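(* Let $\mathbf Y=\mathbf H(z,\mathbf Y)$ be an irreducible system of dimension $m$, with generating function solution $\mathbf Y$ of radius of convergence $\rho$. If $(\rho,\mathbf Y(\rho))$ lies inside the domain of convergence of $\mathbf H$, then there exists a neighborhood of $\boldsymbol\zeta:=(\mathbf Y(\rho),\rho)$ such that Newton's iteration for the characteristic system \[\mathbf Y-\mathbf H(z,\mathbf Y)=\mathbf 0,\qquad \det\Big(\mathrm{Id}-\tfrac{\partial\mathbf H}{\partial\mathbf Y}(z,\mathbf Y)\Big)=0\] in the unknowns $(\mathbf Y,z)$ converges quadratically to $\boldsymbol\zeta$ when started in that neighborhood.
   Context: Let $\mathbf H=(H_1,\dots,H_m)$, written $\mathbf H(z,\mathbf Y)$, be analytic in a neighborhood of $\mathbf 0\in\mathbb C^{m+1}$; its domain of convergence is that of its Taylor series at $\mathbf 0$. The system is well founded when (i) each $H_i$ has nonnegative real Taylor coefficients at $\mathbf 0$; (ii) with $\mathbf U^{[0]}=\mathbf 0$, for $k=0,\dots,m$, $(0,\mathbf U^{[k]})$ lies in the domain of convergence, so that $\mathbf U^{[k+1]}=\mathbf H(0,\mathbf U^{[k]})$ is defined; (iii) $\partial\mathbf H/\partial\mathbf Y$ at $(0,\mathbf U^{[m]})$ is nilpotent. The generating function solution is the unique solution analytic near $0$ with value $\mathbf U^{[m]}$ at $0$; $\mathbf Y(\rho)$ is its limit as $z\to\rho^-$. The system is irreducible if it is well founded, zero-free (no coordinate of the solution identically zero), recursive ($\partial\mathbf H/\partial\mathbf Y$ not nilpotent as a matrix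 of functions), and its dependency graph (edge $i\to j$ when $H_i$ depends on $Y_j$) is strongly connected. *)

(* Defs.v *)
From HB Require Import structures.
From mathcomp Require Import all_boot all_order all_algebra.
From mathcomp Require Import all_classical all_reals all_analysis.
From mathcomp Require Import complex.

Set Implicit Arguments.
Unset Strict Implicit.
Unset Printing Implicit Defensive.
Import Order.TTheory GRing.Theory Num.Theory.
Import numFieldTopology.Exports numFieldNormedType.Exports.

Local Open Scope classical_set_scope.
Local Open Scope ring_scope.
Local Open Scope complex_scope.

(* The complex numbers, named so that [numFieldNormedType] gives them their
   usual topology; [R[i]] itself carries none. In this type [0 <= x] means
   "x is a nonnegative real", and norms [`|x|] are complex-valued. *)
Definition Cplx (R : realType) : numClosedFieldType := R[i].

Definition ofR (R : realType) (x : R) : Cplx R := x%:C.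

Definition modulus (R : realType) (z : Cplx R) : R := complex.Re `|z|.

Section PowerSeries.
Context {R : realType} {n : nat}.
Local Notation C := (Cplx R).
Implicit Types (c : {ffun 'I_n -> nat} -> C) (x : 'rV[C]_n).

Definition monomial (a : {ffun 'I_n -> nat}) x : C := \prod_i x 0 i ^+ a i.

Definition abs_convergent c x : Prop :=
  summable [set: {ffun 'I_n -> nat}]
    (fun a => (modulus (c a * monomial a x))%:E).

(* The sum of the series, taken along the boxes [0, N[^n; the order of
   summation is irrelevant wherever the series converges absolutely. *)
Definition psum c x : C :=
  limn (fun N => \sum_(b : {ffun 'I_n -> 'I_N})
    c [ffun i => b i : nat] * monomial [ffun i => b i : nat] x).

End PowerSeries.

(* [h i a] is the Taylor coefficient at 0 of [H_i] on the monomial of exponent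
   [a]; variable 0 is [z] and variable [1 + j] is [Y_j]. *)
Definition psystem (R : realType) (m : nat) :=
  'I_m -> {ffun 'I_(1 + m) -> nat} -> Cplx R.

Section Systems.
Context {R : realType} {m : nat}.
Local Notation C := (Cplx R).
Implicit Types (h : psystem R m) (z : C) (Y : 'rV[C]_m) (p : 'rV[C]_(1 + m)).

Definition zY z Y : 'rV[C]_(1 + m) := row_mx z%:M Y.

Definition Hfun h p : 'rV[C]_m := \row_i psum (h i) p.

(* The domain of convergence is open: the interior of the set of points of
   absolute convergence. *)
Definition cvg_domain h : set 'rV[C]_(1 + m) :=
  interior [set p | forall i, abs_convergent (h i) p].

(* [jacobian] acts on row vectors, hence is the transpose of the usual one:
   [dHdY h p i j] is the partial derivative of [H_i] with respect to [Y_j]. *)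
Definition dHdY h p : 'M[C]_m := (dsubmx (jacobian (Hfun h) p))^T.

Definition Uiter h (k : nat) : 'rV[C]_m := iter k (fun u => Hfun h (zY 0 u)) 0.

(* [Uiter h 0 = 0], so the second clause contains the analyticity of [H] at 0. *)
Definition well_founded_system h : Prop :=
  [/\ forall i a, 0 <= h i a,
      forall k, (k <= m)%N -> cvg_domain h (zY 0 (Uiter h k)) &
      exists k, dHdY h (zY 0 (Uiter h m)) ^+ k = 0].

(* A vector [y] of univariate power series is given by its coefficients. *)
Definition gf (y : nat -> 'rV[C]_m) z : 'rV[C]_m :=
  limn (series (fun k => z ^+ k *: y k)).

Definition cvg_radius (y : nat -> 'rV[C]_m) : \bar R :=
  ereal_sup [set (modulus z)%:E |
    z in [set z | cvgn (series (fun k => z ^+ k *: y k))]].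

Definition gf_solution h (y : nat -> 'rV[C]_m) : Prop :=
  [/\ (0 < cvg_radius y)%E, gf y 0 = Uiter h m &
      \forall z \near (0 : C),
        cvg_domain h (zY z (gf y z)) /\ gf y z = Hfun h (zY z (gf y z))].

Definition zero_free_system h : Prop :=
  forall y, gf_solution h y -> forall i, exists k, y k 0 i != 0.

Definition recursive_system h : Prop :=
  ~ exists k, forall p, cvg_domain h p -> dHdY h p ^+ k = 0.

Definition depends_on h (i j : 'I_m) : Prop :=
  exists2 p, cvg_domain h p & dHdY h p i j != 0.

Definition strongly_connected_system h : Prop :=
  forall i j, connect [rel i' j' | `[< depends_on h i' j' >]] i j.

Definition irreducible_system h : Prop :=
  [/\ well_founded_system h, zero_free_system h, recursive_system h &
      strongly_connected_system h].

(* The unknowns of the characteristic system come in the order (Y, z). *)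
Definition zY_of_Yz (x : 'rV[C]_(m + 1)) : 'rV[C]_(1 + m) :=
  zY (rsubmx x 0 0) (lsubmx x).

Definition char_system h (x : 'rV[C]_(m + 1)) : 'rV[C]_(m + 1) :=
  row_mx (lsubmx x - Hfun h (zY_of_Yz x))
         (\det (1%:M - dHdY h (zY_of_Yz x)))%:M.

End Systems.

Section Newton.
Context {R : realType} {n : nat}.
Local Notation C := (Cplx R).
Implicit Types (F : 'rV[C]_n -> 'rV[C]_n) (x l : 'rV[C]_n) (D V : set 'rV[C]_n).

(* The row-vector form of x - F'(x)^-1 F(x). *)
Definition newton F x : 'rV[C]_n := x - F x *m invmx (jacobian F x).

(* [F] is only meaningful on [D], and [invmx] only on invertible matrices, so
   that the iteration is defined as long as both side conditions hold. *)
Definition newton_cvg_quadratically D F V l : Prop :=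
  exists c : R, forall x0, V x0 ->
    let x k := iter k (newton F) x0 in
    [/\ forall k, D (x k) /\ jacobian F (x k) \in unitmx,
        x @ \oo --> l &
        forall k, `|x k.+1 - l| <= ofR c * `|x k - l| ^+ 2].

End Newton.

(* Main.v *)
Require Import Defs.
From HB Require Import structures.
From mathcomp Require Import all_boot all_order all_algebra.
From mathcomp Require Import perm.
From mathcomp Require Import all_classical all_reals all_analysis.
From mathcomp Require Import complex ring lra.

Import Order.TTheory GRing.Theory Num.Theory.
Import numFieldTopology.Exports numFieldNormedType.Exports.

Local Open Scope classical_set_scope.
Local Open Scope ring_scope.

Set Implicit Arguments.
Unset Strict Implicit.
Unset Printing Implicit Defensive.

(** Newton's iteration for [F] converges quadratically near a zero where [F] is
    twice differentiable and [F'] is invertible, so the point is that the Jacobian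
    of the characteristic system is invertible at [zeta = (tau, rho)].

    Call [(x, Z)], [x > 0], a supersolution when [H(x, Z) <= Z]. Comparing
    coefficients degree by degree shows that the coefficients of [Y] are
    nonnegative and that every partial sum of [Y] at [x] is bounded by [Z]; hence
    there is no supersolution with [x > rho]. On the other hand, a fixed point
    [(x0, Z0)] for which [1 - A], [A = dH/dY], has a nonnegative inverse is
    perturbed into a supersolution with [x > x0].

    Convexity of [H] gives [A(x, Y x) (tau - Y x) <= tau - Y x] for [x < rho], and
    by compactness there is [w > 0] with [A w <= w] at [zeta]. If [1 - A] were
    invertible there would be a supersolution beyond [rho], so [1 - A] is singular;
    irreducibility then makes its kernels one-dimensional, spanned by positive
    vectors [w] and [u], and its adjugate is a nonzero multiple of [w u^T].
    A kernel vector of the Jacobian vanishes as soon as [u H_z] and [u d2H(w, w)] are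
    nonzero. If [H_z = 0] then [(rho + 1, tau)] is a supersolution; if [H] is affine
    in [Y] then [u H(rho, 0) = u (tau - A tau) = 0] makes [(rho, 0)] a supersolution;
    both are impossible. *)

(** * Limits in the complex numbers *)

(** The fixed point equation of [Y] is only given near 0, and no sign of its coefficients is known
    beforehand. It is carried to every [x] in []0, rho[] without analytic continuation, by comparing
    coefficients along truncations of the series. The obstacle is that the coefficient of degree [N]
    of [Y] occurs on both sides of the equation, through the matrix [A0 = dH/dY] at [(0, y 0)]. As
    [A0] is nilpotent, that coefficient is reached from 0 by finitely many iterations, each of them
    nonnegative and kept below a supersolution. Nonnegativity thus presupposes one supersolution;
    near [z = 0] it comes from the finite sum of the powers of [A0]. Second derivatives of [H] enter
    because the differential of a determinant is given by the cofactors: on [w], the last column of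
    the Jacobian is a multiple of [u d2H(w, w)]. All the differential calculus rests on one
    estimate, a first order expansion with uniform quadratic remainder, stable under sums, products
    and limits. It therefore applies to power series, to their derivatives and to determinants
    alike. *)

Section OrderLimits.
Context {K : numFieldType}.

(** Nonnegativity of [a] amounts to [|a| = a], an equation that passes to the limit even when the
    order of [K] is only partial, as on the complex numbers. *)
Lemma ger0_cvg (T : Type) (F : set_system T) {FF : ProperFilter F}
    (f : T -> K) (a : K) :
  f @ F --> a -> (\forall t \near F, 0 <= f t) -> 0 <= a.
Proof.
move=> fa f0; suff <- : `|a| = a by [].
apply: (@norm_cvg_unique K K (f @ F)) => //.
apply: cvg_trans (cvg_norm fa); apply: near_eq_cvg => /=.
by apply: filterS f0 => t /= /ger0_norm ->.
Qed.

Lemma ler_cvg (T : Type) (F : set_system T) {FF : ProperFilter F}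
    (f g : T -> K) (a b : K) :
  f @ F --> a -> g @ F --> b -> (\forall t \near F, f t <= g t) -> a <= b.
Proof.
move=> fa gb fg; rewrite -subr_ge0.
apply: (ger0_cvg (cvgB gb fa)).
by apply: filterS fg => t /=; rewrite !fctE subr_ge0.
Qed.

Lemma ler_cvg_seq (u v : nat -> K) (a b : K) :
  u @ \oo --> a -> v @ \oo --> b -> (forall n, u n <= v n) -> a <= b.
Proof. by move=> ua vb uv; apply: (ler_cvg ua vb); exact: nearW. Qed.

Lemma ler_cvg_cst (u : nat -> K) (a b : K) :
  u @ \oo --> a -> (forall n, u n <= b) -> a <= b.
Proof. by move=> ua; apply: (ler_cvg_seq ua); exact: cvg_cst. Qed.

Lemma nondecreasing_ler (u : nat -> K) : (forall n, u n <= u n.+1) ->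
  forall m n, (m <= n)%N -> u m <= u n.
Proof.
move=> u1 m n; elim: n => [|n IH]; first by rewrite leqn0 => /eqP->.
by rewrite leq_eqVlt => /predU1P[->//|]; rewrite ltnS => /IH /le_trans; apply.
Qed.

Lemma nondecreasing_cvg_ler (u : nat -> K) (a : K) : (forall n, u n <= u n.+1) ->
  u @ \oo --> a -> forall n, u n <= a.
Proof.
move=> u1 ua n; apply: (ler_cvg (@cvg_cst _ (u n) nat \oo _) ua).
by exists n => // k /= nk; exact: nondecreasing_ler.
Qed.

End OrderLimits.

(** The only completeness used by the analysis below, which is done over an abstract field. An
    inequality makes the difference real and nonnegative, so such a sequence moves along a real
    half-line. *)
Definition monotone_complete (K : numFieldType) : Prop :=
  forall (u : nat -> K) (M : K),
    (forall n, u n <= u n.+1) -> (forall n, u n <= M) -> cvgn u.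

Section MonotoneComplete.
Context {K : numClosedFieldType} (Kc : monotone_complete K).

(* The real and imaginary parts of [u] become monotone after adding [v]. *)
Lemma dominated_cvgn (u v : nat -> K) (M : K) :
    (forall n, `|u n.+1 - u n| <= v n.+1 - v n) -> (forall n, v n <= M) ->
    (forall n, v n \is Num.real) -> cvgn u.
Proof.
move=> uv vM vr.
have vc : cvgn v.
  by apply: Kc vM => n; rewrite -subr_ge0 (le_trans _ (uv n)).
have v1 n : v n <= v n.+1 by rewrite -subr_ge0 (le_trans _ (uv n)).
have u0 n : `|u n - u 0%N| <= v n - v 0%N.
  elim: n => [|n IH]; first by rewrite !subrr normr0.
  rewrite -[u _](subrK (u n)) -addrA -[v n.+1](subrK (v n)) -[leRHS]addrA.
  by apply: le_trans (ler_normD _ _) _; apply: lerD.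
have key (r : K -> K) : (forall z, r z \is Num.real) -> {morph r : x y / x - y} ->
    (forall z, `|r z| <= `|z|) -> cvgn (r \o u).
  move=> rr rB rn.
  suff : cvgn ((fun n => r (u n)) + v).
    move=> c; rewrite [_ \o _](_ : _ = ((fun n => r (u n)) + v) - v); last first.
      by apply/funext => n /=; rewrite !fctE addrK.
    exact: is_cvgB.
  apply: (@Kc _ (r (u 0%N) + (M - v 0%N) + M)) => n.
    rewrite !fctE -subr_ge0 opprD addrACA -rB -lerBlDl sub0r.
    apply: le_trans (uv n); apply: le_trans (rn _).
    by rewrite -normrN real_ler_norm ?rpredN.
  rewrite !fctE; apply: lerD (vM n).
  rewrite -lerBlDl -rB; apply: le_trans (real_ler_norm (rr _)) _.
  by apply: le_trans (rn _) _; apply: le_trans (u0 n) _; rewrite lerD2r.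
have cR : cvgn ((fun z : K => 'Re z) \o u).
  apply: key => [z|x y|z]; [exact: Creal_Re|exact: raddfB|].
  by have [] := leif_normC_Re_Creal z.
have cI : cvgn ((fun z : K => 'Im z) \o u).
  apply: key => [z|x y|z]; [exact: Creal_Im|exact: raddfB|].
  have [+ _] := leif_normC_Re_Creal ('i * z).
  by rewrite ReMil normrN normrM normCi mul1r.
rewrite [u](_ : _ = (fun n => 'Re (u n) + 'i * 'Im (u n))); last first.
  by apply/funext => n; rewrite -Crect.
by apply: is_cvgD => //; apply: is_cvgMr.
Qed.


(** The sequence [- 2 ^ -n] is nondecreasing and bounded, and its limit is fixed by halving, hence
    0. The Archimedean property needed later is thus a consequence of monotone completeness. *)
Lemma cvg_expr_half : (fun n => 2%:R ^- n : K) @ \oo --> (0 : K).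
Proof.
have c : cvgn (fun n => - 2%:R ^- n : K).
  apply: (@Kc _ 0) => n; last by rewrite oppr_le0 invr_ge0 exprn_ge0.
  rewrite lerN2 lef_pV2 ?posrE ?exprn_gt0 // exprS ler_peMl ?exprn_ge0 //.
  by rewrite ler1n.
have /cvgN := c; rewrite opprK => {}c.
have e : - limn (fun n => - 2%:R ^- n : K) = 0; last by rewrite -e.
set l := - _ in c *.
have c2 : (fun n => 2%:R^-1 * 2%:R ^- n : K) @ \oo --> 2%:R^-1 * l.
  exact: cvgMr.
have : 2%:R^-1 * l = l.
  apply: (@norm_cvg_unique K K _ _ _ _ c2).
  move: c; rewrite -cvg_shiftS => /=; apply: cvg_trans.
  by apply: near_eq_cvg; apply: nearW => n /=; rewrite exprS invfM.
move=> /(congr1 (fun x => 2%:R * x)); rewrite mulrA divff ?pnatr_eq0 // mul1r.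
by rewrite mulr_natl mulr2n => /(congr1 (fun x => x - l)); rewrite subrr addrK.
Qed.

End MonotoneComplete.

(** * Real numbers inside the complex numbers *)

Section ComplexNumbers.
Context {R : realType}.
Local Notation C := (Cplx R).
Implicit Types (x y : R) (z : C).

Fact ofR_is_zmod_morphism : zmod_morphism (@ofR R).
Proof. by move=> x y; rewrite /ofR rmorphB. Qed.
HB.instance Definition _ :=
  GRing.isZmodMorphism.Build R (Cplx R) (@ofR R) ofR_is_zmod_morphism.

Fact ofR_is_monoid_morphism : monoid_morphism (@ofR R).
Proof. by split=> [|x y]; rewrite /ofR ?rmorph1 ?rmorphM. Qed.
HB.instance Definition _ :=
  GRing.isMonoidMorphism.Build R (Cplx R) (@ofR R) ofR_is_monoid_morphism.

Lemma ler_ofR x y : (ofR x <= ofR y) = (x <= y).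
Proof. exact: lecR. Qed.

Lemma ltr_ofR x y : (ofR x < ofR y) = (x < y).
Proof. exact: ltcR. Qed.

Lemma ofR_ge0 x : (0 <= ofR x) = (0 <= x).
Proof. by rewrite -[0]/(ofR 0) ler_ofR. Qed.

Lemma ofR_gt0 x : (0 < ofR x) = (0 < x).
Proof. by rewrite -[0]/(ofR 0) ltr_ofR. Qed.

Lemma ofR_inj : injective (@ofR R).
Proof. exact: fmorph_inj. Qed.

Lemma ge0_ofR z : 0 <= z -> z = ofR (complex.Re z).
Proof. by case: z => a b; rewrite lecE /= => /andP[/eqP-> _]. Qed.

Lemma ge0_ofRP z : 0 <= z -> exists2 x, 0 <= x & z = ofR x.
Proof.
move=> z0; exists (complex.Re z); last exact: ge0_ofR.
by rewrite -ofR_ge0 -ge0_ofR.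
Qed.

Lemma ofR_modulus z : ofR (modulus z) = `|z|.
Proof. by rewrite -ge0_ofR. Qed.

Lemma modulus_ofR x : 0 <= x -> modulus (ofR x) = x.
Proof. by move=> x0; apply: ofR_inj; rewrite ofR_modulus ger0_norm // ofR_ge0. Qed.

Lemma modulus_ge0 z : 0 <= modulus z.
Proof. by rewrite -ofR_ge0 ofR_modulus. Qed.

Lemma normr_ofR x : `|ofR x| = ofR `|x|.
Proof.
have [x0|x0] := leP 0 x; first by rewrite !ger0_norm ?ofR_ge0.
by rewrite (ltr0_norm x0) -normrN -rmorphN ger0_norm // ofR_ge0 oppr_ge0 ltW.
Qed.

Lemma continuous_ofR : continuous (@ofR R : R -> C).
Proof.
move=> x; apply/cvgrPdist_lt => e e0.
have [d _ ed] := ge0_ofRP (ltW e0); move: e0; rewrite ed ofR_gt0 => d0.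
have /cvgrPdist_lt /(_ _ d0) : y @[y --> x] --> x by exact: cvg_id.
by apply: filterS => y; rewrite -rmorphB normr_ofR ltr_ofR.
Qed.

(** The differences [u n - u 0] are nonnegative reals, so the claim reduces to monotone convergence
    in [R]. *)
Lemma Cplx_complete : monotone_complete C.
Proof.
move=> u M u1 uM; set v := fun n => complex.Re (u n - u 0%N).
have uv n : u n = u 0%N + ofR (v n).
  by rewrite /v -ge0_ofR ?subrKC // subr_ge0 nondecreasing_ler.
have vl : v @ \oo --> limn v.
  apply: nondecreasing_is_cvgn.
    move=> m n mn; rewrite -ler_ofR -(lerD2l (u 0%N)) -!uv.
    exact: nondecreasing_ler.
  exists (complex.Re (M - u 0%N)) => _ [n _ <-].
  rewrite -ler_ofR -ge0_ofR; last by rewrite subr_ge0.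
  by rewrite lerBrDl -uv.
apply/cvg_ex; exists (u 0%N + ofR (limn v)).
rewrite [u in u @ _](_ : _ = (fun n => u 0%N + ofR (v n))); last by apply/funext.
apply: cvgD; first exact: cvg_cst.
by apply: continuous_cvg vl; exact: continuous_ofR.
Qed.

End ComplexNumbers.

(** * Box sums and second order approximation *)

Section BoxSums.
Context {n : nat}.
Local Notation expo := {ffun 'I_n -> nat}.

(** The same boxes of exponents as in [psum], so that its partial sums are box sums. *)
Definition bsum (V : nmodType) (N : nat) (F : expo -> V) : V :=
  \sum_(b : {ffun 'I_n -> 'I_N}) F [ffun i => b i : nat].

Lemma bsum_widen (V : nmodType) N (F : expo -> V) :
  \sum_(b : {ffun 'I_n -> 'I_N.+1} | [forall i, (b i < N)%N]) F [ffun i => b i : nat]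
  = bsum N F.
Proof.
pose h (b : {ffun 'I_n -> 'I_N}) : {ffun 'I_n -> 'I_N.+1} :=
  [ffun i => widen_ord (leqnSn N) (b i)].
have h_inj : injective h.
  move=> b b' /ffunP e; apply/ffunP => i; have := e i.
  by rewrite !ffunE => /(congr1 val) /= ?; apply: val_inj.
rewrite (eq_bigl (fun b => b \in imset h (mem predT))); last first.
  move=> b; apply/forallP/imsetP => [Pb|[c _ ->] i]; last by rewrite ffunE /=.
  exists [ffun i => Ordinal (Pb i)] => //.
  by apply/ffunP => i; rewrite !ffunE; apply: val_inj.
rewrite big_imset /=; last exact: in2W.
by apply: eq_bigr => b _; congr F; apply/ffunP => i; rewrite !ffunE.
Qed.

Lemma bsumS (V : nmodType) N (F : expo -> V) :
  bsum N.+1 F = bsum N F +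
    \sum_(b : {ffun 'I_n -> 'I_N.+1} | ~~ [forall i, (b i < N)%N])
       F [ffun i => b i : nat].
Proof.
rewrite [LHS](bigID (fun b : {ffun 'I_n -> 'I_N.+1} => [forall i, (b i < N)%N])).
by congr (_ + _); exact: bsum_widen.
Qed.

Lemma bsum_term (V : nmodType) (F : expo -> V) (a : expo) :
  exists N, exists b : {ffun 'I_n -> 'I_N},
    a = [ffun i => b i : nat] /\
    bsum N F = F a + \sum_(b' | b' != b) F [ffun i => b' i : nat].
Proof.
exists (\max_i a i).+1, [ffun i => inord (a i)].
have ea : a = [ffun i => [ffun j => inord (a j) : 'I_(\max_i a i).+1] i : nat].
  by apply/ffunP => i; rewrite !ffunE inordK // ltnS (leq_bigmax i).
by split=> //; rewrite /bsum (bigD1 [ffun i => inord (a i)]) //= -ea.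
Qed.

Section Normed.
Context {K : numClosedFieldType}.
Implicit Types F G : expo -> K.

(** Absolute summability of the family, in a form that needs neither suprema nor extended reals. *)
Definition bbounded F := exists M, forall N, bsum N (fun a => `|F a|) <= M.

Lemma ler_bsum N F G : (forall a, F a <= G a) -> bsum N F <= bsum N G.
Proof. by move=> FG; apply: ler_sum. Qed.

Lemma bsum_ge0 N F : (forall a, 0 <= F a) -> 0 <= bsum N F.
Proof. by move=> F0; apply: sumr_ge0. Qed.

Lemma ler_norm_bsum N F : `|bsum N F| <= bsum N (fun a => `|F a|).
Proof. exact: ler_norm_sum. Qed.

Lemma bsum_nondecreasing F : (forall a, 0 <= F a) -> forall N, bsum N F <= bsum N.+1 F.
Proof. by move=> F0 N; rewrite bsumS lerDl sumr_ge0. Qed.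

Lemma bsum_ge_term F (a : expo) : (forall a, 0 <= F a) -> exists N, F a <= bsum N F.
Proof.
move=> F0; have [N [b [_ e]]] := bsum_term F a.
by exists N; rewrite e lerDl sumr_ge0.
Qed.

Lemma bsumZ N (k : K) F : bsum N (fun a => k * F a) = k * bsum N F.
Proof. by rewrite /bsum mulr_sumr. Qed.

Lemma bbounded_le F G (k : K) : 0 <= k -> (forall a, `|F a| <= k * `|G a|) ->
  bbounded G -> bbounded F.
Proof.
move=> k0 FG [M GM]; exists (k * M) => N.
apply: le_trans (ler_bsum _ FG) _; rewrite bsumZ.
exact: ler_wpM2l.
Qed.

Definition btot F : K := limn (fun N => bsum N F).

Hypothesis Kc : monotone_complete K.

Lemma cvg_bsum F : bbounded F -> (fun N => bsum N F) @ \oo --> btot F.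
Proof.
case=> M FM; apply: (@dominated_cvgn K Kc _ (fun N => bsum N (fun a => `|F a|)) M) => //.
  by move=> N; rewrite !bsumS ![_ + _ - _]addrAC !subrr !add0r; exact: ler_norm_sum.
by move=> N; rewrite ger0_real // bsum_ge0.
Qed.

Lemma ler_norm_btot F M : (forall N, bsum N (fun a => `|F a|) <= M) -> `|btot F| <= M.
Proof.
move=> FM; have c : bbounded F by exists M.
apply: (ler_cvg_cst (cvg_norm (cvg_bsum c))) => N.
exact: le_trans (ler_norm_bsum _ _) (FM N).
Qed.

Lemma bsum_le_btot F : (forall a, 0 <= F a) -> bbounded F -> forall N, bsum N F <= btot F.
Proof.
move=> F0 bF; apply: nondecreasing_cvg_ler; first exact: bsum_nondecreasing.
exact: cvg_bsum.
Qed.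

Lemma btot_ge0 F : (forall a, 0 <= F a) -> bbounded F -> 0 <= btot F.
Proof. by move=> F0 bF; apply: le_trans (bsum_le_btot F0 bF 0); exact: bsum_ge0. Qed.

Lemma term_le_btot F a : (forall a, 0 <= F a) -> bbounded F -> F a <= btot F.
Proof.
move=> F0 bF; have [N /le_trans] := bsum_ge_term a F0; apply.
exact: bsum_le_btot.
Qed.

Lemma btot_le F M : bbounded F -> (forall N, bsum N F <= M) -> btot F <= M.
Proof. by move=> bF; apply: ler_cvg_cst (cvg_bsum bF). Qed.

Lemma btot0 F : (forall a, F a = 0) -> btot F = 0.
Proof.
move=> F0; apply/eqP; rewrite -normr_le0; apply: ler_norm_btot => N.
by rewrite /bsum big1 // => b _; rewrite F0 normr0.
Qed.

End Normed.
End BoxSums.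

(** The inductive step of the Leibniz rule. The factor left out is singled out by its value, whence
    [i \notin r]: a repeated index would be removed several times. *)
Lemma sum_prod_others_cons (K : comNzRingType) (I : eqType) (i : I) (r : seq I) (d g : I -> K) :
  i \notin r ->
  \sum_(k <- i :: r) d k * \prod_(j <- i :: r | j != k) g j =
  d i * (\prod_(j <- r) g j) + g i * (\sum_(k <- r) d k * \prod_(j <- r | j != k) g j).
Proof.
move=> ir; rewrite big_cons; congr (_ + _).
  rewrite big_cons eqxx /=; congr (_ * _); rewrite [RHS]big_seq_cond [LHS]big_seq_cond.
  by apply: eq_bigl => j; case: eqVneq => [->|]; rewrite ?(negPf ir) ?andbT.
rewrite mulr_sumr; apply: eq_big_seq => k kr.
rewrite big_cons; case: eqVneq => [e|_]; first by rewrite -e in kr; rewrite kr in ir.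
by rewrite mulrCA.
Qed.

Section SecondOrderApproximation.
Context {K : numClosedFieldType}.
Implicit Types l b c : K.

(* [g'] and [g] are the values of a function at two nearby points and [dg] is
   its differential at the second point, applied to the displacement. *)
Definition taylor2 l b (g' g dg : K) : Prop :=
  [/\ `|g'| <= b, `|g| <= b, `|g' - g| <= l * b, `|dg| <= l * b
    & `|g' - g - dg| <= l ^+ 2 * b].

Lemma taylor2_ge0 l b g' g dg : taylor2 l b g' g dg -> 0 <= b.
Proof. by case=> h _ _ _ _; apply: le_trans h. Qed.

Lemma taylor2W l b l' b' g' g dg : 0 <= l -> l <= l' -> b <= b' ->
  taylor2 l b g' g dg -> taylor2 l' b' g' g dg.
Proof.
move=> l0 ll bb t; have b0 := taylor2_ge0 t.
have lb : l * b <= l' * b' by apply: ler_pM.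
case: t => h1 h2 h3 h4 h5; split; do ?[exact: le_trans lb|exact: le_trans bb].
apply: le_trans h5 _; apply: ler_pM; rewrite ?exprn_ge0 //.
by rewrite lerXn2r // nnegrE ?(le_trans l0).
Qed.

Lemma taylor2D l b c g' g dg h' h dh :
  taylor2 l b g' g dg -> taylor2 l c h' h dh ->
  taylor2 l (b + c) (g' + h') (g + h) (dg + dh).
Proof.
case=> g1 g2 g3 g4 g5 [h1 h2 h3 h4 h5].
have D (u v p q : K) : `|u| <= p -> `|v| <= q -> `|u + v| <= p + q.
  by move=> up vq; apply: le_trans (ler_normD _ _) _; apply: lerD.
split; rewrite ?mulrDr; [exact: D|exact: D| |exact: D|].
  by rewrite opprD addrACA; apply: D.
have -> : g' + h' - (g + h) - (dg + dh) = (g' - g - dg) + (h' - h - dh) by ring.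
exact: D.
Qed.

Lemma taylor2_cst l c : 0 <= l -> taylor2 l `|c| c c 0.
Proof. by move=> l0; split; rewrite ?subrr ?subr0 ?normr0 ?mulr_ge0 ?exprn_ge0. Qed.

(** Stating all bounds relative to a common size [b] makes the estimate multiplicative: the rates
    [l], [k] add up and the sizes multiply, because [l^2 + l k + k^2 <= (l + k)^2]. *)
Lemma taylor2M l b g' g dg k c h' h dh : 0 <= l -> 0 <= k ->
  taylor2 l b g' g dg -> taylor2 k c h' h dh ->
  taylor2 (l + k) (b * c) (g' * h') (g * h) (dg * h + g * dh).
Proof.
move=> l0 k0 tg th; have b0 := taylor2_ge0 tg; have c0 := taylor2_ge0 th.
case: tg th => g1 g2 g3 g4 g5 [h1 h2 h3 h4 h5].
have M (u v p q : K) : `|u| <= p -> `|v| <= q -> `|u * v| <= p * q.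
  by move=> up vq; rewrite normrM ler_pM.
split; [exact: M|exact: M| | |].
- have -> : g' * h' - g * h = (g' - g) * h' + g * (h' - h).
    by rewrite mulrBl mulrBr addrA subrK.
  apply: le_trans (ler_normD _ _) _; rewrite [leRHS]mulrDl; apply: lerD.
    by rewrite mulrA; apply: M.
  by rewrite mulrCA; apply: M.
- apply: le_trans (ler_normD _ _) _; rewrite [leRHS]mulrDl; apply: lerD.
    by rewrite mulrA; apply: M.
  by rewrite mulrCA; apply: M.
- have -> : g' * h' - g * h - (dg * h + g * dh) =
     (g' - g - dg) * h' + dg * (h' - h) + g * (h' - h - dh) by ring.
  apply: le_trans (_ : l ^+ 2 * b * c + (l * b) * (k * c) + b * (k ^+ 2 * c) <= _).
    apply: le_trans (ler_normD _ _) _; apply: lerD; last exact: M.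
    by apply: le_trans (ler_normD _ _) _; apply: lerD; apply: M.
  rewrite -subr_ge0; have -> : (l + k) ^+ 2 * (b * c) -
    (l ^+ 2 * b * c + l * b * (k * c) + b * (k ^+ 2 * c)) = l * k * (b * c) by ring.
  by rewrite !mulr_ge0.
Qed.

Lemma taylor2_sum (I : Type) (r : seq I) l (b g' g dg : I -> K) : 0 <= l ->
  (forall i, taylor2 l (b i) (g' i) (g i) (dg i)) ->
  taylor2 l (\sum_(i <- r) b i) (\sum_(i <- r) g' i) (\sum_(i <- r) g i)
            (\sum_(i <- r) dg i).
Proof.
move=> l0 H; elim: r => [|i r IH]; last by rewrite !big_cons; apply: taylor2D.
by rewrite !big_nil -[X in taylor2 l X](normr0 K); exact: taylor2_cst.
Qed.

Lemma taylor2_prod (I : eqType) (r : seq I) (l b g' g dg : I -> K) :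
  uniq r -> (forall i, 0 <= l i) ->
  (forall i, taylor2 (l i) (b i) (g' i) (g i) (dg i)) ->
  taylor2 (\sum_(i <- r) l i) (\prod_(i <- r) b i) (\prod_(i <- r) g' i)
    (\prod_(i <- r) g i)
    (\sum_(i <- r) dg i * \prod_(j <- r | j != i) g j).
Proof.
move=> + l0 H; elim: r => [_|i r IH /= /andP[ir ur]].
  by rewrite !big_nil -[X in taylor2 _ X](normr1 K); exact: taylor2_cst.
rewrite sum_prod_others_cons //.
rewrite ![in X in taylor2 X]big_cons ![in X in taylor2 _ X]big_cons.
rewrite (big_cons _ _ _ _ _ g') (big_cons _ _ _ _ _ g).
apply: taylor2M => //; last exact: IH.
exact: sumr_ge0.
Qed.

End SecondOrderApproximation.

(** * Term by term differentiation of power series *)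

Section FallingMonomials.
Context {K : numClosedFieldType}.
Implicit Types (s e x : K).

(** The [k]-th derivative of [x ^ n]. *)
Definition ffmon (n k : nat) x : K := (n ^_ k)%:R * x ^+ (n - k).

(** A Cauchy estimate by algebra: up to the factor [k! / e ^ k], the left side is a single term of
    the binomial expansion of [(s + e) ^ n]. *)
Lemma ffact_exp_le (n k : nat) s e : 0 <= s -> 0 < e ->
  (n ^_ k)%:R * s ^+ (n - k) <= k`!%:R / e ^+ k * (s + e) ^+ n.
Proof.
move=> s0 e0; have e0' := ltW e0.
rewrite mulrAC ler_pdivlMr ?exprn_gt0 //.
have [nk|kn] := ltnP n k.
  by rewrite ffact_small // !mul0r mulr_ge0 // exprn_ge0 // addr_ge0.
rewrite exprDn (bigD1 (Ordinal (kn : (k < n.+1)%N))) //= -bin_ffact natrM.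
have -> : 'C(n, k)%:R * k`!%:R * s ^+ (n - k) * e ^+ k =
  k`!%:R * (s ^+ (n - k) * e ^+ k *+ 'C(n, k)) by rewrite -mulr_natl; ring.
rewrite ler_wpM2l // lerDl sumr_ge0 // => i _.
by rewrite mulrn_wge0 // mulr_ge0 // exprn_ge0.
Qed.

Lemma normB_exp_le (p : nat) s x x' : `|x| <= s -> `|x'| <= s ->
  `|x' ^+ p - x ^+ p| <= `|x' - x| * (p%:R * s ^+ p.-1).
Proof.
move=> xs xs'; have s0 : 0 <= s by apply: le_trans xs.
elim: p => [|p IH]; first by rewrite subrr normr0 mul0r mulr0.
have -> : x' ^+ p.+1 - x ^+ p.+1 = x' * (x' ^+ p - x ^+ p) + (x' - x) * x ^+ p.
  by rewrite !exprS; ring.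
apply: le_trans (ler_normD _ _) _; rewrite !normrM /=.
rewrite -addn1 natrD mulrDl mul1r mulrDr; apply: lerD; last first.
  by rewrite ler_wpM2l // normrX lerXn2r ?nnegrE.
apply: le_trans (ler_pM _ _ xs' IH) _ => //.
case: p {IH} => [|p]; first by rewrite !mul0r !mulr0.
by rewrite /= exprS; have -> : s * (`|x' - x| * (p.+1%:R * s ^+ p)) =
  `|x' - x| * (p.+1%:R * (s * s ^+ p)) by ring.
Qed.

Lemma normB_exp_le2 (p : nat) s x x' : `|x| <= s -> `|x'| <= s ->
  `|x' ^+ p - x ^+ p - (x' - x) * (p%:R * x ^+ p.-1)| <=
  `|x' - x| ^+ 2 * (p%:R * p.-1%:R * s ^+ p.-2).
Proof.
move=> xs xs'; have s0 : 0 <= s by apply: le_trans xs.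
elim: p => [|p IH]; first by rewrite subrr !mul0r mulr0 subrr normr0.
have -> : x' ^+ p.+1 - x ^+ p.+1 - (x' - x) * (p.+1%:R * x ^+ p.+1.-1) =
  x' * (x' ^+ p - x ^+ p - (x' - x) * (p%:R * x ^+ p.-1)) +
  (x' - x) ^+ 2 * (p%:R * x ^+ p.-1).
  case: p {IH} => [|p] /=; first by rewrite !expr0 !mul0r; ring.
  by rewrite -[p.+2%:R]natr1 !exprS; ring.
apply: le_trans (ler_normD _ _) _; rewrite !normrM normrX /=.
case: p IH => [|p] IH /=.
  by rewrite !expr0 subrr !mul0r !mulr0 !normr0 !(mulr0, mul0r) subrr normr0 mulr0 addr0.
apply: le_trans (lerD (ler_pM _ _ xs' IH) (_ : _ <= `|x' - x| ^+ 2 * (p.+1%:R * s ^+ p))) _ => //=.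
  by rewrite -expr2 ler_wpM2l ?exprn_ge0 // normr_nat ler_wpM2l // lerXn2r ?nnegrE.
case: p {IH} => [|p] /=.
  rewrite !expr0 !(mulr0, mul0r, mulr1, add0r) -[leLHS]mulr1 ler_wpM2l ?exprn_ge0 //.
  by rewrite ler1n.
have -> : s * (`|x' - x| ^+ 2 * (p.+2%:R * p.+1%:R * s ^+ p)) +
   `|x' - x| ^+ 2 * (p.+2%:R * s ^+ p.+1) =
   `|x' - x| ^+ 2 * (p.+2%:R * p.+2%:R * s ^+ p.+1).
  by rewrite (exprS s p) -[p.+2%:R]natr1; move: (p.+1%:R : K) => q; ring.
by rewrite ler_wpM2l ?exprn_ge0 // ler_wpM2r ?exprn_ge0 // ler_wpM2r // ler_nat.
Qed.

(** By the Cauchy estimate, [b] bounds the derivative of order [k], [(k + 1) / e * b] the next one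
    and [(k + 1) (k + 2) / e ^ 2 * b] the one after. The single rate [(k + 2) / e] covers both. *)
Lemma taylor2_ffmon (n k : nat) s e x x' : `|x| <= s -> `|x'| <= s -> 0 < e ->
  taylor2 (k.+2%:R / e * `|x' - x|) (k`!%:R / e ^+ k * (s + e) ^+ n)
    (ffmon n k x') (ffmon n k x) ((x' - x) * ffmon n k.+1 x).
Proof.
move=> xs xs' e0; have s0 : 0 <= s by apply: le_trans xs.
have e0' := ltW e0; have en0 : e != 0 by rewrite gt_eqF.
set h := x' - x; set b := _ * (s + e) ^+ n.
have b0 : 0 <= b by rewrite mulr_ge0 ?exprn_ge0 ?addr_ge0 ?divr_ge0 ?exprn_ge0.
have F0 z : `|z| <= s -> `|ffmon n k z| <= b.
  move=> zs; apply: le_trans (ffact_exp_le n k s0 e0).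
  rewrite normrM normr_nat ler_wpM2l // normrX lerXn2r ?nnegrE //.
have F1 : (n ^_ k.+1)%:R * s ^+ (n - k.+1) <= k.+1%:R / e * b.
  apply: le_trans (ffact_exp_le n k.+1 s0 e0) _.
  by rewrite /b factS natrM exprS invfM le_eqVlt; apply/orP; left; apply/eqP; ring.
have F2 : (n ^_ k.+2)%:R * s ^+ (n - k.+2) <= (k.+2%:R / e) ^+ 2 * b.
  apply: le_trans (ffact_exp_le n k.+2 s0 e0) _.
  rewrite !factS !natrM !exprS !invfM expr0 mulr1.
  set q := k.+2%:R * e^-1 * e^-1 * b.
  have -> : k.+2%:R * (k.+1%:R * k`!%:R) * (e^-1 * (e^-1 * (e ^+ k)^-1)) * (s + e) ^+ n
     = k.+1%:R * q by rewrite /q /b; ring.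
  have -> : k.+2%:R / e * (k.+2%:R / e) * b = k.+2%:R * q by rewrite /q; ring.
  have q0 : 0 <= q by apply: mulr_ge0 => //; rewrite !divr_ge0.
  by rewrite ler_wpM2r ?ler_nat.
have k12 : k.+1%:R / e * b <= k.+2%:R / e * b.
  by rewrite !ler_wpM2r ?invr_ge0 ?ler_nat.
have nk1 : (n - k.+1 = (n - k).-1)%N by rewrite subnS.
have nk2 : (n - k.+2 = (n - k).-2)%N by rewrite !subnS.
split; [exact: F0|exact: F0| | |].
- rewrite /ffmon -mulrBr normrM normr_nat.
  apply: le_trans (ler_wpM2l _ (normB_exp_le (n - k) xs xs')) _ => //.
  rewrite mulrCA mulrAC mulrC ler_wpM2r //; apply: le_trans k12; apply: le_trans F1.
  by rewrite ffactnSr natrM nk1 mulrA.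
- rewrite normrM mulrAC mulrC ler_wpM2r //; apply: le_trans k12; apply: le_trans F1.
  by rewrite /ffmon normrM normr_nat ler_wpM2l // normrX lerXn2r ?nnegrE.
- have -> : ffmon n k x' - ffmon n k x - h * ffmon n k.+1 x = (n ^_ k)%:R *
    (x' ^+ (n - k) - x ^+ (n - k) - h * ((n - k)%:R * x ^+ (n - k).-1)).
    by rewrite /ffmon ffactnSr natrM nk1; ring.
  rewrite normrM normr_nat.
  apply: le_trans (ler_wpM2l _ (normB_exp_le2 (n - k) xs xs')) _ => //.
  have -> : (k.+2%:R / e * `|h|) ^+ 2 * b = `|h| ^+ 2 * ((k.+2%:R / e) ^+ 2 * b) by ring.
  rewrite mulrCA ler_wpM2l ?exprn_ge0 //; apply: le_trans F2.
  by rewrite !ffactnSr !natrM nk2 nk1 !mulrA.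
Qed.

End FallingMonomials.

Section RowNorm.
Context {K : numDomainType} {n : nat}.
Implicit Types x : 'rV[K]_n.

Lemma ler_coord_norm x i : `|x 0 i| <= `|x|.
Proof.
rewrite -[`|x|]/(mx_norm x) mx_normE -[leLHS]nngE num_le.
exact: (le_bigmax _ (fun ij : 'I_1 * 'I_n => `|x ij.1 ij.2|%:nng) (0, i)).
Qed.

Lemma norm_row_le x (b : K) : 0 <= b -> (forall i, `|x 0 i| <= b) -> `|x| <= b.
Proof.
move=> b0 xb; have [x0|/mx_norm_neq0[[i j]]] := eqVneq (mx_norm x) 0.
  by rewrite -[`|x|]/(mx_norm x) x0.
by rewrite -[`|x|]/(mx_norm x) => -> /=; rewrite (ord1 i).
Qed.

End RowNorm.

Section PartialDerivatives.
Context {K : numClosedFieldType} {n : nat}.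
Local Notation expo := {ffun 'I_n -> nat}.
Implicit Types (al : 'I_n -> nat) (a : expo) (x : 'rV[K]_n) (c : expo -> K).

Definition succ_at (j : 'I_n) al : 'I_n -> nat := fun i => (al i + (i == j))%N.

(** The partial derivative of multi-order [al] of the monomial with exponent [a]. *)
Definition dmon al a x : K := \prod_i ffmon (a i) (al i) (x 0 i).

(* The power series [c], differentiated term by term [al i] times in each variable [i]. *)
Definition psder al c x : K := btot (fun a => c a * dmon al a x).

Definition spow (s : 'I_n -> K) a : K := \prod_i s i ^+ a i.

Lemma cvgr_sum (I : Type) (r : seq I) (u : I -> nat -> K) (l : I -> K) :
  (forall i, u i @ \oo --> l i) ->
  (fun N => \sum_(i <- r) u i N) @ \oo --> \sum_(i <- r) l i.
Proof.
move=> ul; elim: r => [|i r IH].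
  rewrite big_nil [X in X @ _](_ : _ = fun=> 0); first exact: cvg_cst.
  by apply/funext => N; rewrite big_nil.
rewrite big_cons [X in X @ _](_ : _ = u i + (fun N => \sum_(i <- r) u i N)).
  by apply: cvgD.
by apply/funext => N; rewrite big_cons.
Qed.

Lemma taylor2_dmon al a (s : 'I_n -> K) e x x' :
  (forall i, `|x 0 i| <= s i) -> (forall i, `|x' 0 i| <= s i) -> 0 < e ->
  taylor2 (\sum_i (al i).+2%:R / e * `|x' - x|)
          (\prod_i ((al i)`!%:R / e ^+ al i) * spow (fun i => s i + e) a)
          (dmon al a x') (dmon al a x)
          (\sum_j (x' - x) 0 j * dmon (succ_at j al) a x).
Proof.
move=> xs xs' e0; rewrite /spow -big_split /=.
have l0 (i : 'I_n) (z : K) : 0 <= z -> 0 <= (al i).+2%:R / e * z.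
  by move=> z0; rewrite mulr_ge0 // divr_ge0 // ltW.
have := @taylor2_prod K _ (index_enum 'I_n) _ _ _ _ _ (index_enum_uniq _)
  (fun i => l0 i _ (normr_ge0 (x' 0 i - x 0 i)))
  (fun i => taylor2_ffmon (a i) (al i) (xs i) (xs' i) e0).
rewrite /dmon [\sum_(i <- _) (x' 0 i - _) * _ * _](_ : _ =
   \sum_j (x' - x) 0 j * \prod_i ffmon (a i) (succ_at j al i) (x 0 i)); last first.
  apply: eq_bigr => j _; rewrite !mxE -mulrA; congr (_ * _).
  rewrite [RHS](bigD1 j) //= /succ_at eqxx addn1; congr (_ * _).
  by apply: eq_bigr => i ij; rewrite (negPf ij) addn0.
apply: taylor2W => //; first by apply: sumr_ge0 => i _; exact: l0.
apply: ler_sum => i _; rewrite ler_wpM2l ?divr_ge0 ?(ltW e0) //.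
by have := ler_coord_norm (x' - x) i; rewrite !mxE.
Qed.

Lemma taylor2_cvg (l b : K) (g' g dg : nat -> K) (G' G dG : K) :
  (forall N, taylor2 l b (g' N) (g N) (dg N)) ->
  g' @ \oo --> G' -> g @ \oo --> G -> dg @ \oo --> dG -> taylor2 l b G' G dG.
Proof.
move=> t c' c dc; split.
- by apply: (ler_cvg_cst (cvg_norm c')) => N; case: (t N).
- by apply: (ler_cvg_cst (cvg_norm c)) => N; case: (t N).
- by apply: (ler_cvg_cst (cvg_norm (cvgB c' c))) => N; case: (t N).
- by apply: (ler_cvg_cst (cvg_norm dc)) => N; case: (t N).
- by apply: (ler_cvg_cst (cvg_norm (cvgB (cvgB c' c) dc))) => N; case: (t N).
Qed.

Hypothesis Kc : monotone_complete K.

Section Polydisc.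
Variables (c : expo -> K) (s : 'I_n -> K) (e : K).
Hypotheses (s0 : forall i, 0 <= s i) (e0 : 0 < e).
Hypothesis cb : bbounded (fun a => c a * spow (fun i => s i + e) a).

Lemma bbounded_dmon al x : (forall i, `|x 0 i| <= s i) ->
  bbounded (fun a => c a * dmon al a x).
Proof.
move=> xs; set k := \prod_i ((al i)`!%:R / e ^+ al i) : K.
have k0 : 0 <= k by rewrite prodr_ge0 // => i _; rewrite divr_ge0 // exprn_ge0 // ltW.
apply: (@bbounded_le _ _ _ _ k k0 _ cb) => a; rewrite !normrM mulrCA ler_wpM2l //.
have [+ _ _ _ _] := taylor2_dmon al a xs xs e0; move=> /le_trans; apply.
apply: ler_wpM2l => //; rewrite real_ler_norm // ger0_real //.
by apply: prodr_ge0 => i _; rewrite exprn_ge0 // addr_ge0 // ltW.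
Qed.

(** The sizes in the termwise estimate are a fixed multiple of [spow (s + e)], summable against [c],
    and the rates do not depend on the exponent. Summing over boxes and letting them grow justifies
    termwise differentiation and bounds the remainder at once. *)
Lemma taylor2_psder al : exists L B, 0 <= L /\ forall x x',
  (forall i, `|x 0 i| <= s i) -> (forall i, `|x' 0 i| <= s i) ->
  taylor2 (L * `|x' - x|) B (psder al c x') (psder al c x)
    (\sum_j (x' - x) 0 j * psder (succ_at j al) c x).
Proof.
case: (cb) => M cM.
exists (\sum_i (al i).+2%:R / e), (\prod_i ((al i)`!%:R / e ^+ al i) * M).
split=> [|x x' xs xs'].
  by apply: sumr_ge0 => i _; rewrite divr_ge0 // ltW.
have k0 : 0 <= \prod_i ((al i)`!%:R / e ^+ al i) :> K.
  by rewrite prodr_ge0 // => i _; rewrite divr_ge0 // exprn_ge0 // ltW.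
have L0 : 0 <= (\sum_i (al i).+2%:R / e) * `|x' - x|.
  by rewrite mulr_ge0 // sumr_ge0 // => i _; rewrite divr_ge0 // ltW.
apply: (@taylor2_cvg _ _ (fun N => bsum N (fun a => c a * dmon al a x'))
  (fun N => bsum N (fun a => c a * dmon al a x))
  (fun N => \sum_j (x' - x) 0 j * bsum N (fun a => c a * dmon (succ_at j al) a x))).
- move=> N.
  rewrite [X in taylor2 _ _ _ _ X](_ : _ = bsum N (fun a => \sum_j (x' - x) 0 j *
    (c a * dmon (succ_at j al) a x))); last first.
    by rewrite /bsum exchange_big /=; apply: eq_bigr => j _; rewrite mulr_sumr.
  apply: taylor2W (lexx _) (ler_wpM2l k0 (cM N)) _ => //.
  rewrite -bsumZ; apply: taylor2_sum => // b.
  set a := [ffun _ => _]; have t := taylor2_dmon al a xs xs' e0.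
  have tc := taylor2M (lexx 0) _ (taylor2_cst (c a) (lexx 0)) t.
  have := tc; rewrite -mulr_suml => /(_ L0); rewrite add0r mul0r add0r.
  have -> : \sum_j (x' - x) 0 j * (c a * dmon (succ_at j al) a x) =
    c a * \sum_j (x' - x) 0 j * dmon (succ_at j al) a x.
    by rewrite mulr_sumr; apply: eq_bigr => j _; rewrite mulrCA.
  apply: taylor2W => //; rewrite normrM mulrCA ler_wpM2l // ler_wpM2l //.
  rewrite real_ler_norm // ger0_real //.
  by apply: prodr_ge0 => i _; rewrite exprn_ge0 // addr_ge0 // ltW.
- by apply: cvg_bsum => //; exact: bbounded_dmon.
- by apply: cvg_bsum => //; exact: bbounded_dmon.
- apply: cvgr_sum => j; apply: cvgMr; apply: cvg_bsum => //; exact: bbounded_dmon.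
Qed.

End Polydisc.
End PartialDerivatives.

(** * Local quadratic convergence of Newton's iteration *)

Lemma lipschitz_cvg (K : numFieldType) (V W : normedModType K) (f : V -> W) (x : V) (M : K) :
  0 <= M -> (\forall x' \near x, `|f x' - f x| <= M * `|x' - x|) ->
  f x' @[x' --> x] --> f x.
Proof.
move=> M0 nD; apply/cvgrPdist_lt => e e0.
have d0 : 0 < e / (M + 1) by rewrite divr_gt0 // ltr_wpDl.
have /cvgrPdist_lt/(_ _ d0) : x' @[x' --> x] --> x by exact: cvg_id.
apply: filterS2 nD => x' fx' xx'.
rewrite distrC; apply: le_lt_trans fx' _.
rewrite distrC; move: xx'; rewrite ltr_pdivlMr ?ltr_wpDl // mulrC; apply: le_lt_trans.
by rewrite ler_wpM2r // lerDl.
Qed.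

Lemma lipschitz_continuous (K : numFieldType) (V W : normedModType K) (f : V -> W) (M : K) :
  0 <= M -> (forall x x', `|f x' - f x| <= M * `|x' - x|) -> continuous f.
Proof. by move=> M0 H x; apply: (lipschitz_cvg M0); apply: nearW => x'; exact: H. Qed.

Lemma littleo_quadratic (K : numFieldType) (V W : normedModType K) (f : V -> W)
    (df : {linear V -> W}) (x : V) (M : K) : 0 <= M -> continuous df ->
  (\forall x' \near x, `|f x' - f x - df (x' - x)| <= M * `|x' - x| ^+ 2) ->
  'd f x = df :> (V -> W).
Proof.
move=> M0 cdf nD; apply: diff_unique => //.
apply/eqaddoP => e e0.
have d0 : 0 < e / (M + 1) by rewrite divr_gt0 // ltr_wpDl.
have nD0 : \forall v \near (0 : V), `|f (v + x) - f x - df (v + x - x)| <= M * `|v + x - x| ^+ 2.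
  have : v + x @[v --> (0 : V)] --> 0 + x.
    by apply: cvgD; [exact: cvg_id|exact: cvg_cst].
  by rewrite add0r => /(_ _ nD).
have /cvgrPdist_lt/(_ _ d0) : v @[v --> (0 : V)] --> (0 : V) by exact: cvg_id.
apply: filterS2 nD0 => v Dv; rewrite sub0r normrN => vd /=.
move: Dv; rewrite addrK !fctE /= opprD addrA.
move=> /le_trans; apply; rewrite expr2 mulrA ler_wpM2r //.
move: vd; rewrite ltr_pdivlMr ?ltr_wpDl // mulrC => /ltW; apply: le_trans.
by rewrite ler_wpM2r // lerDl.
Qed.

(** * Functions with a uniform second order expansion *)

Section TwiceDifferentiable.
Context {K : numClosedFieldType} {n : nat}.
Implicit Types (D : set 'rV[K]_n) (f : 'rV[K]_n -> K) (g : 'I_n -> 'rV[K]_n -> K).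

(* [g k] is the partial derivative of [f] in the direction [k]; the second order
   remainder is uniformly quadratic on [D]. *)
Definition c2on D f g : Prop := exists L B, 0 <= L /\
  forall x x', D x -> D x' ->
    taylor2 (L * `|x' - x|) B (f x') (f x) (\sum_k (x' - x) 0 k * g k x).

Lemma c2on_ext_in D f f' g g' :
  (forall x, D x -> f x = f' x) -> (forall k x, D x -> g k x = g' k x) ->
  c2on D f g -> c2on D f' g'.
Proof.
move=> ff gg [L [B [L0 H]]]; exists L, B; split=> // x x' Dx Dx'.
rewrite -!ff //; under eq_bigr do rewrite -gg //; exact: H.
Qed.

Lemma c2on_ext D f f' g g' : f =1 f' -> (forall k, g k =1 g' k) ->
  c2on D f g -> c2on D f' g'.
Proof. by move=> ff gg; apply: c2on_ext_in => [x _|k x _]; [exact: ff|exact: gg]. Qed.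

Lemma c2on_cst D (c : K) : c2on D (fun=> c) (fun _ _ => 0).
Proof.
exists 0, `|c|; split=> // x x' _ _; rewrite mul0r big1; first exact: taylor2_cst.
by move=> k _; rewrite mulr0.
Qed.

Lemma c2on_coord D (M : K) i : (forall x, D x -> `|x 0 i| <= M) ->
  c2on D (fun x => x 0 i) (fun k _ => (k == i)%:R).
Proof.
move=> DM; exists 1, (M + 1); split=> // x x' Dx Dx'.
have M0 : 0 <= M by apply: le_trans (DM _ Dx).
have e : \sum_k (x' - x) 0 k * (k == i)%:R = x' 0 i - x 0 i.
  rewrite (bigD1 i) //= eqxx mulr1 big1 ?addr0 ?mxE //.
  by move=> k /negPf ->; rewrite mulr0.
have h : `|x' 0 i - x 0 i| <= 1 * `|x' - x| * (M + 1).
  rewrite mul1r; have := ler_coord_norm (x' - x) i; rewrite !mxE => /le_trans; apply.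
  by rewrite ler_peMr // lerDr.
rewrite e; split=> //; first by apply: le_trans (DM _ Dx') _; rewrite lerDl.
  by apply: le_trans (DM _ Dx) _; rewrite lerDl.
by rewrite subrr normr0 mulr_ge0 ?exprn_ge0 ?mulr_ge0 ?addr_ge0.
Qed.

Lemma c2onM D f f' g g' : c2on D f g -> c2on D f' g' ->
  c2on D (fun x => f x * f' x) (fun k x => g k x * f' x + f x * g' k x).
Proof.
move=> [L [B [L0 H]]] [L' [B' [L0' H']]]; exists (L + L'), (B * B').
split=> [|x x' Dx Dx']; first exact: addr_ge0.
have := taylor2M _ _ (H _ _ Dx Dx') (H' _ _ Dx Dx').
rewrite -mulrDl !mulr_ge0 // => /(_ isT isT).
rewrite mulr_suml mulr_sumr -big_split /=.
by under eq_bigr => k _ do rewrite -mulrA [f x * _]mulrCA -mulrDr.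
Qed.

Lemma c2on_sum (I : finType) D (f : I -> 'rV[K]_n -> K) (g : I -> 'I_n -> 'rV[K]_n -> K) :
  (forall i, c2on D (f i) (g i)) ->
  c2on D (fun x => \sum_i f i x) (fun k x => \sum_i g i k x).
Proof.
move=> H; have /choice[LB HLB] : forall i, exists LB : K * K, 0 <= LB.1 /\
  forall x x', D x -> D x' ->
    taylor2 (LB.1 * `|x' - x|) LB.2 (f i x') (f i x) (\sum_k (x' - x) 0 k * g i k x).
  by move=> i; have [L [B LB]] := H i; exists (L, B).
have L0 i : 0 <= (LB i).1 by case: (HLB i).
have S0 : 0 <= \sum_i (LB i).1 by apply: sumr_ge0.
exists (\sum_i (LB i).1), (\sum_i (LB i).2); split=> // x x' Dx Dx'.
under [X in taylor2 _ _ _ _ X]eq_bigr do rewrite mulr_sumr.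
rewrite exchange_big /=; apply: taylor2_sum => [|i]; first by rewrite mulr_ge0.
have [_ /(_ _ _ Dx Dx')] := HLB i; apply: taylor2W => //; first by rewrite mulr_ge0.
by rewrite ler_wpM2r // (bigD1 i) //= lerDl sumr_ge0.
Qed.

Lemma c2on_prod (I : finType) D (f : I -> 'rV[K]_n -> K) (g : I -> 'I_n -> 'rV[K]_n -> K) :
  (forall i, c2on D (f i) (g i)) ->
  c2on D (fun x => \prod_i f i x)
         (fun k x => \sum_i g i k x * \prod_(j | j != i) f j x).
Proof.
move=> H; have /choice[LB HLB] : forall i, exists LB : K * K, 0 <= LB.1 /\
  forall x x', D x -> D x' ->
    taylor2 (LB.1 * `|x' - x|) LB.2 (f i x') (f i x) (\sum_k (x' - x) 0 k * g i k x).
  by move=> i; have [L [B LB]] := H i; exists (L, B).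
have L0 i : 0 <= (LB i).1 by case: (HLB i).
exists (\sum_i (LB i).1), (\prod_i (LB i).2); split=> [|x x' Dx Dx'].
  exact: sumr_ge0.
under [X in taylor2 _ _ _ _ X]eq_bigr do rewrite mulr_sumr.
rewrite exchange_big /= mulr_suml.
under [X in taylor2 _ _ _ _ X]eq_bigr do under eq_bigr do rewrite mulrA.
under [X in taylor2 _ _ _ _ X]eq_bigr do rewrite -mulr_suml.
apply: taylor2_prod; first exact: index_enum_uniq.
  by move=> i; rewrite mulr_ge0.
by move=> i; have [_ /(_ _ _ Dx Dx')] := HLB i.
Qed.

(** Jacobi's formula, obtained by applying the product rule to each term of the Leibniz
    expansion. *)
Lemma c2on_det m D (M : 'rV[K]_n -> 'M[K]_m) (G : 'I_m -> 'I_m -> 'I_n -> 'rV[K]_n -> K) :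
  (forall i j, c2on D (fun x => M x i j) (G i j)) ->
  c2on D (fun x => \det (M x))
         (fun k x => \sum_i \sum_j G i j k x * cofactor (M x) i j).
Proof.
move=> H.
apply: (@c2on_ext D (fun x => \sum_(s : {perm 'I_m}) (-1) ^+ s * \prod_i M x i (s i)) _
  (fun k x => \sum_(s : {perm 'I_m}) (0 * (\prod_i M x i (s i)) + (-1) ^+ s *
      \sum_i G i (s i) k x * \prod_(j | j != i) M x j (s j)))) => //.
  move=> k x; under eq_bigr do rewrite mul0r add0r mulr_sumr.
  rewrite exchange_big /=; apply: eq_bigr => i _.
  (* [N] is [M x] with row [i] differentiated. The terms of the product rule that differentiate row
     [i] form its determinant, and the cofactors along that row are those of [M x]. *)
  pose N := \matrix_(i', j) (if i' == i then G i j k x else M x i' j).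
  transitivity (\det N).
    apply: eq_bigr => s _; congr (_ * _); rewrite [RHS](bigD1 i) //= /N !mxE eqxx.
    by congr (_ * _); apply: eq_bigr => j ji; rewrite !mxE (negPf ji).
  rewrite (expand_det_row _ i); apply: eq_bigr => j _; rewrite mxE eqxx.
  congr (_ * (_ * \det _)); apply/matrixP => i' j'; rewrite !mxE.
  by rewrite eq_sym (negPf (neq_lift _ _)).
apply: c2on_sum => s; apply: c2onM; first exact: c2on_cst.
by apply: c2on_prod => i; exact: H.
Qed.

Lemma c2on_lipschitz D f g : c2on D f g -> exists2 M, 0 <= M &
  forall x x', D x -> D x' -> `|f x' - f x| <= M * `|x' - x|.
Proof.
move=> [L [B [L0 H]]]; exists (L * `|B|) => [|x x' Dx Dx']; first exact: mulr_ge0.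
have t := H _ _ Dx Dx'; have B0 := taylor2_ge0 t.
by case: t => _ _ + _ _; rewrite mulrAC (ger0_norm B0).
Qed.

Lemma c2on_quadratic D f g : c2on D f g -> exists2 M, 0 <= M &
  forall x x', D x -> D x' ->
  `|f x' - f x - \sum_k (x' - x) 0 k * g k x| <= M * `|x' - x| ^+ 2.
Proof.
move=> [L [B [L0 H]]]; exists (L ^+ 2 * `|B|) => [|x x' Dx Dx'].
  by rewrite mulr_ge0 // exprn_ge0.
have t := H _ _ Dx Dx'; have B0 := taylor2_ge0 t.
by case: t => _ _ _ _; rewrite exprMn mulrAC (ger0_norm B0).
Qed.

Lemma c2on_continuous D f g (x : 'rV[K]_n) : c2on D f g -> nbhs x D -> f x' @[x' --> x] --> f x.
Proof.
move=> /c2on_lipschitz[M M0 H] nD; apply: (lipschitz_cvg M0).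
have Dx := nbhs_singleton nD.
by apply: filterS nD => x' Dx'; exact: H.
Qed.


End TwiceDifferentiable.

Section Newton.
Context {K : numClosedFieldType}.

Lemma norm_mulmx_le n m (v : 'rV[K]_n) (A : 'M[K]_(n, m)) :
  `|v *m A| <= (\sum_k \sum_l `|A k l|) * `|v|.
Proof.
have S0 k : 0 <= \sum_l `|A k l| by apply: sumr_ge0.
apply: norm_row_le => [|l]; first by rewrite mulr_ge0 ?sumr_ge0.
rewrite mxE mulr_suml; apply: le_trans (ler_norm_sum _ _ _) _.
apply: ler_sum => k _; rewrite normrM mulrC ler_pM ?ler_coord_norm //.
by rewrite (bigD1 l) //= lerDl sumr_ge0.
Qed.

Lemma c2on_row_quadratic n m (D : set 'rV[K]_n) (F : 'rV[K]_n -> 'rV[K]_m)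
    (J : 'rV[K]_n -> 'M[K]_(n, m)) :
  (forall l, c2on D (fun x => F x 0 l) (fun k x => J x k l)) ->
  exists2 M, 0 <= M & forall x x', D x -> D x' ->
    `|F x' - F x - (x' - x) *m J x| <= M * `|x' - x| ^+ 2.
Proof.
move=> H; have /choice[M HM] : forall l, exists M, 0 <= M /\
    forall x x', D x -> D x' ->
    `|F x' 0 l - F x 0 l - \sum_k (x' - x) 0 k * J x k l| <= M * `|x' - x| ^+ 2.
  by move=> l; have [M M0 HM] := c2on_quadratic (H l); exists M.
have M0 l : 0 <= M l by case: (HM l).
exists (\sum_l M l) => [|x x' Dx Dx']; first exact: sumr_ge0.
apply: norm_row_le => [|l]; first by rewrite mulr_ge0 ?exprn_ge0 ?sumr_ge0.
have [_ /(_ _ _ Dx Dx')] := HM l; rewrite !mxE => /le_trans; apply.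
by rewrite ler_wpM2r ?exprn_ge0 // (bigD1 l) //= lerDl sumr_ge0.
Qed.

Lemma jacobian_c2on n m (D : set 'rV[K]_n) (F : 'rV[K]_n -> 'rV[K]_m)
    (J : 'rV[K]_n -> 'M[K]_(n, m)) (x : 'rV[K]_n) :
  (forall l, c2on D (fun x => F x 0 l) (fun k x => J x k l)) ->
  nbhs x D -> jacobian F x = J x.
Proof.
move=> /c2on_row_quadratic[M M0 H] nD.
have Dx := nbhs_singleton nD.
suff dF : 'd F x = mulmxr (J x) :> ('rV[K]_n -> 'rV[K]_m).
  apply/row_matrixP => i; rewrite /jacobian rowE mul_rV_lin1 dF.
  by rewrite /= -rowE.
apply: (littleo_quadratic M0); last by apply: filterS nD => x' Dx'; exact: H.
apply: (@lipschitz_continuous K _ _ _ (\sum_k \sum_l `|J x k l|)).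
  by do 2!apply: sumr_ge0 => ? _.
by move=> v v' /=; rewrite -mulmxBl; exact: norm_mulmx_le.
Qed.

(** The value [a b / (a + b)] replaces the minimum and avoids comparing [a] with [b]. *)
Lemma pos_lower_bound (a b : K) : 0 < a -> 0 < b -> exists2 d, 0 < d & d <= a /\ d <= b.
Proof.
move=> a0 b0; exists (a * b / (a + b)); first by rewrite divr_gt0 ?mulr_gt0 ?addr_gt0.
have b0' := ltW b0; have a0' := ltW a0.
split; rewrite ler_pdivrMr ?addr_gt0 // mulrDr; first by rewrite lerDr mulr_ge0.
by rewrite [b * a]mulrC lerDl mulr_ge0.
Qed.

Hypothesis Kc : monotone_complete K.

Definition newton_step n (F : 'rV[K]_n -> 'rV[K]_n) x :=
  x - F x *m invmx (jacobian F x).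

(** As [F zeta = 0], multiplying the new error by [J x] gives the Taylor remainder at [x], evaluated
    at [zeta]. A bound on the inverse of [J x], uniform near [zeta], turns this into a quadratic
    estimate. *)
Theorem newton_quadratic n (D : set 'rV[K]_n) (F : 'rV[K]_n -> 'rV[K]_n)
    (J : 'rV[K]_n -> 'M[K]_n) (zeta : 'rV[K]_n) :
  (forall l, c2on D (fun x => F x 0 l) (fun k x => J x k l)) ->
  (forall k l, exists g, c2on D (fun x => J x k l) g) ->
  nbhs zeta D -> F zeta = 0 -> J zeta \in unitmx ->
  exists V, nbhs zeta V /\ exists2 c, 0 <= c & forall x0, V x0 ->
    [/\ forall k, nbhs (iter k (newton_step F) x0) D /\
          jacobian F (iter k (newton_step F) x0) \in unitmx,
        (fun k => iter k (newton_step F) x0) @ \oo --> zeta &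
        forall k, `|iter k.+1 (newton_step F) x0 - zeta| <=
          c * `|iter k (newton_step F) x0 - zeta| ^+ 2].
Proof.
move=> HF HJ nD F0 uJ.
have [M M0 quad] := c2on_row_quadratic HF.
have /choice[N HN] : forall kl : 'I_n * 'I_n, exists N, 0 <= N /\
    forall x x', D x -> D x' -> `|J x' kl.1 kl.2 - J x kl.1 kl.2| <= N * `|x' - x|.
  by move=> [k l]; have [g /c2on_lipschitz[N N0 HN]] := HJ k l; exists N.
have N0 kl : 0 <= N kl by case: (HN kl).
set P := \sum_k \sum_l N (k, l).
have P0 : 0 <= P by do 2!apply: sumr_ge0 => ? _.
set A0 := invmx (J zeta); set c0 := \sum_k \sum_l `|A0 k l|.
have c00 : 0 <= c0 by do 2!apply: sumr_ge0 => ? _.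
set c := 2%:R * (c0 * M).
have c_ge0 : 0 <= c by rewrite !mulr_ge0.
have Dz := nbhs_singleton nD.
have /nbhs_interior : nbhs zeta D by []. rewrite nbhs_ballP => -[r /= r0 rD].
(* Below this radius [J x] stays so close to [J zeta] that the perturbation costs at most half of
   [|v|] in [inv_bd]; below the next one, [c * |x - zeta| <= 1 / 2], so each step halves the error.
   The added 1 keeps the denominators positive. *)
have p1 : 0 < (2%:R * (c0 * P + 1))^-1 :> K.
  by rewrite invr_gt0 mulr_gt0 // ltr_wpDl // mulr_ge0.
have p2 : 0 < (2%:R * (c + 1))^-1 :> K by rewrite invr_gt0 mulr_gt0 // ltr_wpDl.
have [d1 d10 [d1r d1p]] := pos_lower_bound r0 p1.
have [d d0 [dd1 dp2]] := pos_lower_bound d10 p2.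
have dr := le_trans dd1 d1r; have dp1 := le_trans dd1 d1p.
have in_D (x : 'rV[K]_n) : `|x - zeta| < d -> nbhs x D.
  move=> xd; apply: rD; rewrite -ball_normE /= distrC.
  exact: lt_le_trans xd dr.
(* A lower bound on [|v *m J x|] serves twice: it shows that [J x] has trivial kernel, and it bounds
   the inverse. *)
have inv_bd (x : 'rV[K]_n) : `|x - zeta| < d ->
    forall v : 'rV[K]_n, `|v| <= 2%:R * (c0 * `|v *m J x|).
  move=> xd v; have Dx := nbhs_singleton (in_D _ xd).
  have e : v = (v *m J x) *m A0 + (v *m (J zeta - J x)) *m A0.
    by rewrite -mulmxDl -mulmxDr subrKC mulmxK.
  have s : \sum_k \sum_l `|(J zeta - J x) k l| <= P * d.
    rewrite /P mulr_suml; apply: ler_sum => k _.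
    rewrite mulr_suml; apply: ler_sum => l _; rewrite !mxE.
    have [_ /(_ _ _ Dx Dz) /le_trans] := HN (k, l); apply.
    by rewrite ler_wpM2l // distrC ltW.
  have h1 : `|v| <= c0 * `|v *m J x| + c0 * (P * d * `|v|).
    rewrite {1}e; apply: le_trans (ler_normD _ _) _; apply: lerD.
      exact: norm_mulmx_le.
    apply: le_trans (norm_mulmx_le _ _) _; rewrite ler_wpM2l //.
    by apply: le_trans (norm_mulmx_le _ _) _; rewrite ler_wpM2r.
  have h2 : c0 * (P * d * `|v|) <= 2%:R^-1 * `|v|.
    rewrite !mulrA ler_wpM2r //.
    apply: le_trans (ler_wpM2l _ dp1) _; first exact: mulr_ge0.
    rewrite invfM mulrCA ger_pMr ?invr_gt0 // ler_pdivrMr ?ltr_wpDl ?mulr_ge0 //.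
    by rewrite mul1r lerDl.
  have := le_trans h1 (lerD (lexx _) h2).
  rewrite -lerBlDr -{1}[`|v|]mul1r -mulrBl.
  have -> : 1 - 2%:R^-1 = 2%:R^-1 :> K by field.
  by rewrite ler_pdivrMl.
have unit_J (x : 'rV[K]_n) : `|x - zeta| < d -> J x \in unitmx.
  move=> xd; rewrite -row_free_unit -kermx_eq0; apply/eqP/row_matrixP => i.
  rewrite row0; apply/eqP; rewrite -normr_le0.
  apply: le_trans (inv_bd _ xd _) _; rewrite -row_mul mulmx_ker row0 normr0.
  by rewrite !mulr0.
have jacE (x : 'rV[K]_n) : `|x - zeta| < d -> jacobian F x = J x.
  by move=> xd; apply: (jacobian_c2on HF); exact: in_D.
have step (x : 'rV[K]_n) : `|x - zeta| < d ->
    `|newton_step F x - zeta| <= c * `|x - zeta| ^+ 2.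
  move=> xd; rewrite /newton_step jacE //.
  apply: le_trans (inv_bd _ xd _) _; rewrite /c -!mulrA ler_wpM2l // ler_wpM2l //.
  rewrite addrAC mulmxBl mulmxKV ?unit_J //.
  have := quad _ _ (nbhs_singleton (in_D _ xd)) Dz.
  rewrite F0 sub0r -(opprB x zeta) mulNmx opprK normrN.
  by rewrite [- F x + _]addrC.
have half (x : 'rV[K]_n) : `|x - zeta| < d ->
    `|newton_step F x - zeta| <= 2%:R^-1 * `|x - zeta|.
  move=> xd; apply: le_trans (step _ xd) _; rewrite expr2 mulrA ler_wpM2r //.
  apply: le_trans (ler_wpM2l c_ge0 (ltW (lt_le_trans xd dp2))) _.
  rewrite invfM mulrCA ger_pMr ?invr_gt0 // ler_pdivrMr ?ltr_wpDl //.
  by rewrite mul1r lerDl.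
exists [set x | `|x - zeta| < d]; split.
  apply/nbhs_ballP; exists d => //= x; rewrite -ball_normE /= distrC; exact: id.
exists c; first by [].
move=> x0 Vx0; set x := fun k => iter k (newton_step F) x0.
have xk k : `|x k - zeta| < d /\ `|x k - zeta| <= d * 2%:R ^- k.
  elim: k => [|k [IH1 IH2]]; first by rewrite expr0 invr1 mulr1; split; rewrite //= ltW.
  have h := half _ IH1; split.
    apply: le_lt_trans h _; apply: le_lt_trans IH1.
    by rewrite ler_piMl // invf_le1 // ler1n.
  apply: le_trans h _; rewrite exprS invfM mulrCA.
  by rewrite ler_wpM2l // invr_ge0.
split=> [k||k].
- by have [h _] := xk k; split; [exact: in_D|rewrite jacE // unit_J].
- apply/cvgrPdist_lt => e e0.
  have := cvg_expr_half Kc => /cvgrPdist_lt /(_ (e / d)); rewrite divr_gt0 // => /(_ isT).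
  apply: filterS => k; rewrite sub0r normrN normfV normrX normr_nat.
  rewrite ltr_pdivlMr // mulrC => /(le_lt_trans _); apply.
  by rewrite distrC; case: (xk k).
- by apply: step; case: (xk k).
Qed.

End Newton.

(** * Nonnegative irreducible matrices *)

Section Connectivity.
Context {T : finType} (e : rel T) (P : T -> Prop).

Lemma connect_ind_fwd i j : (forall k l, e k l -> P k -> P l) ->
  connect e i j -> P i -> P j.
Proof.
move=> eP /connectP[p + ->]; elim: p i => [|k p IH] i //= /andP[ik kp] Pi.
by apply: IH => //; apply: eP ik Pi.
Qed.

Lemma connect_ind_bwd i j : (forall k l, e k l -> P l -> P k) ->
  connect e i j -> P j -> P i.
Proof.
move=> eP /connectP[p + ->]; elim: p i => [|k p IH] i //= /andP[ik kp] Pj.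
by apply: eP ik _; apply: IH.
Qed.

End Connectivity.

Section PerronFrobenius.
Context {F : realFieldType} {m : nat}.
Variable A : 'M[F]_m.
Implicit Types (u w q x : 'I_m -> F).
Hypothesis A0 : forall i j, 0 <= A i j.
Hypothesis irr : forall i j, connect [rel i j | 0 < A i j] i j.

(** Since [A i j * w j <= w i], positivity travels backwards along the edges, and the graph is
    strongly connected. *)
Lemma subinvariant_gt0 w k : (forall i, 0 <= w i) -> w k != 0 ->
  (forall i, \sum_j A i j * w j <= w i) -> forall i, 0 < w i.
Proof.
move=> w0 wk Aw i.
apply: (@connect_ind_bwd _ _ (fun i => 0 < w i) _ _ _ (irr i k)) => [i' j /= ij wj|].
  apply: lt_le_trans (Aw i'); rewrite (bigD1 j) //=.
  by rewrite ltr_pwDl ?mulr_gt0 // sumr_ge0 // => l _; rewrite mulr_ge0.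
by rewrite lt_neqAle eq_sym wk w0.
Qed.

Section Subinvariant.
Variable w : 'I_m -> F.
Hypotheses (w0 : forall i, 0 < w i) (Aw : forall i, \sum_j A i j * w j <= w i).

(** Maximum principle: with [t] the largest ratio [q i / w i], the vector [t w - q] is nonnegative,
    and wherever it vanishes its image under [A] is at most 0. Its zeros therefore spread along the
    edges to every index. *)
Lemma superinvariant_prop q (i0 : 'I_m) : (forall i, 0 <= q i) ->
  (forall i, q i <= \sum_j A i j * q j) -> exists2 t, 0 <= t & forall i, q i = t * w i.
Proof.
move=> q0 qA.
have [k _ kmax] := @arg_maxP _ _ _ i0 xpredT (fun i => q i / w i) isT.
have t0 : 0 <= q k / w k by rewrite divr_ge0 // ltW.
have qt i : q i <= q k / w k * w i by rewrite -ler_pdivrMr //; exact: kmax.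
exists (q k / w k) => // i.
apply: (@connect_ind_fwd _ _ (fun i => q i = q k / w k * w i) _ _ _ (irr k i));
  last first.
  by rewrite divfK // gt_eqF.
set t := q k / w k in t0 qt * => a b /= ab qa.
have s0 j : 0 <= A a j * (t * w j - q j) by rewrite mulr_ge0 // subr_ge0.
have s : \sum_j A a j * (t * w j - q j) <= 0.
  under eq_bigr do rewrite mulrBr mulrCA.
  rewrite sumrB -mulr_sumr subr_le0; apply: le_trans (qA a); rewrite qa.
  by rewrite ler_wpM2l.
have : A a b * (t * w b - q b) = 0.
  apply/eqP; rewrite eq_le s0 andbT; apply: le_trans s.
  by rewrite (bigD1 b) //= lerDl sumr_ge0.
by move/eqP; rewrite mulf_eq0 gt_eqF //= subr_eq0 eq_sym => /eqP.
Qed.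

Lemma norm_superinvariant x : (forall i, x i = \sum_j A i j * x j) ->
  forall i, `|x i| <= \sum_j A i j * `|x j|.
Proof.
move=> xA i; rewrite {1}xA; apply: le_trans (ler_norm_sum _ _ _) _.
by apply: ler_sum => j _; rewrite normrM ger0_norm.
Qed.

Lemma superinvariant_eq0 q i0 : (forall i, 0 <= q i) ->
  (forall i, q i <= \sum_j A i j * q j) -> q i0 = 0 -> forall i, q i = 0.
Proof.
move=> q0 qA qi0 i; have [t _ qt] := superinvariant_prop i0 q0 qA.
have /eqP := qi0; rewrite qt mulf_eq0 [w _ == _]gt_eqF // orbF => /eqP t0.
by rewrite qt t0 mul0r.
Qed.

(** The vector solves [(1 - A) v = 1]. If the least ratio [t = v k / w k] were negative, then at [k]
    the left side would be at most [t (w k - (A w) k) <= 0], not 1. *)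
Lemma nonsingular_strict : \det (1%:M - A) != 0 -> exists2 v : 'I_m -> F,
  forall i, 0 <= v i & forall i, v i - \sum_j A i j * v j = 1.
Proof.
move=> dA; have uA : 1%:M - A \in unitmx by rewrite unitmxE unitfE.
pose c := invmx (1%:M - A) *m const_mx 1 : 'cV_m.
have ec i : c i 0 - \sum_j A i j * c j 0 = 1.
  have : ((1%:M - A) *m c) i 0 = 1 by rewrite mulKVmx // mxE.
  by rewrite mulmxBl mul1mx !mxE.
exists (fun i => c i 0) => // i.
have [k _ kmin] := @arg_minP _ _ _ i xpredT (fun i => c i 0 / w i) isT.
set t := c k 0 / w k in kmin.
suff t0 : 0 <= t.
  by have := kmin i isT; rewrite ler_pdivlMr // => /(le_trans _); apply; rewrite mulr_ge0 // ltW.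
rewrite leNgt; apply/negP => tneg.
have h : t * \sum_j A k j * w j <= \sum_j A k j * c j 0.
  rewrite mulr_sumr; apply: ler_sum => j _; rewrite mulrCA ler_wpM2l //.
  by rewrite -ler_pdivlMr //; exact: kmin.
have h2 : t * w k <= t * \sum_j A k j * w j by rewrite ler_nM2l.
have := ec k; have -> : c k 0 = t * w k by rewrite /t divfK // gt_eqF.
lra.
Qed.

Hypothesis dA : \det (1%:M - A) = 0.

Lemma singular_right_vector : exists2 x : 'I_m -> F,
  exists i, x i != 0 & forall i, x i = \sum_j A i j * x j.
Proof.
have /eqP/det0P[v v0 vA] : \det (1%:M - A)^T = 0 by rewrite det_tr.
exists (fun i => v 0 i) => [|i].
  apply/existsP; apply: contraNT v0 => /existsPn v0; apply/eqP/rowP => i.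
  by rewrite mxE; apply/eqP/negPn/v0.
have /rowP/(_ i) := vA; rewrite linearB /= trmx1 mulmxBr mulmx1 !mxE => /eqP.
rewrite subr_eq0 => /eqP ->; apply: eq_bigr => j _; by rewrite mxE mulrC.
Qed.

(** For a kernel vector [x] of [1 - A], [|x|] is superinvariant, hence a positive multiple of [w].
    So [w] is both sub- and superinvariant. *)
Lemma invariant_right i : \sum_j A i j * w j = w i.
Proof.
have [x [k xk] xA] := singular_right_vector.
have [t t0 xt] := superinvariant_prop i (fun i => normr_ge0 (x i)) (norm_superinvariant xA).
have tpos : 0 < t.
  rewrite lt_neqAle t0 andbT; apply: contraNN xk => /eqP t_0.
  by rewrite -normr_eq0 xt -t_0 mul0r.
apply/eqP; rewrite eq_le Aw /= -(ler_pM2l tpos) -xt.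
apply: le_trans (norm_superinvariant xA i) _; rewrite mulr_sumr.
by apply: ler_sum => j _; rewrite xt mulrCA.
Qed.

(** Subtracting the multiple of [w] that agrees with [x] at [i0] leaves an invariant vector
    vanishing at [i0]; its modulus is superinvariant with a zero, hence zero. *)
Lemma invariant_right_unique x i0 : (forall i, x i = \sum_j A i j * x j) ->
  forall i, x i = x i0 / w i0 * w i.
Proof.
move=> xA i; set c := _ / _; pose y i := x i - c * w i.
have yA k : y k = \sum_j A k j * y j.
  rewrite /y; under eq_bigr do rewrite mulrBr mulrCA.
  by rewrite sumrB -mulr_sumr invariant_right -xA.
have := superinvariant_eq0 (fun i => normr_ge0 (y i)) (norm_superinvariant yA) (i0 := i0).
rewrite {1}/y /c divfK ?gt_eqF // subrr normr0 => /(_ erefl i) /eqP.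
by rewrite normr_eq0 subr_eq0 => /eqP.
Qed.

(** Pairing the nonnegative vector [q A - q] with [w > 0] gives 0 because [A w = w], so it vanishes.
    Positivity of [q] then spreads forwards along the edges. *)
Lemma left_subinvariant q : (forall i, 0 <= q i) ->
  (forall j, q j <= \sum_i q i * A i j) ->
  (forall j, \sum_i q i * A i j = q j) /\
  ((exists i, q i != 0) -> forall i, 0 < q i).
Proof.
move=> q0 qA.
have e j : \sum_i q i * A i j = q j.
  have s0 k : 0 <= (\sum_i q i * A i k - q k) * w k.
    by rewrite mulr_ge0 ?subr_ge0 ?qA // ltW.
  have s : \sum_k (\sum_i q i * A i k - q k) * w k = 0.
    under eq_bigr do rewrite mulrBl mulr_suml.
    rewrite sumrB exchange_big /= -sumrB big1 // => i _.
    under eq_bigr do rewrite -mulrA.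
    by rewrite -mulr_sumr invariant_right subrr.
  have /(_ j isT)/eqP := psumr_eq0P (fun k _ => s0 k) s.
  by rewrite mulf_eq0 [w _ == _]gt_eqF // orbF subr_eq0 => /eqP.
split=> // -[k qk] i.
apply: (@connect_ind_fwd _ _ (fun i => 0 < q i) _ _ _ (irr k i)) => [a b /= ab qa|].
  rewrite -e (bigD1 a) //= ltr_pwDl ?mulr_gt0 // sumr_ge0 // => l _.
  by rewrite mulr_ge0.
by rewrite lt_neqAle eq_sym qk q0.
Qed.

Lemma norm_left_superinvariant x : (forall j, x j = \sum_i x i * A i j) ->
  forall j, `|x j| <= \sum_i `|x i| * A i j.
Proof.
move=> xA j; rewrite {1}xA; apply: le_trans (ler_norm_sum _ _ _) _.
by apply: ler_sum => i _; rewrite normrM (ger0_norm (A0 _ _)).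
Qed.

Lemma left_vector : exists2 u : 'I_m -> F,
  forall i, 0 < u i & forall j, \sum_i u i * A i j = u j.
Proof.
have /eqP/det0P[v v0 vA] := dA.
have vE j : v 0 j = \sum_i v 0 i * A i j.
  have /rowP/(_ j) := vA; rewrite mulmxBr mulmx1 !mxE => /eqP.
  by rewrite subr_eq0 => /eqP.
have [e p] := left_subinvariant (fun i => normr_ge0 (v 0 i)) (norm_left_superinvariant vE).
exists (fun i => `|v 0 i|) => //; apply: p.
apply/existsP; apply: contraNT v0 => /existsPn v0; apply/eqP/rowP => i.
by rewrite mxE; apply/eqP; rewrite -normr_eq0; apply/negPn/v0.
Qed.

(** A kernel vector of the minor, extended by 0 at [i0], has a superinvariant modulus, and the zero
    at [i0] forces it to vanish everywhere. *)
Lemma principal_cofactor_neq0 i0 : cofactor (1%:M - A) i0 i0 != 0.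
Proof.
rewrite /cofactor mulf_neq0 ?signr_eq0 // -det_tr; apply/det0P => -[v v0 vN].
pose q i := if unlift i0 i is Some k then `|v 0 k| else 0.
have ql k : q (lift i0 k) = `|v 0 k| by rewrite /q liftK.
have qi0 : q i0 = 0 by rewrite /q unlift_none.
have q0 i : 0 <= q i by rewrite /q; case: unlift.
have vE k : v 0 k = \sum_l A (lift i0 k) (lift i0 l) * v 0 l.
  have /rowP/(_ k) := vN; rewrite !mxE => e; apply/eqP; rewrite -subr_eq0 -[X in _ == X]e.
  apply/eqP; rewrite (bigD1 k) //= [X in _ = X](bigD1 k) //= !mxE eqxx.
  rewrite mulrBr mulr1 opprD addrA [v 0 k * _]mulrC; congr (_ + _).
  rewrite -sumrN; apply: eq_bigr => l lk; rewrite !mxE (inj_eq (@lift_inj _ i0)).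
  by rewrite eq_sym (negPf lk) sub0r mulrN mulrC.
have qA i : q i <= \sum_j A i j * q j.
  case: (unliftP i0 i) => [k ->|->]; last first.
    by rewrite qi0 sumr_ge0 // => j _; rewrite mulr_ge0.
  rewrite ql (bigD1_ord i0) //= qi0 mulr0 add0r vE.
  apply: le_trans (ler_norm_sum _ _ _) _; apply: ler_sum => l _.
  by rewrite normrM (ger0_norm (A0 _ _)) ql.
have q_0 := superinvariant_eq0 q0 qA qi0.
case/eqP: v0; apply/rowP => k; rewrite mxE; apply/eqP.
by rewrite -normr_eq0 -ql q_0.
Qed.

(** As [\det N = 0], the adjugate is annihilated by [N] on both sides: [cofactor N i j] is right
    invariant in [j], hence proportional to [w], and left invariant in [i], hence proportional to
    [u]. The constant is nonzero because a principal cofactor is. *)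
Lemma cofactor_rank1 (i0 : 'I_m) : exists u k,
  [/\ forall i, 0 < u i, forall j, \sum_i u i * A i j = u j, k != 0 &
      forall i j, cofactor (1%:M - A) i j = k * u i * w j].
Proof.
have [u u0 uA] := left_vector; set N := 1%:M - A.
have nw j : w j != 0 by rewrite gt_eqF.
have nu j : u j != 0 by rewrite gt_eqF.
have col i j : cofactor N i j = cofactor N i i0 / w i0 * w j.
  apply: (@invariant_right_unique (cofactor N i) i0) => k.
  have /matrixP/(_ k i) := mul_mx_adj N; rewrite -/N dA.
  rewrite {1}/N mulmxBl mul1mx !mxE mul0rn => /eqP; rewrite subr_eq0 => /eqP ->.
  by apply: eq_bigr => l _; rewrite !mxE.
have row j : cofactor N j i0 = cofactor N i0 i0 / u i0 * u j.
  set c := _ / _; pose y j := cofactor N j i0 - c * u j.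
  have xA k : cofactor N k i0 = \sum_i cofactor N i i0 * A i k.
    have /matrixP/(_ i0 k) := mul_adj_mx N; rewrite -/N dA.
    rewrite {2}/N mulmxBr mulmx1 !mxE mul0rn => /eqP; rewrite subr_eq0 => /eqP ->.
    by apply: eq_bigr => l _; rewrite !mxE.
  have yA k : y k = \sum_i y i * A i k.
    rewrite /y; under eq_bigr do rewrite mulrBl -[c * _ * _]mulrA.
    by rewrite sumrB -mulr_sumr uA -xA.
  (* A nonzero left invariant vector has no zero coordinate, whereas [y] vanishes at [i0] by the
     choice of [c]. *)
  have [_ p] := left_subinvariant (fun i => normr_ge0 (y i)) (norm_left_superinvariant yA).
  apply/eqP; rewrite -subr_eq0 -/(y j); apply/negPn/negP => yj.
  have := p (ex_intro _ j _) i0; rewrite normr_eq0 => /(_ yj).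
  by rewrite normr_gt0 /y /c divfK // subrr eqxx.
exists u, (cofactor N i0 i0 / u i0 / w i0); split=> //.
  by rewrite mulf_neq0 ?invr_neq0 // mulf_neq0 ?invr_neq0 //; exact: principal_cofactor_neq0.
by move=> i j; rewrite col row; ring.
Qed.

(* A kernel vector [(v, t)] has [t = 0] because [u] annihilates the range of
   [1 - A] while [u b > 0]; then [v] is proportional to [w], and the last
   column is nonzero on [w]. *)
Lemma bordered_unitmx (J : 'M[F]_(m + 1)) (b : 'I_m -> F) (B : 'I_m -> 'I_m -> 'I_m -> F) i0 :
  (forall i, 0 <= b i) -> b i0 != 0 ->
  (forall i j k, 0 <= B i j k) -> (exists i j k, B i j k != 0) ->
  (forall k j, J (lshift 1 k) (lshift 1 j) = (k == j)%:R - A j k) ->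
  (forall j, J (rshift m 0) (lshift 1 j) = - b j) ->
  (forall k, J (lshift 1 k) (rshift m 0) =
     - \sum_i \sum_j B i j k * cofactor (1%:M - A) i j) ->
  J \in unitmx.
Proof.
move=> b0 bi0 B0 [i1 [j1 [k1 Bn]]] J1 J2 J3.
have [u [c [u0 uA c0 cofE]]] := cofactor_rank1 i0.
rewrite -row_free_unit -kermx_eq0; apply/eqP/row_matrixP => r; rewrite row0.
set v := row r _; have vJ : v *m J = 0 by rewrite -row_mul mulmx_ker row0.
set t := v 0 (rshift m 0); pose x k := v 0 (lshift 1 k).
have e j : x j - \sum_k A j k * x k = t * b j.
  have /rowP/(_ (lshift 1 j)) := vJ; rewrite !mxE big_split_ord big_ord1 /= J2.
  rewrite -/t mulrN => /eqP; rewrite subr_eq0 => /eqP <-.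
  under [RHS]eq_bigr do rewrite J1 mulrBr.
  rewrite sumrB; congr (_ - _); last by apply: eq_bigr => k _; rewrite mulrC.
  rewrite (bigD1 j) //= eqxx mulr1 big1 ?addr0 // => k /negPf ->.
  by rewrite mulr0.
have t0 : t = 0.
  have : \sum_j u j * (t * b j) = 0.
    under eq_bigr do rewrite -e mulrBr mulr_sumr.
    rewrite sumrB exchange_big /= -sumrB big1 // => k _.
    under eq_bigr do rewrite mulrA.
    by rewrite -mulr_suml uA subrr.
  under eq_bigr do rewrite mulrCA.
  rewrite -mulr_sumr => /eqP; rewrite mulf_eq0 => /orP[/eqP//|].
  rewrite gt_eqF // (bigD1 i0) //= ltr_pwDl ?mulr_gt0 //.
    by rewrite lt_neqAle eq_sym bi0 b0.
  by rewrite sumr_ge0 // => i _; rewrite mulr_ge0 // ltW.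
have xA j : x j = \sum_k A j k * x k.
  by apply/eqP; rewrite -subr_eq0 e t0 mul0r.
have xw := invariant_right_unique i0 xA; set s := x i0 / w i0 in xw.
have s0 : s = 0.
  have /rowP/(_ (rshift m 0)) := vJ; rewrite !mxE big_split_ord big_ord1 /=.
  rewrite -/t t0 mul0r addr0.
  under eq_bigr => k _ do rewrite J3 -/(x k) xw.
  (* The rank one form of the cofactors reduces the last equation to [- s c] times a sum of
     nonnegative terms, one of which is positive. *)
  have -> : \sum_(k < m) s * w k * - (\sum_i \sum_j B i j k * cofactor (1%:M - A) i j) =
    - (s * c) * \sum_k \sum_i \sum_j u i * w j * w k * B i j k.
    rewrite mulr_sumr; apply: eq_bigr => k _; rewrite mulrN mulNr mulr_sumr -sumrN.
    rewrite mulr_sumr -sumrN; apply: eq_bigr => i _.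
    rewrite mulr_sumr mulr_sumr -sumrN -sumrN; apply: eq_bigr => j _.
    by rewrite cofE; ring.
  move/eqP; rewrite mulf_eq0 oppr_eq0 mulf_eq0 (negPf c0) orbF => /orP[/eqP//|].
  have P i j k : 0 < u i * w j * w k by rewrite !mulr_gt0.
  have Q i j k : 0 <= u i * w j * w k * B i j k by rewrite mulr_ge0 // ltW.
  rewrite gt_eqF // (bigD1 k1) //= ltr_pwDl //; last first.
    by do 3!apply: sumr_ge0 => ? _.
  rewrite (bigD1 i1) //= ltr_pwDl //; last by do 2!apply: sumr_ge0 => ? _.
  rewrite (bigD1 j1) //= ltr_pwDl //; last by apply: sumr_ge0 => ? _.
  by rewrite mulr_gt0 // lt_neqAle eq_sym Bn B0.
apply/rowP => k; rewrite [RHS]mxE; case: (split_ordP k) => k' ->.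
  by rewrite -[LHS]/(x k') xw s0 mul0r.
by rewrite (ord1 k') -[LHS]/t t0.
Qed.

End Subinvariant.
End PerronFrobenius.

(** * Expansions at the origin and nonnegative coefficients *)

Section SmallArguments.
Context {K : numClosedFieldType}.
Implicit Types (f g : K -> K).

(** Only positive real [x] are tested, since [0 < x] forces [x] to be real. This is enough to
    determine Taylor coefficients. *)
Definition bigOh (N : nat) f : Prop := exists M x0, [/\ 0 <= M, 0 < x0 &
  forall x, 0 < x -> x <= x0 -> `|f x| <= M * x ^+ N].

Lemma eq_bigOh N f g : f =1 g -> bigOh N f -> bigOh N g.
Proof.
by move=> fg [M [x0 [M0 x00 H]]]; exists M, x0; split=> // x ? ?; rewrite -fg H.
Qed.

Lemma near_bigOh N f g r : 0 < r -> (forall x, 0 < x -> x <= r -> f x = g x) ->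
  bigOh N f -> bigOh N g.
Proof.
move=> r0 fg [M [x0 [M0 x00 H]]]; have [d d0 [dr dx]] := pos_lower_bound r0 x00.
exists M, d; split=> // x x_0 xd; rewrite -fg //; last exact: le_trans dr.
by apply: H => //; exact: le_trans dx.
Qed.

Lemma bigOhD N f g : bigOh N f -> bigOh N g -> bigOh N (fun x => f x + g x).
Proof.
move=> [M [x0 [M0 x00 H]]] [M' [x0' [M0' x00' H']]].
have [d d0 [d1 d2]] := pos_lower_bound x00 x00'.
exists (M + M'), d; split=> // [|x x_0 xd]; first exact: addr_ge0.
apply: le_trans (ler_normD _ _) _; rewrite mulrDl; apply: lerD.
  by apply: H => //; exact: le_trans d1.
by apply: H' => //; exact: le_trans d2.
Qed.

Lemma bigOhN N f : bigOh N f -> bigOh N (fun x => - f x).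
Proof.
by move=> [M [x0 [M0 x00 H]]]; exists M, x0; split=> // x *; rewrite normrN H.
Qed.

Lemma bigOhB N f g : bigOh N f -> bigOh N g -> bigOh N (fun x => f x - g x).
Proof. by move=> Hf Hg; apply: bigOhD => //; exact: bigOhN. Qed.

Lemma bigOhM N N' f g : bigOh N f -> bigOh N' g -> bigOh (N + N') (fun x => f x * g x).
Proof.
move=> [M [x0 [M0 x00 H]]] [M' [x0' [M0' x00' H']]].
have [d d0 [d1 d2]] := pos_lower_bound x00 x00'.
exists (M * M'), d; split=> // [|x x_0 xd]; first exact: mulr_ge0.
rewrite normrM exprD mulrACA ler_pM //.
  by apply: H => //; exact: le_trans d1.
by apply: H' => //; exact: le_trans d2.
Qed.

Lemma bigOh_cst c : bigOh 0 (fun=> c).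
Proof. by exists `|c|, 1; split=> // x _ _; rewrite expr0 mulr1. Qed.

Lemma bigOh_exp N c : bigOh N (fun x => x ^+ N * c).
Proof.
exists `|c|, 1; split=> // x x0 _.
by rewrite normrM (ger0_norm (exprn_ge0 _ (ltW x0))) mulrC.
Qed.

Lemma bigOhW N N' f : (N' <= N)%N -> bigOh N f -> bigOh N' f.
Proof.
move=> NN [M [x0 [M0 x00 H]]]; have [d d0 [d1 d2]] := pos_lower_bound x00 ltr01.
exists M, d; split=> // x x_0 xd; apply: le_trans (H _ x_0 (le_trans xd d1)) _.
rewrite ler_wpM2l // -(subnK NN) exprD ler_piMl ?exprn_ge0 ?(ltW x_0) //.
by rewrite exprn_ile1 ?(ltW x_0) // (le_trans xd).
Qed.

Lemma bigOh_sum (I : Type) (r : seq I) N (f : I -> K -> K) :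
  (forall i, bigOh N (f i)) -> bigOh N (fun x => \sum_(i <- r) f i x).
Proof.
move=> H; elim: r => [|i r IH].
  exists 0, 1; split=> // x _ _; rewrite big_nil normr0 mul0r //.
by apply: eq_bigOh (bigOhD (H i) IH) => x; rewrite big_cons.
Qed.

Lemma bigOh_norm_le N f g : bigOh N g ->
  (exists2 r, 0 < r & forall x, 0 < x -> x <= r -> `|f x| <= `|g x|) -> bigOh N f.
Proof.
move=> [M [x0 [M0 x00 H]]] [r r0 fg]; have [d d0 [d1 d2]] := pos_lower_bound x00 r0.
exists M, d; split=> // x x_0 xd; apply: le_trans (fg _ x_0 (le_trans xd d2)) _.
by apply: H => //; exact: le_trans d1.
Qed.

Lemma bigOh1_cst c : bigOh 1 (fun=> c) -> c = 0.
Proof.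
move=> [M [x0 [M0 x00 H]]]; apply/eqP; rewrite -normr_le0.
have [//|c0] := eqVneq c 0; first by move=> ->; rewrite normr0.
have p : 0 < `|c| / (2%:R * (M + 1)).
  by rewrite divr_gt0 ?normr_gt0 // mulr_gt0 // ltr_wpDl.
have [d d0 [d1 d2]] := pos_lower_bound x00 p.
have := H _ d0 d1; rewrite expr1 => /le_trans/(_ (ler_wpM2l M0 d2)).
rewrite mulrCA -[leLHS]mulr1 ler_pM2l ?normr_gt0 // ler_pdivlMr; last first.
  by rewrite mulr_gt0 // ltr_wpDl.
rewrite mul1r => h; exfalso; move: h; apply/negP.
rewrite -real_ltNge ?ger0_real ?mulr_ge0 ?addr_ge0 //.
by rewrite mulr_natl mulr2n -[ltLHS]addr0 ltr_leD ?ltrDl // addr_ge0.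
Qed.

(** Uniqueness of Taylor coefficients: the constant term is small with [x], hence 0; dividing by [x]
    lowers the order. *)
Lemma bigOh_poly_unique N (a : nat -> K) : bigOh N (fun x => \sum_(k < N) x ^+ k * a k) ->
  forall k, (k < N)%N -> a k = 0.
Proof.
elim: N a => [//|N IH] a H.
have a0 : a 0%N = 0.
  apply: bigOh1_cst; pose g (x : K) := \sum_(i < N) x ^+ (lift ord0 i) * a (lift ord0 i).
  apply: (@eq_bigOh _ (fun x => (\sum_(k < N.+1) x ^+ k * a k) - g x)).
    by move=> x; rewrite big_ord_recl expr0 mul1r addrK.
  apply: bigOhB; first exact: bigOhW H.
  by apply: bigOh_sum => i; apply: (@bigOhW (lift ord0 i)) => //; exact: bigOh_exp.
case=> [//|k] kN; apply: (IH (fun k => a k.+1)) => //.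
have [M [x0 [M0 x00 {}H]]] := H; exists M, x0; split=> // x x_0 xx.
have := H _ x_0 xx; rewrite big_ord_recl a0 mulr0 add0r.
under eq_bigr do rewrite /bump /= exprS -mulrA.
rewrite -mulr_sumr normrM (gtr0_norm x_0) exprS mulrCA ler_pM2l //.
Qed.

End SmallArguments.

(** * Coefficientwise comparison of polynomials *)

Section NonnegativePolynomials.
Context {K : numClosedFieldType}.
Implicit Types (p q : {poly K}).

(** Nonnegativity of [p] is included, so that the relation is stable under products and [polyle p p]
    says that [p] has nonnegative coefficients. *)
Definition polyle p q : Prop := forall k, 0 <= p`_k /\ p`_k <= q`_k.

Lemma polyle_sum (I : Type) (r : seq I) (P : pred I) (p q : I -> {poly K}) :
  (forall i, polyle (p i) (q i)) ->
  polyle (\sum_(i <- r | P i) p i) (\sum_(i <- r | P i) q i).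
Proof.
move=> pq k; rewrite !coef_sum; split.
  by apply: sumr_ge0 => i _; case: (pq i k).
by apply: ler_sum => i _; case: (pq i k).
Qed.

Lemma polyleM p q p' q' : polyle p q -> polyle p' q' -> polyle (p * p') (q * q').
Proof.
move=> pq pq' k; rewrite !coefM; split.
  by apply: sumr_ge0 => i _; rewrite mulr_ge0 //; [case: (pq i)|case: (pq' (k - i)%N)].
by apply: ler_sum => i _; case: (pq i) => *; case: (pq' (k - i)%N) => *; exact: ler_pM.
Qed.

Lemma polyle1 : polyle 1 1.
Proof. by move=> k; rewrite coef1. Qed.

Lemma polyle_exp p q n : polyle p q -> polyle (p ^+ n) (q ^+ n).
Proof.
move=> pq; elim: n => [|n IH]; first by rewrite !expr0; exact: polyle1.
by rewrite !exprS; apply: polyleM.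
Qed.

Lemma polyle_prod (I : Type) (r : seq I) (P : pred I) (p q : I -> {poly K}) :
  (forall i, polyle (p i) (q i)) ->
  polyle (\prod_(i <- r | P i) p i) (\prod_(i <- r | P i) q i).
Proof.
move=> pq; apply: (big_ind2 polyle) => //; [exact: polyle1|].
by move=> *; apply: polyleM.
Qed.

Lemma polyleZ (c : K) p q : 0 <= c -> polyle p q -> polyle (c *: p) (c *: q).
Proof.
move=> c0 pq k; rewrite !coefZ; have [a b] := pq k.
by rewrite mulr_ge0 // ler_wpM2l.
Qed.

Lemma horner_ge0 p (x : K) : (forall k, 0 <= p`_k) -> 0 <= x -> 0 <= p.[x].
Proof.
move=> p0 x0; rewrite horner_coef; apply: sumr_ge0 => i _.
by rewrite mulr_ge0 // exprn_ge0.
Qed.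

Lemma horner_le p (x y : K) : (forall k, 0 <= p`_k) -> 0 <= x -> x <= y ->
  p.[x] <= p.[y].
Proof.
move=> p0 x0 xy; rewrite !horner_coef; apply: ler_sum => i _.
by rewrite ler_wpM2l // lerXn2r ?nnegrE // (le_trans x0).
Qed.

Lemma horner_take p (N : nat) (x : K) : (take_poly N p).[x] = \sum_(k < N) x ^+ k * p`_k.
Proof.
rewrite (horner_coef_wide x (size_take_poly N p)); apply: eq_bigr => k _.
by rewrite coef_take_poly ltn_ord mulrC.
Qed.

Hypothesis Kc : monotone_complete K.

(** Monotone convergence for coefficients: each is bounded by [f x1 / x1 ^ k], hence converges. The
    part of degree at least [N] at [x] is at most [(x / x1) ^ N] times that at [x1], which yields
    the remainder of [f] uniformly in the box size [B]. *)
Lemma nonneg_poly_limit (P : nat -> {poly K}) (f : K -> K) (x1 : K) : 0 < x1 ->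
  (forall B, polyle (P B) (P B.+1)) ->
  (forall x, 0 <= x -> x <= x1 -> (fun B => (P B).[x]) @ \oo --> f x) ->
  exists g : nat -> K, [/\ forall k, 0 <= g k, forall B k, (P B)`_k <= g k,
    forall N, \sum_(k < N) x1 ^+ k * g k <= f x1 &
    forall N x, 0 <= x -> x <= x1 ->
      `|f x - \sum_(k < N) x ^+ k * g k| <= f x1 * (x / x1) ^+ N].
Proof.
move=> x10 PP Pf; have x10' := ltW x10.
have P0 B k : 0 <= (P B)`_k by case: (PP B k).
have Pinc B : (P B).[x1] <= f x1.
  have := @nondecreasing_cvg_ler K (fun B => (P B).[x1]) _ _ (Pf x1 x10' (lexx _)) B.
  apply=> C; rewrite -subr_ge0 -hornerN -hornerD horner_ge0 // => k.
  by rewrite coefD coefN subr_ge0; case: (PP C k).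
have dP B N k : 0 <= (drop_poly N (P B))`_k by rewrite coef_drop_poly.
have split_P B N x : (P B).[x] =
    \sum_(k < N) x ^+ k * (P B)`_k + (drop_poly N (P B)).[x] * x ^+ N.
  by rewrite -{1}(poly_take_drop N (P B)) hornerD hornerM hornerXn horner_take.
have partial B N : \sum_(k < N) x1 ^+ k * (P B)`_k <= f x1.
  apply: le_trans (Pinc B); rewrite (split_P B N x1) lerDl.
  by rewrite mulr_ge0 ?exprn_ge0 ?horner_ge0.
have Pk B k : (P B)`_k <= f x1 / x1 ^+ k.
  rewrite ler_pdivlMr ?exprn_gt0 // mulrC; apply: le_trans (partial B k.+1).
  by rewrite big_ord_recr /= lerDr sumr_ge0 // => i _; rewrite mulr_ge0 ?exprn_ge0.
have Pcvg k : (fun B => (P B)`_k) @ \oo --> limn (fun B => (P B)`_k).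
  by apply: (Kc (M := f x1 / x1 ^+ k)) => B; [case: (PP B k)|exact: Pk].
set g := fun k => limn (fun B => (P B)`_k).
have sum_cvg N (x : K) : (fun B => \sum_(k < N) x ^+ k * (P B)`_k) @ \oo -->
    \sum_(k < N) x ^+ k * g k.
  by apply: cvgr_sum => k; apply: cvgMr; exact: Pcvg.
exists g; split.
- by move=> k; apply: (ger0_cvg (Pcvg k)); exact: nearW.
- move=> B k; apply: nondecreasing_cvg_ler (Pcvg k) _ => C.
  by case: (PP C k).
- by move=> N; apply: (ler_cvg_cst (sum_cvg N x1)) => B; exact: partial.
move=> N x x0 xx1.
apply: (ler_cvg_cst (cvg_norm (cvgB (Pf x x0 xx1) (sum_cvg N x)))) => B.
rewrite !fctE (split_P B N x) addrAC subrr add0r.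
rewrite ger0_norm ?mulr_ge0 ?exprn_ge0 ?horner_ge0 // expr_div_n mulrCA mulrC.
rewrite ler_wpM2l ?exprn_ge0 // ler_pdivlMr ?exprn_gt0 //.
apply: le_trans (Pinc B); rewrite (split_P B N x1).
apply: le_trans (_ : (drop_poly N (P B)).[x1] * x1 ^+ N <= _).
  by rewrite ler_wpM2r ?exprn_ge0 // horner_le.
by rewrite lerDr sumr_ge0 // => k _; rewrite mulr_ge0 ?exprn_ge0.
Qed.

End NonnegativePolynomials.

Section NonnegativeSeries.
Context {K : numClosedFieldType} {n : nat}.
Local Notation expo := {ffun 'I_n -> nat}.
Implicit Types (c : expo -> K) (x y : 'rV[K]_n).

Lemma ffmon_ge0 k l (x : K) : 0 <= x -> 0 <= ffmon k l x.
Proof. by move=> x0; rewrite mulr_ge0 // exprn_ge0. Qed.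

Lemma ffmon_le k l (x y : K) : 0 <= x -> x <= y -> ffmon k l x <= ffmon k l y.
Proof.
move=> x0 xy; rewrite ler_wpM2l // lerXn2r ?nnegrE //; exact: le_trans xy.
Qed.

Lemma dmon_ge0 al (a : expo) x : (forall i, 0 <= x 0 i) -> 0 <= dmon al a x.
Proof. by move=> x0; apply: prodr_ge0 => i _; exact: ffmon_ge0. Qed.

Lemma dmon_le al (a : expo) x y : (forall i, 0 <= x 0 i) ->
  (forall i, x 0 i <= y 0 i) -> dmon al a x <= dmon al a y.
Proof.
by move=> x0 xy; apply: ler_prod => i _; rewrite ffmon_ge0 // ffmon_le.
Qed.

Lemma bbounded_dmon_le c al x y : (forall a, 0 <= c a) -> (forall i, 0 <= x 0 i) ->
  (forall i, x 0 i <= y 0 i) -> bbounded (fun a => c a * dmon al a y) ->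
  bbounded (fun a => c a * dmon al a x).
Proof.
move=> c0 x0 xy; apply: (@bbounded_le _ _ _ _ 1) => // a.
have y0 i : 0 <= y 0 i by apply: le_trans (xy i).
by rewrite mul1r !ger0_norm ?mulr_ge0 ?dmon_ge0 // ler_wpM2l // dmon_le.
Qed.

Lemma bernoulli_le k (x y : K) : 0 <= x -> x <= y ->
  ffmon k 0 x + (y - x) * ffmon k 1 x <= ffmon k 0 y.
Proof.
move=> x0 xy; have y0 := le_trans x0 xy; rewrite /ffmon !ffactn0 ffactn1 !mul1r !subn0.
elim: k => [|k IH]; first by rewrite !expr0 mul0r mulr0 addr0.
rewrite subSS subn0 !exprS; apply: le_trans (ler_wpM2l y0 IH); rewrite -subr_ge0.
case: k {IH} => [|k].
  rewrite le_eqVlt; apply/orP; left; apply/eqP; rewrite sub0n !expr0; ring.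
rewrite subSS subn0 exprS -[k.+2%:R]natr1.
move: (k.+1%:R : K) (ler0n K k.+1) => q q0.
have -> : y * (x * x ^+ k + (y - x) * (q * x ^+ k)) -
   (x * (x * x ^+ k) + (y - x) * ((q + 1) * (x * x ^+ k))) =
   (y - x) ^+ 2 * (q * x ^+ k) by ring.
by rewrite mulr_ge0 ?exprn_ge0 ?subr_ge0 // mulr_ge0 // exprn_ge0.
Qed.

Lemma prod_convex (I : eqType) (r : seq I) (f f' d : I -> K) : uniq r ->
  (forall i, 0 <= f i) -> (forall i, 0 <= d i) -> (forall i, f i + d i <= f' i) ->
  \prod_(i <- r) f i + \sum_(i <- r) d i * \prod_(j <- r | j != i) f j <=
  \prod_(i <- r) f' i.
Proof.
move=> + f0 d0 ff; elim: r => [_|i r IH /= /andP[ir ur]].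
  by rewrite !big_nil addr0.
rewrite sum_prod_others_cons // ![\prod_(j <- _ :: _) _]big_cons.
set P := \prod_(j <- r) f j; set S := \sum_(k <- r) _.
have P0 : 0 <= P by apply: prodr_ge0.
have S0 : 0 <= S by apply: sumr_ge0 => k _; rewrite mulr_ge0 // prodr_ge0.
apply: le_trans (_ : (f i + d i) * (P + S) <= _); last first.
  by apply: ler_pM => //; rewrite ?addr_ge0 //; exact: IH.
rewrite -subr_ge0; have -> : (f i + d i) * (P + S) - (f i * P + (d i * P + f i * S)) =
  d i * S by ring.
exact: mulr_ge0.
Qed.

Definition zexp : 'I_n -> nat := fun=> 0%N.

(** A monomial such as the product of two variables is not convex. The tangent inequality holds
    between comparable nonnegative points, where all terms of higher order are nonnegative. *)
Lemma dmon_convex (a : expo) x y : (forall i, 0 <= x 0 i) -> (forall i, x 0 i <= y 0 i) ->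
  dmon zexp a x + \sum_j (y - x) 0 j * dmon (succ_at j zexp) a x <= dmon zexp a y.
Proof.
move=> x0 xy; rewrite [\sum_j _](_ : _ = \sum_j ((y 0 j - x 0 j) * ffmon (a j) 1 (x 0 j)) *
  \prod_(i | i != j) ffmon (a i) 0 (x 0 i)).
  apply: prod_convex => [|i|i|i]; [exact: index_enum_uniq|exact: ffmon_ge0| |].
    by rewrite mulr_ge0 ?subr_ge0 ?ffmon_ge0.
  exact: bernoulli_le.
apply: eq_bigr => j _; rewrite !mxE -mulrA; congr (_ * _).
rewrite /dmon (bigD1 j) //= /succ_at eqxx; congr (_ * _).
by apply: eq_bigr => i ij; rewrite (negPf ij).
Qed.

Hypothesis Kc : monotone_complete K.

Lemma psder_ge0 c al x : (forall a, 0 <= c a) -> (forall i, 0 <= x 0 i) ->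
  bbounded (fun a => c a * dmon al a x) -> 0 <= psder al c x.
Proof. by move=> c0 x0; apply: btot_ge0 => // a; rewrite mulr_ge0 ?dmon_ge0. Qed.

Lemma psder_le c al x y : (forall a, 0 <= c a) -> (forall i, 0 <= x 0 i) ->
  (forall i, x 0 i <= y 0 i) -> bbounded (fun a => c a * dmon al a y) ->
  psder al c x <= psder al c y.
Proof.
move=> c0 x0 xy by_; have bx := bbounded_dmon_le c0 x0 xy by_.
apply: (ler_cvg_seq (cvg_bsum Kc bx) (cvg_bsum Kc by_)) => N.
by apply: ler_bsum => a; rewrite ler_wpM2l // dmon_le.
Qed.

Lemma psder_convex c x y : (forall a, 0 <= c a) -> (forall i, 0 <= x 0 i) ->
  (forall i, x 0 i <= y 0 i) -> bbounded (fun a => c a * dmon zexp a y) ->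
  (forall j, bbounded (fun a => c a * dmon (succ_at j zexp) a x)) ->
  psder zexp c x + \sum_j (y - x) 0 j * psder (succ_at j zexp) c x <= psder zexp c y.
Proof.
move=> c0 x0 xy by_ bd; have bx := bbounded_dmon_le c0 x0 xy by_.
have cl : (fun N => bsum N (fun a => c a * dmon zexp a x) +
    \sum_j (y - x) 0 j * bsum N (fun a => c a * dmon (succ_at j zexp) a x)) @ \oo -->
    psder zexp c x + \sum_j (y - x) 0 j * psder (succ_at j zexp) c x.
  apply: cvgD; first exact: cvg_bsum.
  by apply: cvgr_sum => j; apply: cvgMr; exact: cvg_bsum.
apply: (ler_cvg_seq cl (cvg_bsum Kc by_)) => N.
rewrite [\sum_j _](_ : _ = bsum N (fun a => \sum_j (y - x) 0 j *
    (c a * dmon (succ_at j zexp) a x))); last first.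
  by rewrite /bsum exchange_big /=; apply: eq_bigr => j _; rewrite mulr_sumr.
rewrite /bsum -big_split /=; apply: ler_sum => b _; set a := [ffun _ => _].
apply: le_trans (ler_wpM2l (c0 a) (dmon_convex a x0 xy)).
rewrite mulrDr mulr_sumr; apply: lerD => //; apply: ler_sum => j _.
by rewrite mulrCA.
Qed.

(** At a point with positive coordinates each term is at most the vanishing sum, while the
    derivative of a monomial with [al <= a] is positive there. *)
Lemma psder_eq0_coef c al x : (forall a, 0 <= c a) -> (forall i, 0 < x 0 i) ->
  bbounded (fun a => c a * dmon al a x) -> psder al c x = 0 ->
  forall a : expo, (forall i, (al i <= a i)%N) -> c a = 0.
Proof.
move=> c0 x0 bx e a ala; have x0' i := ltW (x0 i).
have F0 a' : 0 <= c a' * dmon al a' x by rewrite mulr_ge0 // dmon_ge0.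
have := term_le_btot Kc a F0 bx; rewrite -/(psder al c x) e.
move=> h; have /eqP : c a * dmon al a x = 0 by apply/eqP; rewrite eq_le h F0.
rewrite mulf_eq0 => /orP[/eqP//|]; rewrite gt_eqF //.
apply: prodr_gt0 => i _; rewrite mulr_gt0 ?exprn_gt0 // ltr0n ffact_gt0; exact: ala.
Qed.

End NonnegativeSeries.

(** * Systems with nonnegative coefficients *)

Section System.
Context {K : numClosedFieldType} (Kc : monotone_complete K) {m : nat}.
Variable h : 'I_m -> {ffun 'I_(1 + m) -> nat} -> K.

(** The analogue of [zY] over an abstract field, convertible to it over the complex numbers. *)
Definition pt (z : K) (Y : 'rV[K]_m) : 'rV[K]_(1 + m) := row_mx z%:M Y.

Lemma pt_l z Y : pt z Y 0 (lshift m 0) = z.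
Proof. by rewrite row_mxEl mxE. Qed.

Lemma pt_r z Y j : pt z Y 0 (rshift 1 j) = Y 0 j.
Proof. by rewrite row_mxEr. Qed.

Lemma rowBE n (x x' : 'rV[K]_n) v : (x - x') 0 v = x 0 v - x' 0 v.
Proof. by rewrite !mxE. Qed.

Lemma ord_pt (P : 'I_(1 + m) -> Prop) :
  P (lshift m 0) -> (forall j, P (rshift 1 j)) -> forall v, P v.
Proof.
move=> Pl Pr v; case: (split_ordP v) => k -> //.
by rewrite (ord1 k).
Qed.

Definition Heval i p : K := psder zexp (h i) p.
Definition dHeval i j p : K := psder (succ_at (rshift 1 j) zexp) (h i) p.

Definition absconv (p : 'rV[K]_(1 + m)) : Prop :=
  forall i, bbounded (fun a => h i a * dmon zexp a p).

(* Absolute convergence on a polydisc slightly larger than the one through [p]. *)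
Definition in_domain (p : 'rV[K]_(1 + m)) : Prop := exists2 e, 0 < e &
  forall i, bbounded (fun a => h i a * spow (fun v => `|p 0 v| + e) a).

Lemma halfr_gt0 (e : K) : 0 < e -> 0 < e / 2%:R.
Proof. by move=> e0; rewrite divr_gt0. Qed.

Lemma halfrD (e : K) : e / 2%:R + e / 2%:R = e.
Proof. by field. Qed.

(** Half of the margin [e] is spent on the size of the neighborhood; the other half remains as the
    margin that bounds all derivatives on it. *)
Lemma in_domain_nbhs (p : 'rV[K]_(1 + m)) : in_domain p -> exists D, [/\ nbhs p D,
  forall x, D x -> in_domain x, forall v, exists M, forall x, D x -> `|x 0 v| <= M,
  forall i al x, D x -> bbounded (fun a => h i a * dmon al a x) &
  forall i al, c2on D (psder al (h i)) (fun j => psder (succ_at j al) (h i))].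
Proof.
move=> [e e0 He]; have d0 := halfr_gt0 e0; set d := e / 2%:R in d0.
have s0 v : 0 <= `|p 0 v| + d by rewrite addr_ge0 // ltW.
have sb i : bbounded (fun a => h i a * spow (fun v => `|p 0 v| + d + d) a).
  apply: (@bbounded_le _ _ _ _ 1 _ _ (He i)) => // a; rewrite mul1r le_eqVlt.
  apply/orP; left; apply/eqP; congr (`|_ * _|); apply: eq_bigr => v _.
  by rewrite -addrA halfrD.
exists [set x | forall v, `|x 0 v| <= `|p 0 v| + d]; split.
- apply/nbhs_ballP; exists d => //= x; rewrite -ball_normE /= => px v.
  rewrite -[x 0 v](subrK (p 0 v)) addrC; apply: le_trans (ler_normD _ _) _.
  rewrite lerD2l; apply: le_trans (ltW px); rewrite distrC.
  by have := ler_coord_norm (p - x) v; rewrite !mxE.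
- move=> x Dx; exists d => // i; apply: (@bbounded_le _ _ _ _ 1 _ _ (sb i)) => // a.
  rewrite mul1r !normrM ler_wpM2l // !ger0_norm.
  + apply: ler_prod => v _; rewrite exprn_ge0 ?addr_ge0 ?(ltW d0) //=.
    by rewrite lerXn2r ?nnegrE ?addr_ge0 ?(ltW d0) // lerD2r; exact: Dx.
  + by apply: prodr_ge0 => v _; rewrite exprn_ge0 // addr_ge0 // ltW.
  + by apply: prodr_ge0 => v _; rewrite exprn_ge0 // addr_ge0 // ltW.
- by move=> v; exists (`|p 0 v| + d) => x; apply.
- by move=> i al x Dx; apply: (bbounded_dmon s0 d0 (sb i)).
- move=> i al; have [L [B [L0 HT]]] := taylor2_psder Kc s0 d0 (sb i) al.
  by exists L, B; split=> // x x' Dx Dx'; exact: HT.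
Qed.

Lemma in_domain_bbounded p i al : in_domain p -> bbounded (fun a => h i a * dmon al a p).
Proof. by move=> /in_domain_nbhs[D [nD _ _ + _]]; apply; exact: nbhs_singleton. Qed.

Lemma in_domain_absconv p : in_domain p -> absconv p.
Proof. by move=> dp i; exact: in_domain_bbounded. Qed.

Hypothesis h0 : forall i a, 0 <= h i a.

Lemma pt_ge0 z (Y : 'rV[K]_m) : 0 <= z -> (forall j, 0 <= Y 0 j) -> forall v, 0 <= pt z Y 0 v.
Proof. by move=> z0 Y0; apply: ord_pt => [|j]; rewrite ?pt_l ?pt_r. Qed.

Lemma pt_le z z' (Y Y' : 'rV[K]_m) : z <= z' -> (forall j, Y 0 j <= Y' 0 j) ->
  forall v, pt z Y 0 v <= pt z' Y' 0 v.
Proof. by move=> zz YY; apply: ord_pt => [|j]; rewrite ?pt_l ?pt_r. Qed.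

Lemma absconv_le (p q : 'rV[K]_(1 + m)) : (forall v, 0 <= p 0 v) -> (forall v, p 0 v <= q 0 v) ->
  absconv q -> absconv p.
Proof. by move=> p0 pq aq i; apply: bbounded_dmon_le (aq i). Qed.

Lemma in_domain_le (p q : 'rV[K]_(1 + m)) : (forall v, 0 <= p 0 v) -> (forall v, p 0 v <= q 0 v) ->
  in_domain q -> in_domain p.
Proof.
move=> p0 pq [e e0 He]; exists e => // i.
apply: (@bbounded_le _ _ _ _ 1 _ _ (He i)) => // a.
rewrite mul1r !normrM ler_wpM2l // !ger0_norm.
- apply: ler_prod => v _; rewrite exprn_ge0 ?addr_ge0 ?(ltW e0) //=.
  rewrite lerXn2r ?nnegrE ?addr_ge0 ?(ltW e0) // lerD2r !ger0_norm //.
  exact: le_trans (pq v).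
- by apply: prodr_ge0 => v _; rewrite exprn_ge0 // addr_ge0 // ltW.
- by apply: prodr_ge0 => v _; rewrite exprn_ge0 // addr_ge0 // ltW.
Qed.

Lemma Heval_ge0 i (p : 'rV[K]_(1 + m)) : (forall v, 0 <= p 0 v) -> absconv p -> 0 <= Heval i p.
Proof. by move=> p0 ap; apply: psder_ge0. Qed.

Lemma Heval_le i (p q : 'rV[K]_(1 + m)) : (forall v, 0 <= p 0 v) -> (forall v, p 0 v <= q 0 v) ->
  absconv q -> Heval i p <= Heval i q.
Proof. by move=> p0 pq aq; apply: psder_le. Qed.

Definition supersol (z : K) (Z : 'rV[K]_m) : Prop :=
  [/\ forall j, 0 <= Z 0 j, absconv (pt z Z) & forall i, Heval i (pt z Z) <= Z 0 i].

(** The point moves by [e (k, w)]. To first order [H] grows by [e (k b + A w)], and [1 + A w <= w]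
    leaves a slack of [e]: one half absorbs [k b], the other half the quadratic remainder. *)
Lemma exists_supersol z0 (Z0 : 'rV[K]_m) (w : 'I_m -> K) :
  0 <= z0 -> (forall j, 0 <= Z0 0 j) -> in_domain (pt z0 Z0) ->
  (forall i, Heval i (pt z0 Z0) = Z0 0 i) -> (forall i, 0 <= w i) ->
  (forall i, 1 + \sum_j dHeval i j (pt z0 Z0) * w j <= w i) ->
  exists z1 Z, z0 < z1 /\ supersol z1 Z.
Proof.
move=> z00 Z00 dp HZ w0 Aw; set p := pt z0 Z0 in dp HZ Aw.
have p0 : forall v, 0 <= p 0 v by exact: pt_ge0.
have [D [nD _ _ Dbb c2]] := in_domain_nbhs dp.
have Dp := nbhs_singleton nD.
have /choice[M HM] : forall i, exists M, 0 <= M /\ forall x x', D x -> D x' ->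
    `|Heval i x' - Heval i x - \sum_v (x' - x) 0 v * psder (succ_at v zexp) (h i) x| <=
    M * `|x' - x| ^+ 2.
  by move=> i; have [M M0 HM] := c2on_quadratic (c2 i zexp); exists M.
have M0 i : 0 <= M i by case: (HM i).
set S := \sum_i M i; have S0 : 0 <= S by apply: sumr_ge0.
pose b i := psder (succ_at (lshift m 0) zexp) (h i) p.
have b0 i : 0 <= b i by apply: psder_ge0 => //; exact: Dbb.
set bS := \sum_i b i; have bS0 : 0 <= bS by apply: sumr_ge0.
(* Chosen so that [k * b i <= 1 / 2] for every [i]. *)
set k := (2%:R * (1 + bS))^-1.
have k0 : 0 < k by rewrite invr_gt0 mulr_gt0 // ltr_pwDl.
have kb i : k * b i <= 2%:R^-1.
  rewrite /k invfM -mulrA ger_pMr ?invr_gt0 // ler_pdivrMl ?ltr_pwDl // mulr1.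
  by rewrite ler_wpDl // /bS (bigD1 i) //= lerDl sumr_ge0.
set W := 1 + \sum_i w i.
have W1 : 1 <= W by rewrite lerDl sumr_ge0.
have W0 : 0 < W by apply: lt_le_trans W1.
have wW i : w i <= W by rewrite ler_wpDl // (bigD1 i) //= lerDl sumr_ge0.
have kW : k <= W.
  apply: le_trans W1; rewrite invf_le1 ?mulr_gt0 ?ltr_pwDl //.
  by rewrite mulr_natl mulr2n -addrA lerDl !addr_ge0.
have := nD; rewrite nbhs_ballP => -[r /= r0 rD].
(* The displacement has norm at most [e W]: the first bound on [e] keeps it inside the ball of
   radius [r], the second one gives [S (e W) ^ 2 <= e / 2]. *)
have p1 : 0 < r / (2%:R * W) by rewrite divr_gt0 // mulr_gt0.
have p2 : 0 < (2%:R * (S * W ^+ 2 + 1))^-1.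
  by rewrite invr_gt0 mulr_gt0 // ltr_wpDl // mulr_ge0 // exprn_ge0 // ltW.
have [e e0 [er eS]] := pos_lower_bound p1 p2; have e0' := ltW e0.
pose Z := \row_j (Z0 0 j + e * w j) : 'rV[K]_m; pose q := pt (z0 + e * k) Z.
have ek0 : 0 < e * k by rewrite mulr_gt0.
have Z_0 j : 0 <= Z 0 j by rewrite mxE addr_ge0 // mulr_ge0.
have q0 : forall v, 0 <= q 0 v by apply: pt_ge0 => //; rewrite addr_ge0 // ltW.
have qpl : (q - p) 0 (lshift m 0) = e * k by rewrite rowBE !pt_l addrAC subrr add0r.
have qpr j : (q - p) 0 (rshift 1 j) = e * w j.
  by rewrite rowBE !pt_r mxE addrAC subrr add0r.
have qp : `|q - p| <= e * W.
  apply: norm_row_le; first by rewrite mulr_ge0 // ltW.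
  apply: ord_pt => [|j]; first by rewrite qpl ger0_norm ?(ltW ek0) // ler_wpM2l.
  by rewrite qpr ger0_norm ?mulr_ge0 // ler_wpM2l.
have Dq : D q.
  apply: rD; rewrite -ball_normE /= distrC; apply: le_lt_trans qp _.
  move: er; rewrite ler_pdivlMr ?mulr_gt0 // mulrCA mulrC => er.
  rewrite -(ltr_pM2r (ltr0n K 2)); apply: le_lt_trans er _.
  by rewrite mulr_natr mulr2n ltrDl.
exists (z0 + e * k), Z; split; first by rewrite ltrDl.
split=> // i; first exact: Dbb.
have [_ /(_ _ _ Dp Dq)] := HM i; rewrite -/p -/q HZ.
have -> : \sum_v (q - p) 0 v * psder (succ_at v zexp) (h i) p =
   e * (k * b i) + e * \sum_j dHeval i j p * w j.
  rewrite big_split_ord big_ord1 qpl mulrA; congr (_ + _).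
  by rewrite mulr_sumr; apply: eq_bigr => j _; rewrite qpr /dHeval; ring.
set sA := \sum_j _ => hq.
have sA0 : 0 <= sA by apply: sumr_ge0 => j _; rewrite mulr_ge0 // psder_ge0 //; exact: Dbb.
have Hq0 : 0 <= Heval i q by apply: Heval_ge0 => // i'; exact: Dbb.
have hr : Heval i q - Z0 0 i - (e * (k * b i) + e * sA) <= M i * `|q - p| ^+ 2.
  apply: le_trans hq; apply: real_ler_norm.
  by rewrite !rpredB ?ger0_real // addr_ge0 // !mulr_ge0 // ltW.
have hM : M i * `|q - p| ^+ 2 <= e * 2%:R^-1.
  apply: le_trans (_ : S * (e * W) ^+ 2 <= _).
    apply: ler_pM => //.
      by rewrite /S (bigD1 i) //= lerDl sumr_ge0.
    by rewrite lerXn2r ?nnegrE // mulr_ge0 // ltW.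
  rewrite exprMn mulrCA {1}expr2 -mulrA ler_wpM2l //.
  have SW0 : 0 <= S * W ^+ 2 by rewrite mulr_ge0 // exprn_ge0 // ltW.
  apply: le_trans (ler_wpM2r SW0 eS) _.
  rewrite invfM -mulrA ger_pMr ?invr_gt0 // ler_pdivrMl ?ltr_wpDl // mulr1.
  by rewrite lerDl.
rewrite mxE; move: (le_trans hr hM); rewrite lerBlDr lerBlDl => /le_trans; apply.
rewrite lerD2l; apply: le_trans (ler_wpM2l e0' (Aw i)); rewrite -!mulrDr ler_wpM2l //.
rewrite addrA lerD2r; apply: le_trans (_ : 2%:R^-1 + 2%:R^-1 <= _); last first.
  by rewrite -[leRHS](halfrD 1) !mul1r.
by rewrite lerD2l.
Qed.

Section Solution.
Variables (y : nat -> 'rV[K]_m) (Yf : K -> 'rV[K]_m).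
Hypothesis Yf_asymp : forall j N, bigOh N (fun x => Yf x 0 j - \sum_(k < N) x ^+ k * y k 0 j).
Hypothesis Yf_fix : exists2 r, 0 < r & forall x, 0 < x -> x <= r ->
  forall i, Yf x 0 i = Heval i (pt x (Yf x)).
Hypothesis dom0 : in_domain (pt 0 (y 0%N)).

Let A0 i j : K := dHeval i j (pt 0 (y 0%N)).

Lemma bigOh_normr N (f : K -> K) : bigOh N f -> bigOh N (fun x => `|f x|).
Proof. by move=> [M [x0 [M0 x00 H]]]; exists M, x0; split=> // x *; rewrite normr_id H. Qed.

(** The series truncated below degree [N], with a candidate [p] in place of the coefficient of
    degree [N]. *)
Definition ptr N (p : 'I_m -> K) (x : K) : 'rV[K]_m :=
  \row_j (\sum_(k < N) x ^+ k * y k 0 j + x ^+ N * p j).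

Lemma bigOh_pt (F : K -> 'rV[K]_m) : (forall j, bigOh 1 (fun x => F x 0 j - y 0%N 0 j)) ->
  bigOh 1 (fun x => `|pt x (F x) - pt 0 (y 0%N)|).
Proof.
move=> HF.
have HS : bigOh 1 (fun x => `|x| + \sum_j `|F x 0 j - y 0%N 0 j|).
  apply: bigOhD; last by apply: bigOh_sum => j; exact: bigOh_normr.
  by apply: bigOh_normr; apply: eq_bigOh (bigOh_exp 1 1) => x; rewrite expr1 mulr1.
apply: bigOh_norm_le HS _; exists 1 => // x x0 _; rewrite normr_id.
rewrite [X in _ <= X]ger0_norm ?addr_ge0 ?sumr_ge0 //.
apply: norm_row_le; first by rewrite addr_ge0 ?sumr_ge0.
apply: ord_pt => [|j].
  by rewrite rowBE !pt_l subr0 lerDl sumr_ge0.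
rewrite rowBE !pt_r (bigD1 j) //= addrCA lerDl.
by rewrite addr_ge0 // sumr_ge0.
Qed.

Lemma bigOh_lt N (f : K -> K) d : bigOh N.+1 f -> 0 < d ->
  exists2 r, 0 < r & forall x, 0 < x -> x <= r -> `|f x| < d.
Proof.
move=> /(bigOhW (ltn0Sn N)) [M [x0 [M0 x00 H]]] d0.
have p : 0 < d / (M + 1) by rewrite divr_gt0 // ltr_wpDl.
have [r r0 [r1 r2]] := pos_lower_bound x00 p.
exists r => // x x_0 xr; apply: le_lt_trans (H _ x_0 (le_trans xr r1)) _.
rewrite expr1; apply: lt_le_trans (_ : (M + 1) * x <= _).
  by rewrite ltr_pM2r // ltrDl.
by rewrite mulrC -ler_pdivlMr ?ltr_wpDl // (le_trans xr).
Qed.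

Lemma near_pt D (F : K -> 'rV[K]_m) : nbhs (pt 0 (y 0%N)) D ->
  (forall j, bigOh 1 (fun x => F x 0 j - y 0%N 0 j)) ->
  exists2 r, 0 < r & forall x, 0 < x -> x <= r -> D (pt x (F x)).
Proof.
rewrite nbhs_ballP => -[d /= d0 dD] /bigOh_pt HF.
have [r r0 Hr] := bigOh_lt HF d0; exists r => // x x0 xr.
by apply: dD; rewrite -ball_normE /= distrC; have := Hr x x0 xr; rewrite normr_id.
Qed.

Lemma Yf_asymp0 j : bigOh 1 (fun x => Yf x 0 j - y 0%N 0 j).
Proof.
by apply: eq_bigOh (Yf_asymp j 1) => x; rewrite big_ord1 expr0 mul1r.
Qed.

Lemma ptr_asymp0 N p j : (0 < N)%N -> bigOh 1 (fun x => ptr N p x 0 j - y 0%N 0 j).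
Proof.
case: N => // N _.
apply: (@eq_bigOh _ _ (fun x => \sum_(k < N) x ^+ (lift ord0 k) * y (lift ord0 k) 0 j
   + x ^+ N.+1 * p j)) => [x|].
  by rewrite mxE big_ord_recl expr0 mul1r addrAC [_ + _ - _]addrAC subrr add0r.
apply: bigOhD; last by apply: (@bigOhW _ N.+1) => //; exact: bigOh_exp.
by apply: bigOh_sum => k; apply: (@bigOhW _ (lift ord0 k)) => //; exact: bigOh_exp.
Qed.

(** The truncation is compared with the solution, where [H] is known. They differ by
    [x ^ N (p - y N)] up to higher order, which acts through [A0]; the quadratic terms have order
    [2 N], at least [N + 1] as [N] is positive. *)
Lemma Heval_asymp N p i : (0 < N)%N ->
  bigOh N.+1 (fun x => Heval i (pt x (ptr N p x)) -
    (\sum_(k < N) x ^+ k * y k 0 i +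
     x ^+ N * (y N 0 i + \sum_j A0 i j * (p j - y N 0 j)))).
Proof.
move=> N0; have [D [nD _ _ _ c2]] := in_domain_nbhs dom0.
have [r1 r10 D1] := near_pt nD Yf_asymp0.
have [r2 r20 D2] := near_pt nD (fun j => ptr_asymp0 p j N0).
have [r3 r30 fixY] := Yf_fix.
have Dn := nbhs_singleton nD.
pose P x := pt x (ptr N p x); pose Q x := pt x (Yf x).
pose d j x := ptr N p x 0 j - Yf x 0 j.
have dO j : bigOh N.+1 (fun x => d j x - x ^+ N * (p j - y N 0 j)).
  apply: eq_bigOh (bigOhN (Yf_asymp j N.+1)) => x.
  by rewrite /d mxE big_ord_recr /=; ring.
have dON j : bigOh N (d j).
  apply: eq_bigOh (bigOhD (bigOhW (leqnSn N) (dO j)) (bigOh_exp N (p j - y N 0 j))) => x.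
  by rewrite subrK.
have PQl x : (P x - Q x) 0 (lshift m 0) = 0.
  by rewrite rowBE !pt_l subrr.
have PQr x j : (P x - Q x) 0 (rshift 1 j) = d j x.
  by rewrite rowBE !pt_r.
have PQ : bigOh N (fun x => `|P x - Q x|).
  apply: bigOh_norm_le (bigOh_sum (index_enum 'I_m) (fun j => bigOh_normr (dON j))) _.
  exists 1 => // x _ _; rewrite normr_id ger0_norm ?sumr_ge0 //.
  apply: norm_row_le; first by rewrite sumr_ge0.
  apply: ord_pt => [|j]; first by rewrite PQl normr0 sumr_ge0.
  by rewrite PQr (bigD1 j) //= lerDl sumr_ge0.
(* Four errors of order [N + 1]: the Taylor remainder at the solution, the tail of the solution, the
   change of the derivative from the solution to the origin, and the replacement of [d] by its
   leading term. *)
have T1 : bigOh N.+1 (fun x => Heval i (P x) - Heval i (Q x) - \sum_j d j x * dHeval i j (Q x)).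
  have [M M0 HM] := c2on_quadratic (c2 i zexp).
  have PQ2 : bigOh N.+1 (fun x => M * (`|P x - Q x| * `|P x - Q x|)).
    apply: (@bigOhW _ (0 + (N + N))); first by rewrite add0n -addn1 leq_add2l.
    by apply: bigOhM; [exact: bigOh_cst|exact: bigOhM].
  apply: bigOh_norm_le PQ2 _; have [r r0 [ra rb]] := pos_lower_bound r10 r20.
  exists r => // x x0 xr.
  have := HM _ _ (D1 x x0 (le_trans xr ra)) (D2 x x0 (le_trans xr rb)).
  rewrite big_split_ord big_ord1 /= -/(P x) -/(Q x) PQl mul0r add0r -expr2.
  under eq_bigr do rewrite PQr.
  move=> /le_trans; apply.
  by rewrite [leRHS]ger0_norm // mulr_ge0 // exprn_ge0.
have T2 : bigOh N.+1 (fun x => Heval i (Q x) - \sum_(k < N.+1) x ^+ k * y k 0 i).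
  apply: near_bigOh r30 _ (Yf_asymp i N.+1) => x x0 xr.
  by rewrite (fixY x x0 xr).
have T3 : bigOh N.+1 (fun x => \sum_j d j x * (dHeval i j (Q x) - A0 i j)).
  apply: bigOh_sum => j; rewrite -addn1; apply: bigOhM => //.
  have [M M0 HM] := c2on_lipschitz (c2 i (succ_at (rshift 1 j) zexp)).
  apply: bigOh_norm_le (bigOhM (bigOh_cst M) (bigOh_pt Yf_asymp0)) _.
  exists r1 => // x x0 xr; rewrite [leRHS]ger0_norm ?mulr_ge0 //.
  by apply: HM => //; exact: D1.
have T4 : bigOh N.+1 (fun x => \sum_j (d j x - x ^+ N * (p j - y N 0 j)) * A0 i j).
  apply: bigOh_sum => j; rewrite -[N.+1]addn0; apply: bigOhM => //; exact: bigOh_cst.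
apply: eq_bigOh (bigOhD (bigOhD T1 T2) (bigOhD T3 T4)) => x.
under [X in _ + (X + _)]eq_bigr do rewrite mulrBr.
under [X in _ + (_ + X)]eq_bigr do rewrite mulrBl.
rewrite !sumrB big_ord_recr /= -/(P x) mulrDr mulr_sumr.
have -> : \sum_j x ^+ N * (A0 i j * (p j - y N 0 j)) =
  \sum_j x ^+ N * (p j - y N 0 j) * A0 i j by apply: eq_bigr => j _; ring.
ring.
Qed.

End Solution.
End System.

(** * Coefficient comparison along truncated series *)

Section TruncatedSolutions.
Context {K : numClosedFieldType} (Kc : monotone_complete K) {m : nat}.
Variable h : 'I_m -> {ffun 'I_(1 + m) -> nat} -> K.
Hypothesis h0 : forall i a, 0 <= h i a.
Variables (y : nat -> 'rV[K]_m) (Yf : K -> 'rV[K]_m).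

(** The coordinates of [pt x (ptr y N p x)] as polynomials in [x]. *)
Definition tpoly N (p : 'I_m -> K) (v : 'I_(1 + m)) : {poly K} :=
  match fintype.split v with
  | inl _ => 'X
  | inr j => \poly_(k < N.+1) (if (k < N)%N then y k 0 j else p j)
  end.

Lemma tpoly_l N p : tpoly N p (lshift m 0) = 'X.
Proof. by rewrite /tpoly (unsplitK (inl 0 : 'I_1 + 'I_m)). Qed.

Lemma tpoly_r N p j : tpoly N p (rshift 1 j) =
  \poly_(k < N.+1) (if (k < N)%N then y k 0 j else p j).
Proof. by rewrite /tpoly (unsplitK (inr j : 'I_1 + 'I_m)). Qed.

Lemma tpoly_horner N p x v : (tpoly N p v).[x] = pt x (ptr y N p x) 0 v.
Proof.
move: v; apply: ord_pt => [|j]; first by rewrite tpoly_l hornerX pt_l.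
rewrite tpoly_r pt_r horner_poly mxE big_ord_recr /= ltnn; congr (_ + _).
  by apply: eq_bigr => k _; rewrite ltn_ord mulrC.
exact: mulrC.
Qed.

(** The box truncation of [H] along the polynomial curve. Its coefficients increase with [B], which
    makes the coefficients of the composite accessible as monotone limits. *)
Definition Hpoly N p B i : {poly K} :=
  bsum B (fun a => h i a *: \prod_v tpoly N p v ^+ a v).

Lemma Hpoly_horner N p B i x :
  (Hpoly N p B i).[x] = bsum B (fun a => h i a * dmon zexp a (pt x (ptr y N p x))).
Proof.
rewrite horner_sum; apply: eq_bigr => b _; rewrite hornerZ horner_prod; congr (_ * _).
apply: eq_bigr => v _.
by rewrite horner_exp tpoly_horner /ffmon ffactn0 mul1r subn0.
Qed.

Lemma polyleX : polyle ('X : {poly K}) 'X.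
Proof. by move=> k; rewrite coefX ler0n. Qed.

Lemma tpoly_le N p N' p' : (forall k j, (k < N.+1)%N ->
    0 <= (if (k < N)%N then y k 0 j else p j) /\
    (if (k < N)%N then y k 0 j else p j) <=
    (if (k < N'.+1)%N then if (k < N')%N then y k 0 j else p' j else 0)) ->
  (forall k j, (k < N'.+1)%N -> 0 <= (if (k < N')%N then y k 0 j else p' j)) ->
  forall v, polyle (tpoly N p v) (tpoly N' p' v).
Proof.
move=> H H'; apply: ord_pt => [|j]; first by rewrite !tpoly_l; exact: polyleX.
rewrite !tpoly_r => k; rewrite !coef_poly; case: (ltnP k N.+1) => kN; first exact: H.
by case: ltnP => kN'; split=> //; apply: H'.
Qed.

Lemma Hpoly_le N p N' p' B i : (forall v, polyle (tpoly N p v) (tpoly N' p' v)) ->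
  polyle (Hpoly N p B i) (Hpoly N' p' B i).
Proof.
move=> H; apply: polyle_sum => b; apply: polyleZ => //.
by apply: polyle_prod => v; apply: polyle_exp.
Qed.

Lemma Hpoly_nondecreasing N p B i : (forall v, polyle (tpoly N p v) (tpoly N p v)) ->
  polyle (Hpoly N p B i) (Hpoly N p B.+1 i).
Proof.
move=> H k; have [P0 _] := @Hpoly_le N p N p B i H k; split=> //.
rewrite /Hpoly bsumS coefD lerDl coef_sum sumr_ge0 // => b _.
have /(_ k) [//] : polyle (h i [ffun v => b v : nat] *: \prod_v tpoly N p v ^+ [ffun v => b v : nat] v)
   (h i [ffun v => b v : nat] *: \prod_v tpoly N p v ^+ [ffun v => b v : nat] v).
apply: polyleZ => //; apply: polyle_prod => v; exact: polyle_exp.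
Qed.

Lemma ptr_ge0 N p x : (forall k j, (k < N)%N -> 0 <= y k 0 j) -> (forall j, 0 <= p j) ->
  0 <= x -> forall j, 0 <= ptr y N p x 0 j.
Proof.
move=> y0 p0 x0 j; rewrite mxE addr_ge0 ?mulr_ge0 ?exprn_ge0 // sumr_ge0 // => k _.
by rewrite mulr_ge0 ?exprn_ge0 ?y0.
Qed.

Lemma ptr_le N p x x' : (forall k j, (k < N)%N -> 0 <= y k 0 j) -> (forall j, 0 <= p j) ->
  0 <= x -> x <= x' -> forall j, ptr y N p x 0 j <= ptr y N p x' 0 j.
Proof.
move=> y0 p0 x0 xx j; have x0' := le_trans x0 xx; rewrite !mxE lerD //.
  by apply: ler_sum => k _; rewrite ler_wpM2r ?y0 // lerXn2r ?nnegrE.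
by rewrite ler_wpM2r // lerXn2r ?nnegrE.
Qed.

Hypothesis Yf_asymp : forall j N, bigOh N (fun x => Yf x 0 j - \sum_(k < N) x ^+ k * y k 0 j).
Hypothesis Yf_fix : exists2 r, 0 < r & forall x, 0 < x -> x <= r ->
  forall i, Yf x 0 i = Heval h i (pt x (Yf x)).
Hypothesis dom0 : in_domain h (pt 0 (y 0%N)).

Let A0 i j : K := dHeval h i j (pt 0 (y 0%N)).

(** The coefficient of [x ^ N] in [H] along the truncation with candidate [p], according to
    [Heval_asymp]; [y N] is a fixed point. *)
Definition next_coef N (p : 'I_m -> K) i : K := y N 0 i + \sum_j A0 i j * (p j - y N 0 j).

(** Monotone limits of polynomials give [H] along the truncation an expansion with nonnegative
    coefficients [g], bounded by its value at [x1], while [Heval_asymp] computes the coefficients up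
    to degree [N]. Uniqueness identifies the two. *)
Lemma truncation_step N p x1 i : (0 < N)%N ->
  (forall k j, (k < N)%N -> 0 <= y k 0 j) -> (forall j, 0 <= p j) ->
  0 < x1 -> absconv h (pt x1 (ptr y N p x1)) ->
  [/\ 0 <= next_coef N p i,
      \sum_(k < N) x1 ^+ k * y k 0 i + x1 ^+ N * next_coef N p i <=
        Heval h i (pt x1 (ptr y N p x1)) &
      forall B k, (k < N)%N -> (Hpoly N p B i)`_k <= y k 0 i].
Proof.
move=> N0 y0 p0 x10 ax; have x10' := ltW x10.
have tp v : polyle (tpoly N p v) (tpoly N p v).
  apply: tpoly_le => k j kN; last by case: ltnP => // kN'; exact: y0.
  by rewrite kN; case: ltnP => kN'; split=> //; exact: y0.
pose f x := Heval h i (pt x (ptr y N p x)).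
have fcvg x : 0 <= x -> x <= x1 -> (fun B => (Hpoly N p B i).[x]) @ \oo --> f x.
  move=> x0 xx1; under eq_fun do rewrite Hpoly_horner.
  apply: cvg_bsum => //.
  apply: (absconv_le h0 _ _ ax); first by apply: pt_ge0 => //; exact: ptr_ge0.
  by apply: pt_le => //; exact: ptr_le.
have [g [g0 gH gsum gO]] := nonneg_poly_limit Kc x10 (fun B => Hpoly_nondecreasing B i tp) fcvg.
pose t k := if (k < N)%N then y k 0 i else next_coef N p i.
have tE x : \sum_(k < N.+1) x ^+ k * t k =
    \sum_(k < N) x ^+ k * y k 0 i + x ^+ N * next_coef N p i.
  rewrite big_ord_recr /= /t ltnn; congr (_ + _).
  by apply: eq_bigr => k _; rewrite ltn_ord.
have gt k : (k < N.+1)%N -> g k = t k.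
  move=> kN; apply/eqP; rewrite -subr_eq0; apply/eqP.
  apply: (@bigOh_poly_unique _ N.+1 (fun k => g k - t k)) => //.
  have O1 : bigOh N.+1 (fun x => f x - \sum_(k < N.+1) x ^+ k * g k).
    exists (f x1 / x1 ^+ N.+1), x1; split=> //.
      rewrite divr_ge0 ?exprn_ge0 // /f Heval_ge0 //.
      by apply: pt_ge0 => //; exact: ptr_ge0.
    move=> x x0 xx1; rewrite mulrAC -mulrA -expr_div_n; apply: gO => //; exact: ltW.
  have O2 := Heval_asymp Kc Yf_asymp Yf_fix dom0 p i N0.
  apply: eq_bigOh (bigOhB O2 O1) => x; rewrite -/A0 -/(next_coef N p i) -/(f x) -tE.
  under [RHS]eq_bigr do rewrite mulrBr.
  by rewrite sumrB; ring.
have tN : t N = next_coef N p i by rewrite /t ltnn.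
split; first by rewrite -tN -gt.
  rewrite -tE; apply: le_trans (gsum N.+1).
  by apply: ler_sum => k _; rewrite gt.
by move=> B k kN; have := gH B k; rewrite (gt k (ltnW kN)) /t kN.
Qed.

Hypothesis y0_ge0 : forall i, 0 <= y 0%N 0 i.
Hypothesis y0_le : forall x Z, 0 < x -> supersol h x Z -> forall i, y 0%N 0 i <= Z 0 i.
Hypothesis nil0 : exists k, (\matrix_(i, j) A0 i j) ^+ k = 0.

(* Nilpotency of [A0] makes [next_coef N], started at [0], reach [y N] in finitely
   many steps, and each step stays below [Z]. *)
Lemma truncation_le x Z : 0 < x -> supersol h x Z -> forall N,
  (forall k i, (k < N)%N -> 0 <= y k 0 i) /\
  (forall i, \sum_(k < N) x ^+ k * y k 0 i <= Z 0 i).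
Proof.
move=> x0 sZ; have [Z0 aZ HZ] := sZ; have x0' := ltW x0.
(* Orders 0 and 1 are treated apart: [truncation_step] needs a positive order, and the constant term
   is controlled by [y0_le]. *)
elim=> [|[_|N [IH1 IH2]]]; first by split=> // i; rewrite big_ord0.
  split=> [k i|i]; first by rewrite ltnS leqn0 => /eqP ->.
  by rewrite big_ord1 expr0 mul1r; exact: y0_le x0 sZ i.
set M := N.+1 in IH1 IH2 *.
pose ps j : 'I_m -> K := iter j (next_coef M) (fun=> 0).
have step j : (forall i, 0 <= ps j i) /\
   forall i, \sum_(k < M) x ^+ k * y k 0 i + x ^+ M * ps j i <= Z 0 i.
  elim: j => [|j [p0 pZ]].
    by split=> // i; rewrite mulr0 addr0; exact: IH2.
  have pl : forall v, pt x (ptr y M (ps j) x) 0 v <= pt x Z 0 v.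
    by apply: pt_le => // i; rewrite mxE; exact: pZ.
  have pg : forall v, 0 <= pt x (ptr y M (ps j) x) 0 v.
    by apply: pt_ge0 => //; exact: ptr_ge0.
  have ap := absconv_le h0 pg pl aZ.
  split=> i; have [n0 nle _] := truncation_step i (ltn0Sn N) IH1 p0 x0 ap.
    exact: n0.
  apply: le_trans nle _; apply: le_trans (HZ i).
  exact: Heval_le.
have [e Ae] := nil0; set A := \matrix_(i, j) A0 i j in Ae.
have pse j i : ps j i - y M 0 i = (A ^+ j *m (\col_l (- y M 0 l))) i 0.
  elim: j i => [|j IH] i; first by rewrite expr0 mul1mx mxE sub0r.
  rewrite exprS -mulmxE -mulmxA mxE /ps /= -/(ps j) /next_coef addrAC subrr add0r.
  by apply: eq_bigr => l _; rewrite IH !mxE.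
have pe i : ps e i = y M 0 i.
  by apply/eqP; rewrite -subr_eq0 pse Ae mul0mx mxE.
have [s1 s2] := step e; split=> [k i|i].
  by rewrite ltnS leq_eqVlt => /predU1P[->|/IH1//]; rewrite -pe.
by rewrite big_ord_recr /= -pe.
Qed.

Lemma cvg_expr_seq (u : nat -> K) (l : K) n : u @ \oo --> l -> (fun k => u k ^+ n) @ \oo --> l ^+ n.
Proof.
move=> ul; elim: n => [|n IH].
  by under eq_fun do rewrite expr0; rewrite expr0; exact: cvg_cst.
by under eq_fun do rewrite exprS; rewrite exprS; exact: cvgM.
Qed.

Lemma cvgr_prod (I : Type) (r : seq I) (u : I -> nat -> K) (l : I -> K) :
  (forall i, u i @ \oo --> l i) ->
  (fun N => \prod_(i <- r) u i N) @ \oo --> \prod_(i <- r) l i.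
Proof.
move=> ul; elim: r => [|i r IH].
  by under eq_fun do rewrite big_nil; rewrite big_nil; exact: cvg_cst.
by under eq_fun do rewrite big_cons; rewrite big_cons; exact: cvgM.
Qed.

Hypothesis y_ge0 : forall k i, 0 <= y k 0 i.

(** One inequality holds because each partial sum is below [H] at that partial sum, hence below [H]
    at [V]. For the other, a box sum of [H] along a truncation is a polynomial with coefficients
    below those of [y], hence below [V]; the truncation is then let grow. *)
Lemma limit_fixpoint x (V : 'rV[K]_m) : 0 < x ->
  (forall i, (fun N => \sum_(k < N) x ^+ k * y k 0 i) @ \oo --> V 0 i) ->
  absconv h (pt x V) -> forall i, Heval h i (pt x V) = V 0 i.
Proof.
move=> x0 yV aV i; have x0' := ltW x0.
have part N j : \sum_(k < N) x ^+ k * y k 0 j <= V 0 j.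
  apply: nondecreasing_cvg_ler (yV j) N => N.
  by rewrite big_ord_recr /= lerDl mulr_ge0 ?exprn_ge0.
have ptrV N j : ptr y N (fun=> 0) x 0 j <= V 0 j by rewrite mxE mulr0 addr0.
have pg N : forall v, 0 <= pt x (ptr y N (fun=> 0) x) 0 v.
  by apply: pt_ge0 => //; exact: ptr_ge0.
have aN N : absconv h (pt x (ptr y N (fun=> 0) x)).
  by apply: (absconv_le h0 (pg N) _ aV); exact: pt_le.
apply/eqP; rewrite eq_le; apply/andP; split; last first.
  apply: (ler_cvg (yV i) (@cvg_cst _ (Heval h i (pt x V)) nat \oo _)).
  exists 2%N => // -[|[|N]] //= _; set M := N.+1.
  have e : ptr y M (y M 0) x = ptr y M.+1 (fun=> 0) x.
    by apply/rowP => j; rewrite !mxE mulr0 addr0 [RHS]big_ord_recr.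
  (* With the true coefficient [y M] as candidate, [next_coef] returns it, and the truncation is the
     partial sum with one more term. *)
  have := @truncation_step M (y M 0) x i (ltn0Sn N) (fun k j _ => y_ge0 k j) (y_ge0 M) x0.
  rewrite e => /(_ (aN _)) [_ + _]; have -> : next_coef M (y M 0) i = y M 0 i.
    by rewrite /next_coef big1 ?addr0 // => j _; rewrite subrr mulr0.
  rewrite [X in _ -> X <= _]big_ord_recr /= => /le_trans; apply.
  by apply: Heval_le => //; exact: pt_le.
apply: btot_le => // B.
have cB : (fun N => bsum B (fun a => h i a * dmon zexp a (pt x (ptr y N (fun=> 0) x)))) @ \oo
    --> bsum B (fun a => h i a * dmon zexp a (pt x V)).
  apply: cvgr_sum => b; apply: cvgMr; apply: cvgr_prod => v.
  apply: cvgMr; apply: cvg_expr_seq; move: v; apply: ord_pt => [|j].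
    by under eq_fun do rewrite pt_l; rewrite pt_l; exact: cvg_cst.
  rewrite pt_r; apply: cvg_trans (yV j); apply: near_eq_cvg; apply: nearW => N /=.
  by rewrite pt_r mxE mulr0 addr0.
apply: (ler_cvg_cst cB) => N; rewrite -Hpoly_horner horner_coef.
apply: le_trans (part (size (Hpoly N (fun=> 0) B i)) i).
apply: ler_sum => k _; rewrite mulrC ler_wpM2l ?exprn_ge0 //.
(* The coefficient of degree [k] is only known to be below [y k] for truncation orders above [k].
   Raising the order to [N'] achieves this and only increases coefficients. *)
pose N' := (maxn N k).+1.
have [_ _ /(_ B k) cf] := @truncation_step N' (fun=> 0) x i (ltn0Sn _)
   (fun k j _ => y_ge0 k j) (fun=> lexx 0) x0 (aN N').
apply: le_trans (cf _); last by rewrite ltnS leq_maxr.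
have [] // := @Hpoly_le N (fun=> 0) N' (fun=> 0) B i _ k.
apply: tpoly_le => l j; last by move=> _; case: ifP.
move=> lN; split; first by case: ifP.
have lN' : (l < N')%N by rewrite ltnS leq_max -ltnS lN.
by rewrite (leqW lN') lN'; case: ifP.
Qed.

End TruncatedSolutions.

(** * The solution series and the characteristic system *)

Section PowerSeriesLimits.
Context {K : numClosedFieldType} (Kc : monotone_complete K).

Lemma power_series_cvg (c : nat -> K) (r M z : K) : 0 < r ->
  (forall k, `|c k| * r ^+ k <= M) -> `|z| < r ->
  let S N := \sum_(k < N) z ^+ k * c k in
  S @ \oo --> limn S /\
  forall N, `|limn S - S N| <= M * (`|z| / r) ^+ N / (1 - `|z| / r).
Proof.
move=> r0 cM zr S; set q := `|z| / r.
have q0 : 0 <= q by rewrite divr_ge0 // ltW.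
have q1 : q < 1 by rewrite ltr_pdivrMr // mul1r.
have q1' : 0 < 1 - q by rewrite subr_gt0.
have qn : 1 - q != 0 by rewrite gt_eqF.
have M0 : 0 <= M by apply: le_trans (cM 0%N); rewrite mulr_ge0 // exprn_ge0 // ltW.
(* Minus the geometric tail: nondecreasing, bounded above by 0, with increments that dominate those
   of [S]. *)
pose v N := - (M * q ^+ N / (1 - q)).
have w0 N : 0 <= M * q ^+ N / (1 - q).
  by rewrite divr_ge0 ?(ltW q1') // mulr_ge0 // exprn_ge0.
have Sv N : `|S N.+1 - S N| <= v N.+1 - v N.
  rewrite /S big_ord_recr /= addrAC subrr add0r normrM normrX.
  have -> : v N.+1 - v N = q ^+ N * M by rewrite /v exprS; field.
  have -> : `|z| ^+ N = q ^+ N * r ^+ N by rewrite -exprMn divfK // gt_eqF.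
  by rewrite -mulrA ler_wpM2l ?exprn_ge0 // mulrC.
have Sc : S @ \oo --> limn S.
  apply: (@dominated_cvgn K Kc S v 0) => // N; first by rewrite oppr_le0.
  by rewrite rpredN ger0_real.
split=> // N.
have tail P : `|S (P + N)%N - S N| <= v (P + N)%N - v N.
  elim: P => [|P IH]; first by rewrite add0n !subrr normr0.
  rewrite addSn -[S _](subrK (S (P + N)%N)) -addrA.
  rewrite -[v (P + N).+1](subrK (v (P + N)%N)) -[leRHS]addrA.
  by apply: le_trans (ler_normD _ _) _; apply: lerD.
have Sc' : (fun P => S (P + N)%N) @ \oo --> limn S by rewrite cvg_shiftn.
apply: (ler_cvg_cst (cvg_norm (cvgB Sc' (cvg_cst (S N))))) => P.
rewrite !fctE; apply: le_trans (tail P) _.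
by rewrite [v N]/v opprK gerDr /v oppr_le0.
Qed.

Lemma cvg_row n (T : Type) (F : set_system T) {FF : Filter F} (u : T -> 'rV[K]_n)
    (l : 'rV[K]_n) :
  (forall j, u t 0 j @[t --> F] --> l 0 j) -> u @ F --> l.
Proof.
move=> ul; apply/cvgrPdist_le => e e0.
have : \forall t \near F, forall j, `|l 0 j - u t 0 j| <= e.
  by apply: filter_forall => j; have /cvgrPdist_le := ul j; apply.
apply: filterS => t H; apply: norm_row_le; first exact: ltW.
by move=> j; rewrite !mxE.
Qed.

Lemma cvg_coord n (T : Type) (F : set_system T) {FF : Filter F} (u : T -> 'rV[K]_n)
    (l : 'rV[K]_n) j : u @ F --> l -> u t 0 j @[t --> F] --> l 0 j.
Proof.
move=> /cvgrPdist_lt ul; apply/cvgrPdist_lt => e e0; apply: filterS (ul _ e0) => t.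
by apply: le_lt_trans; rewrite -rowBE; exact: ler_coord_norm.
Qed.

Lemma series_coord m (y : nat -> 'rV[K]_m) (z : K) N j :
  series (fun k => z ^+ k *: y k) N 0 j = \sum_(k < N) z ^+ k * y k 0 j.
Proof. by rewrite /series /= big_mkord summxE; apply: eq_bigr => k _; rewrite mxE. Qed.

Definition vgf m (y : nat -> 'rV[K]_m) (z : K) : 'rV[K]_m :=
  limn (series (fun k => z ^+ k *: y k)).

Lemma vgf_cvg m (y : nat -> 'rV[K]_m) (r M z : K) : 0 < r ->
  (forall k j, `|y k 0 j| * r ^+ k <= M) -> `|z| < r ->
  [/\ series (fun k => z ^+ k *: y k) @ \oo --> vgf y z,
   forall j, (fun N => \sum_(k < N) z ^+ k * y k 0 j) @ \oo --> vgf y z 0 j &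
   forall j N, `|vgf y z 0 j - \sum_(k < N) z ^+ k * y k 0 j| <=
      M * (`|z| / r) ^+ N / (1 - `|z| / r)].
Proof.
move=> r0 yM zr.
pose l : 'rV[K]_m := \row_j limn (fun N => \sum_(k < N) z ^+ k * y k 0 j).
have H j := power_series_cvg r0 (fun k => yM k j) zr.
have sl : series (fun k => z ^+ k *: y k) @ \oo --> l.
  apply: cvg_row => j; have [+ _] := H j; rewrite mxE; apply: cvg_trans.
  by apply: near_eq_cvg; apply: nearW => N; rewrite series_coord.
have gl : vgf y z = l by apply: (@norm_cvg_lim K _ _ _ _ sl).
split; first by rewrite gl.
  by move=> j; rewrite gl mxE; case: (H j).
by move=> j N; rewrite gl mxE; case: (H j).
Qed.

Lemma vgf_asymp m (y : nat -> 'rV[K]_m) (r M : K) : 0 < r ->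
  (forall k j, `|y k 0 j| * r ^+ k <= M) ->
  forall j N, bigOh N (fun x => vgf y x 0 j - \sum_(k < N) x ^+ k * y k 0 j).
Proof.
move=> r0 yM j N; have M0 : 0 <= M.
  by apply: le_trans (yM 0%N j); rewrite mulr_ge0 // exprn_ge0 // ltW.
exists (M / r ^+ N * 2%:R), (r / 2%:R).
have r20 := halfr_gt0 r0; have rn : r != 0 by rewrite gt_eqF.
split=> // [|x x0 xr]; first by rewrite mulr_ge0 // divr_ge0 // exprn_ge0 // ltW.
have xr1 : `|x| < r.
  by rewrite gtr0_norm //; apply: le_lt_trans xr _; rewrite -[ltRHS](halfrD r) ltrDl.
have [_ _ /(_ j N) /le_trans] := vgf_cvg r0 yM xr1; apply.
have q2 : `|x| / r <= 2%:R^-1 by rewrite gtr0_norm // ler_pdivrMr // mulrC.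
rewrite gtr0_norm // in q2 *.
have h2 : 2%:R^-1 <= 1 - x / r.
  have -> : 2%:R^-1 = 1 - 2%:R^-1 :> K by field.
  by rewrite lerD2l lerN2.
have -> : M * (x / r) ^+ N / (1 - x / r) = x ^+ N * (M / r ^+ N * (1 - x / r)^-1).
  by rewrite expr_div_n; ring.
have -> : M / r ^+ N * 2%:R * x ^+ N = x ^+ N * (M / r ^+ N * 2%:R) by ring.
rewrite ler_wpM2l ?exprn_ge0 ?(ltW x0) // ler_wpM2l //.
  by rewrite divr_ge0 // exprn_ge0 // ltW.
by rewrite -[leRHS]invrK lef_pV2 ?posrE ?invr_gt0 // (lt_le_trans _ h2) // invr_gt0.
Qed.

Lemma convergent_series_bounded m (y : nat -> 'rV[K]_m) (z : K) :
  cvgn (series (fun k => z ^+ k *: y k)) ->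
  exists2 M, 0 <= M & forall k j, `|y k 0 j| * `|z| ^+ k <= M.
Proof.
move=> /cvgrPdist_lt/(_ 1 ltr01)[N0 _ HN].
pose S := \sum_(k < N0) `|z ^+ k *: y k|.
have S0 : 0 <= S by apply: sumr_ge0.
(* A late term is the difference of two partial sums within 1 of the limit, hence at most 2; [S]
   covers the finitely many early ones. *)
exists (2%:R + S); first by rewrite addr_ge0.
move=> k j; apply: le_trans (_ : `|z ^+ k *: y k| <= _).
  by have := ler_coord_norm (z ^+ k *: y k) j; rewrite mxE normrM normrX mulrC.
have [kN|Nk] := ltnP k N0.
  by rewrite ler_wpDl // /S (bigD1 (Ordinal kN)) //= lerDl sumr_ge0.
rewrite ler_wpDr //.
have a1 := HN k Nk; have a2 := HN k.+1 (leqW Nk).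
set u := series _ in a1 a2; set L := limn _ in a1 a2.
have -> : z ^+ k *: y k = (L - u k) - (L - u k.+1).
  have -> : L - u k - (L - u k.+1) = u k.+1 - u k by rewrite opprB addrC addrA subrK.
  by rewrite /u /series /= big_nat_recr //= addrAC subrr add0r.
apply: le_trans (ler_normB _ _) _; rewrite -[2%:R]/(1 + 1); apply: lerD; exact: ltW.
Qed.

End PowerSeriesLimits.

Section CharacteristicSystem.
Context {K : numClosedFieldType} (Kc : monotone_complete K) {m : nat}.
Variable h : 'I_m -> {ffun 'I_(1 + m) -> nat} -> K.

Definition zYperm (x : 'rV[K]_(m + 1)) : 'rV[K]_(1 + m) :=
  pt (x 0 (rshift m 0)) (lsubmx x).

(** The position in the order [(z, Y)] of the unknown with index [k] in the order [(Y, z)]. *)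
Definition var_index (k : 'I_(m + 1)) : 'I_(1 + m) :=
  match fintype.split k with inl j => rshift 1 j | inr _ => lshift m 0 end.

Lemma var_index_l j : var_index (lshift 1 j) = rshift 1 j.
Proof. by rewrite /var_index (unsplitK (inl j : 'I_m + 'I_1)). Qed.

Lemma var_index_r : var_index (rshift m 0) = lshift m 0.
Proof. by rewrite /var_index (unsplitK (inr 0 : 'I_m + 'I_1)). Qed.

Lemma zYperm_l x : zYperm x 0 (lshift m 0) = x 0 (rshift m 0).
Proof. exact: pt_l. Qed.

Lemma zYperm_r x j : zYperm x 0 (rshift 1 j) = x 0 (lshift 1 j).
Proof. by rewrite pt_r mxE. Qed.

Lemma zYperm_norm x x' : `|zYperm x' - zYperm x| <= `|x' - x|.
Proof.
apply: norm_row_le => //; apply: ord_pt => [|j].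
  rewrite rowBE !zYperm_l -rowBE; exact: ler_coord_norm.
rewrite rowBE !zYperm_r -rowBE; exact: ler_coord_norm.
Qed.

Lemma c2on_zYperm (D : set 'rV[K]_(1 + m)) f g : c2on D f g ->
  c2on [set x | D (zYperm x)] (f \o zYperm) (fun k x => g (var_index k) (zYperm x)).
Proof.
move=> [L [B [L0 H]]]; exists L, B; split=> // x x' Dx Dx'.
have := H _ _ Dx Dx'.
rewrite [X in taylor2 _ _ _ _ X](_ : _ =
  \sum_k (x' - x) 0 k * g (var_index k) (zYperm x)); last first.
  rewrite !big_split_ord !big_ord1 /= addrC var_index_r; congr (_ + _).
    apply: eq_bigr => j _; rewrite var_index_l rowBE !zYperm_r -rowBE //.
  by rewrite rowBE !zYperm_l -rowBE.
apply: taylor2W => //; first by rewrite mulr_ge0.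
by rewrite ler_wpM2l // zYperm_norm.
Qed.

Definition dHmx p : 'M[K]_m := \matrix_(i, j) dHeval h i j p.

(* Transposed, as [jacobian] acts on row vectors. *)
Definition char_jac (x : 'rV[K]_(m + 1)) : 'M[K]_(m + 1) := \matrix_(k, l)
  match fintype.split l with
  | inl j => (k == lshift 1 j)%:R - psder (succ_at (var_index k) zexp) (h j) (zYperm x)
  | inr _ => \sum_i \sum_j
      - psder (succ_at (var_index k) (succ_at (rshift 1 j) zexp)) (h i) (zYperm x) *
      cofactor (1%:M - dHmx (zYperm x)) i j
  end.

Lemma char_jac_l x k j : char_jac x k (lshift 1 j) =
  (k == lshift 1 j)%:R - psder (succ_at (var_index k) zexp) (h j) (zYperm x).
Proof. by rewrite mxE (unsplitK (inl j : 'I_m + 'I_1)). Qed.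

Lemma char_jac_r x k : char_jac x k (rshift m 0) = \sum_i \sum_j
  - psder (succ_at (var_index k) (succ_at (rshift 1 j) zexp)) (h i) (zYperm x) *
      cofactor (1%:M - dHmx (zYperm x)) i j.
Proof. by rewrite mxE (unsplitK (inr 0 : 'I_m + 'I_1)). Qed.

Variable D : set 'rV[K]_(1 + m).
Hypothesis Dbd : forall v, exists M, forall x, D x -> `|x 0 v| <= M.
Hypothesis c2 : forall i al, c2on D (psder al (h i)) (fun j => psder (succ_at j al) (h i)).

Let E : set 'rV[K]_(m + 1) := [set x | D (zYperm x)].

Lemma c2onB n (D' : set 'rV[K]_n) f f' g g' : c2on D' f g -> c2on D' f' g' ->
  c2on D' (fun x => f x - f' x) (fun k x => g k x - g' k x).
Proof.
move=> cf cf'.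
pose F (b : bool) := if b then f else fun x => -1 * f' x.
pose G (b : bool) := if b then g else fun k x => 0 * f' x + -1 * g' k x.
apply: (@c2on_ext _ _ D' (fun x => \sum_(b : bool) F b x) _
  (fun k x => \sum_(b : bool) G b k x)) => [x|k x|].
- by rewrite big_bool /= mulN1r.
- by rewrite big_bool /= mul0r add0r mulN1r.
- by apply: c2on_sum; case=> //=; apply: c2onM => //; exact: c2on_cst.
Qed.

Lemma c2on_coordE k : c2on E (fun x => x 0 k) (fun k' _ => (k' == k)%:R).
Proof.
case: (split_ordP k) => j ->.
  have [M HM] := Dbd (rshift 1 j); apply: (@c2on_coord _ _ _ M) => x Ex.
  by have := HM _ Ex; rewrite zYperm_r.
have [M HM] := Dbd (lshift m 0); apply: (@c2on_coord _ _ _ M) => x Ex.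
by have := HM _ Ex; rewrite zYperm_l (ord1 j).
Qed.

Lemma c2on_psder i al : c2on E (fun x => psder al (h i) (zYperm x))
  (fun k x => psder (succ_at (var_index k) al) (h i) (zYperm x)).
Proof. exact: (c2on_zYperm (c2 i al)). Qed.

Lemma c2on_charmx i j : c2on E (fun x => (1%:M - dHmx (zYperm x)) i j)
  (fun k x => - psder (succ_at (var_index k) (succ_at (rshift 1 j) zexp)) (h i) (zYperm x)).
Proof.
apply: c2on_ext (c2onB (c2on_cst E (1%:M i j)) (c2on_psder i (succ_at (rshift 1 j) zexp))).
  by move=> x; rewrite !mxE.
by move=> k x; rewrite sub0r.
Qed.

Lemma c2on_char (F : 'rV[K]_(m + 1) -> 'rV[K]_(m + 1)) :
  (forall x j, E x -> F x 0 (lshift 1 j) = x 0 (lshift 1 j) - Heval h j (zYperm x)) ->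
  (forall x, E x -> F x 0 (rshift m 0) = \det (1%:M - dHmx (zYperm x))) ->
  forall l, c2on E (fun x => F x 0 l) (fun k x => char_jac x k l).
Proof.
move=> F1 F2 l; case: (split_ordP l) => j ->.
  apply: c2on_ext_in (c2onB (c2on_coordE (lshift 1 j)) (c2on_psder j zexp)).
    by move=> x Ex; rewrite F1.
  by move=> k x _; rewrite char_jac_l.
rewrite (ord1 j); apply: c2on_ext_in (c2on_det c2on_charmx).
  by move=> x Ex; rewrite F2.
by move=> k x _; rewrite char_jac_r.
Qed.

(** The derivative is left unspecified: Newton's iteration only needs the Jacobian to be
    Lipschitz. *)
Lemma c2on_char_jac k l : exists g, c2on E (fun x => char_jac x k l) g.
Proof.
case: (split_ordP l) => j ->.
  eexists; apply: c2on_ext (c2onB (c2on_cst E (k == lshift 1 j)%:R) (c2on_psder j _)).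
    by move=> x; rewrite char_jac_l.
  by move=> k' x.
rewrite (ord1 j).
have cof i i' : exists g, c2on E (fun x => cofactor (1%:M - dHmx (zYperm x)) i i') g.
  eexists; rewrite /cofactor; apply: c2onM; first exact: c2on_cst.
  apply: c2on_det => a b; apply: c2on_ext (c2on_charmx (lift i a) (lift i' b)) => // x.
  by rewrite !mxE.
have /choice[G HG] : forall ij : 'I_m * 'I_m, exists g,
    c2on E (fun x => cofactor (1%:M - dHmx (zYperm x)) ij.1 ij.2) g by move=> ij; exact: cof.
eexists; apply: (@c2on_ext _ _ E (fun x => \sum_i \sum_j (-1 *
  psder (succ_at (var_index k) (succ_at (rshift 1 j) zexp)) (h i) (zYperm x)) *
      cofactor (1%:M - dHmx (zYperm x)) i j)).
- by move=> x; rewrite char_jac_r; do 2!apply: eq_bigr => ? _; rewrite mulN1r.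
- by move=> k' x.
- apply: c2on_sum => i; apply: c2on_sum => i'; apply: c2onM (HG (i, i')).
  by apply: c2onM; [exact: c2on_cst|exact: c2on_psder].
Qed.

End CharacteristicSystem.

(** The vectors lie in the compact unit cube and have coordinate sum 1, which prevents a cluster
    point from vanishing. *)
Lemma subinvariant_limit (R : realType) (m : nat) (A : 'M[R]_m) :
  (forall i j, 0 <= A i j) ->
  (forall e, 0 < e -> exists v : 'I_m -> R, [/\ forall i, 0 <= v i, \sum_i v i = 1 &
     forall i, \sum_j A i j * v j <= v i + e]) ->
  exists w : 'I_m -> R, [/\ forall i, 0 <= w i, exists i, w i != 0 &
     forall i, \sum_j A i j * w j <= w i].
Proof.
move=> A0 H.
have /choice[v Hv] : forall n : nat, exists v : 'I_m -> R, [/\ forall i, 0 <= v i,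
    \sum_i v i = 1 & forall i, \sum_j A i j * v j <= v i + n.+1%:R^-1].
  by move=> n; apply: H; rewrite invr_gt0.
pose u n : 'rV[R]_m := \row_i v n i.
have v1 n i : v n i <= 1.
  by have [v0 <- _] := Hv n; rewrite (bigD1 i) //= lerDl sumr_ge0.
have cK := @rV_compact R m (fun=> `[0, 1]%classic) (fun=> @segment_compact R 0 1).
have [|w [wK wcl]] := cK (u @ \oo) _.
  by exists 0%N => // n _ i /=; rewrite in_itv /= mxE v1 andbT; case: (Hv n).
have w0 i : 0 <= w 0 i by have := wK i; rewrite /= in_itv /= => /andP[].
have near_w e : 0 < e -> exists2 n, n.+1%:R^-1 < e & forall i, `|w 0 i - v n i| < e.
  move=> e0; have [N _ HN] := @near_infty_natSinv_lt R (PosNum e0).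
  have F1 : (u @ \oo) [set u n | n in [set n | (N <= n)%N]].
    by exists N => // n Nn; exists n.
  have [_ [[n /= Nn <-] wn]] := wcl _ _ F1 (nbhsx_ballx w e e0).
  exists n; first exact: HN.
  move=> i; move: wn; rewrite -ball_normE /=; apply: le_lt_trans.
  by have := ler_coord_norm (w - u n) i; rewrite !mxE.
exists (fun i => w 0 i); split=> // [|i].
  apply/existsP; rewrite -negb_forall; apply/negP => /forallP w_0.
  (* Were [w] zero, some [v n] would have all its [m] coordinates below [1 / (m + 1)], too small for
     a sum of 1. *)
  have e0 : 0 < (m.+1%:R)^-1 :> R by rewrite invr_gt0.
  have [n _ Hn] := near_w _ e0; have [v0 v_1 _] := Hv n.
  have : \sum_i v n i <= \sum_(i < m) (m.+1%:R)^-1.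
    apply: ler_sum => i _; have := Hn i; rewrite (eqP (w_0 i)) sub0r normrN ger0_norm //.
    exact: ltW.
  rewrite v_1 sumr_const card_ord -[_^-1 *+ m]mulr_natl ler_pdivlMr // mul1r ler_nat ltnn //.
apply/ler_addgt0Pr => e e0.
set s := \sum_j A i j; have s0 : 0 <= s by apply: sumr_ge0.
(* The error is [s d] for replacing [w] by [v n] under [A], [d] for returning from [v n] to [w], and
   at most [d] for the term [1 / (n + 1)]. *)
have d0 : 0 < e / (2 + s) by rewrite divr_gt0 // ltr_pwDl.
have [n ne Hn] := near_w _ d0; have [v0 _ /(_ i) vA] := Hv n.
set d := e / (2 + s) in d0 ne Hn.
have h1 : \sum_j A i j * w 0 j <= \sum_j A i j * v n j + s * d.
  rewrite /s mulr_suml -big_split /=; apply: ler_sum => j _; rewrite -mulrDr.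
  rewrite ler_wpM2l //; have := Hn j; rewrite ltr_norml => /andP[_]; lra.
have h2 : v n i <= w 0 i + d by have := Hn i; rewrite ltr_norml => /andP[]; lra.
have h3 : (2 + s) * d = e by rewrite /d mulrC divfK // gt_eqF // ltr_pwDl.
rewrite -h3 mulrDl addrA; apply: le_trans h1 _; rewrite lerD2r.
apply: le_trans vA _; apply: le_trans (lerD h2 (ltW ne)) _.
by rewrite -addrA mulr_natl mulr2n.
Qed.

(** * Systems independent of [z] or affine in [Y] *)

Section DegenerateSystems.
Context {K : numClosedFieldType} (Kc : monotone_complete K) {m : nat}.
Variable h : 'I_m -> {ffun 'I_(1 + m) -> nat} -> K.

Lemma dmon_pt al (a : {ffun 'I_(1 + m) -> nat}) (z : K) (Y : 'rV[K]_m) :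
  dmon al a (pt z Y) = ffmon (a (lshift m 0)) (al (lshift m 0)) z *
    \prod_j ffmon (a (rshift 1 j)) (al (rshift 1 j)) (Y 0 j).
Proof.
rewrite /dmon big_split_ord big_ord1 /= pt_l; congr (_ * _).
by apply: eq_bigr => j _; rewrite pt_r.
Qed.

Lemma z_independent (z z' : K) (Y : 'rV[K]_m) :
  (forall i (a : {ffun 'I_(1 + m) -> nat}), (0 < a (lshift m 0%R))%N -> h i a = 0) ->
  absconv h (pt z Y) -> absconv h (pt z' Y) /\ forall i, Heval h i (pt z' Y) = Heval h i (pt z Y).
Proof.
move=> hz az.
have e i : (fun a => h i a * dmon zexp a (pt z' Y)) = (fun a => h i a * dmon zexp a (pt z Y)).
  apply/funext => a; have [a0|a0] := posnP (a (lshift m 0)); last by rewrite hz // !mul0r.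
  by rewrite !dmon_pt a0 /ffmon !subn0 !expr0.
by split=> i; rewrite /Heval /psder e //; exact: az.
Qed.

Lemma succ_at_l (j : 'I_m) al : succ_at (rshift 1 j) al (lshift m 0) = al (lshift m 0).
Proof. by rewrite /succ_at eq_lrshift addn0. Qed.

Lemma succ_at_r (j : 'I_m) al k :
  succ_at (rshift 1 j) al (rshift 1 k) = (al (rshift 1 k) + (k == j))%N.
Proof. by rewrite /succ_at eq_rshift. Qed.

(** The hypothesis says that the monomial has total degree at most 1 in [Y]. If the degree is 0,
    only the first term survives; if it is 1, only the derivative in the one variable present
    does. *)
Lemma affine_monomial (a : {ffun 'I_(1 + m) -> nat}) (z : K) (Y : 'rV[K]_m) :
  (forall j k, ~ forall v, (succ_at (rshift 1 k) (succ_at (rshift 1 j) zexp) v <= a v)%N) ->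
  dmon zexp a (pt z 0) + \sum_j Y 0 j * dmon (succ_at (rshift 1 j) zexp) a (pt z Y) =
  dmon zexp a (pt z Y).
Proof.
move=> Ha.
have [/existsP[j0 aj0]|/existsPn a0] := boolP [exists j, (0 < a (rshift 1 j))%N].
  have a1 : a (rshift 1 j0) = 1%N.
    apply/eqP; rewrite eqn_leq aj0 andbT leqNgt; apply/negP => a2.
    apply: (Ha j0 j0); apply: ord_pt => [|k]; first by rewrite !succ_at_l.
    rewrite !succ_at_r /zexp; case: eqVneq => [->|_] //=.
  have ak k : k != j0 -> a (rshift 1 k) = 0%N.
    move=> kj; apply/eqP; rewrite -leqn0 leqNgt; apply/negP => ak.
    apply: (Ha j0 k); apply: ord_pt => [|l]; first by rewrite !succ_at_l.
    rewrite !succ_at_r /zexp; have [->|lj] := eqVneq l j0.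
      by rewrite eq_sym (negPf kj) a1.
    by case: eqVneq => [->|].
  have p0 : dmon zexp a (pt z 0) = 0.
    by rewrite dmon_pt (bigD1 j0) //= a1 mxE /ffmon subn0 expr1 mulr0 mul0r mulr0.
  rewrite p0 add0r (bigD1 j0) //= big1 ?addr0; last first.
    move=> k kj; rewrite dmon_pt (bigD1 k) //= succ_at_r eqxx ak // /ffmon.
    by rewrite ffact0n !(mul0r, mulr0).
  rewrite !dmon_pt succ_at_l mulrCA; congr (_ * _).
  rewrite (bigD1 j0) //= [RHS](bigD1 j0) //= succ_at_r eqxx a1 mulrA; congr (_ * _).
    by rewrite /ffmon subnn subn0 expr0 expr1 ffactn0 ffactnn !mul1r mulr1.
  by apply: eq_bigr => k kj; rewrite succ_at_r (negPf kj).
have ak k : a (rshift 1 k) = 0%N by apply/eqP; rewrite -leqn0 leqNgt; exact: a0.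
rewrite big1 ?addr0; last first.
  move=> j _; rewrite dmon_pt (bigD1 j) //= succ_at_r eqxx ak /ffmon.
  by rewrite ffact0n !(mul0r, mulr0).
rewrite !dmon_pt; congr (_ * _); apply: eq_bigr => k _.
by rewrite ak /ffmon subn0 !expr0.
Qed.

Hypothesis h0 : forall i a, 0 <= h i a.

Lemma affine_fixpoint (z : K) (Y : 'rV[K]_m) : 0 <= z -> (forall j, 0 <= Y 0 j) ->
  in_domain h (pt z Y) ->
  (forall i (a : {ffun 'I_(1 + m) -> nat}) j k,
     (forall v, (succ_at (rshift 1 k) (succ_at (rshift 1 j) zexp) v <= a v)%N) ->
     h i a = 0) ->
  forall i, Heval h i (pt z 0) + \sum_j Y 0 j * dHeval h i j (pt z Y) = Heval h i (pt z Y).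
Proof.
move=> z0 Y0 dY hd i.
have a0 : absconv h (pt z 0).
  apply: (absconv_le h0 _ _ (in_domain_absconv Kc dY)).
    by apply: pt_ge0 => // j; rewrite mxE.
  by apply: pt_le => // j; rewrite mxE.
have cl : (fun N => bsum N (fun a => h i a * dmon zexp a (pt z 0)) + \sum_j Y 0 j *
    bsum N (fun a => h i a * dmon (succ_at (rshift 1 j) zexp) a (pt z Y))) @ \oo -->
    Heval h i (pt z 0) + \sum_j Y 0 j * dHeval h i j (pt z Y).
  apply: cvgD; first exact: cvg_bsum.
  apply: cvgr_sum => j; apply: cvgMr; apply: cvg_bsum => //; exact: in_domain_bbounded.
apply: (@norm_cvg_unique K K _ _ _ _ cl).
have := cvg_bsum Kc (in_domain_absconv Kc dY i); apply: cvg_trans; apply: near_eq_cvg.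
apply: nearW => N; under eq_bigr do rewrite -bsumZ.
rewrite /bsum exchange_big -big_split /=; apply: eq_bigr => b _.
set a := [ffun _ => _]; have [->|ha] := eqVneq (h i a) 0.
  by rewrite !mul0r add0r big1 // => j _; rewrite mul0r mulr0.
under eq_bigr do rewrite mulrCA.
rewrite -mulr_sumr -mulrDr; congr (_ * _); symmetry; apply: affine_monomial => j k le_a.
by case/eqP: ha; exact: hd le_a.
Qed.

End DegenerateSystems.

(** * Absolute convergence and the domain of convergence *)

Section BoxEnumeration.
Context {n : nat}.
Local Notation expo := {ffun 'I_n -> nat}.

Definition box_enum (N : nat) : seq expo :=
  map (fun b : {ffun 'I_n -> 'I_N} => [ffun i => b i : nat] : expo)
    (enum {ffun 'I_n -> 'I_N}).

Lemma box_enum_uniq N : uniq (box_enum N).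
Proof.
rewrite map_inj_uniq ?enum_uniq // => b b' /ffunP e; apply/ffunP => i.
by have := e i; rewrite !ffunE => /val_inj.
Qed.

Lemma mem_box_enum N (a : expo) : (forall i, (a i < N)%N) -> a \in box_enum N.
Proof.
move=> aN; apply/mapP; exists [ffun i => Ordinal (aN i)]; first by rewrite mem_enum.
by apply/ffunP => i; rewrite !ffunE.
Qed.

Lemma bsum_box_enum (V : nmodType) N (F : expo -> V) : bsum N F = \sum_(a <- box_enum N) F a.
Proof. by rewrite big_map big_enum. Qed.

End BoxEnumeration.

Section Bridge.
Context {R : realType}.
Local Notation C := (Cplx R).

Lemma monomialE n (a : {ffun 'I_n -> nat}) (x : 'rV[C]_n) : monomial a x = dmon zexp a x.
Proof. by apply: eq_bigr => i _; rewrite /ffmon ffactn0 mul1r subn0. Qed.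

Lemma psumE n (c : {ffun 'I_n -> nat} -> C) x : psum c x = psder zexp c x.
Proof.
have e : (fun N => \sum_(b : {ffun 'I_n -> 'I_N}) c [ffun i => b i : nat] *
    monomial [ffun i => b i : nat] x) = (fun N => bsum N (fun a => c a * dmon zexp a x)).
  by apply/funext => N; apply: eq_bigr => b _; rewrite monomialE.
by rewrite /psum e.
Qed.

(** Every finite set of exponents lies in a box and every box is finite, so finite sums and box sums
    have the same bounds. *)
Lemma abs_convergentP n (c : {ffun 'I_n -> nat} -> C) x :
  abs_convergent c x <-> bbounded (fun a => c a * dmon zexp a x).
Proof.
pose f a := modulus (c a * dmon zexp a x).
have f0 a : 0 <= f a by exact: modulus_ge0.
have bE N : bsum N (fun a => `|c a * dmon zexp a x|) = ofR (\sum_(a <- box_enum N) f a).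
  by rewrite bsum_box_enum rmorph_sum; apply: eq_bigr => a _; rewrite /f -ofR_modulus.
have aE : abs_convergent c x = (\esum_(a in setT) (f a)%:E < +oo)%E.
  rewrite /abs_convergent /summable; congr (_ < _)%E; apply: eq_esum => a _.
  by rewrite monomialE gee0_abs // lee_fin modulus_ge0.
have sumE N : (\sum_(a \in [set` box_enum N]) (f a)%:E)%E = (\sum_(a <- box_enum N) f a)%:E.
  by rewrite -fsbig_seq ?box_enum_uniq // sumEFin.
rewrite aE; split=> [fin|[M HM]].
  have e0 : (0 <= \esum_(a in setT) (f a)%:E)%E by apply: esum_ge0 => a _; rewrite lee_fin.
  exists (ofR (fine (\esum_(a in setT) (f a)%:E)%E)) => N.
  rewrite bE ler_ofR -lee_fin fineK; last by rewrite ge0_fin_numE.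
  apply: esum_ge; exists [set` box_enum N]; last by rewrite sumE.
  by split=> //; exact: finite_seq.
have M0 : 0 <= M by apply: le_trans (HM 0%N); rewrite bsum_ge0.
have [s s0 Ms] := ge0_ofRP M0.
apply: le_lt_trans (ltry s); apply: ge_ereal_sup => _ [X [finX _] <-].
have /finite_seqP[t Xt] := finX.
pose mx (a : {ffun 'I_n -> nat}) := \max_i a i.
pose N := (\big[maxn/0%N]_(a <- t) mx a).+1.
apply: le_trans (_ : \sum_(a \in [set` box_enum N]) (f a)%:E <= _)%E.
  apply: lee_fsum_nneg_subset => //; first exact: finite_seq.
    move=> a; rewrite inE => Xa; rewrite inE; apply: mem_box_enum => i; rewrite ltnS.
    apply: leq_trans (leq_bigmax i) _.
    have at_ : a \in t by move: Xa; rewrite Xt.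
    by rewrite -/(mx a) (big_rem a at_) /= leq_maxl.
  by move=> a _; rewrite lee_fin.
by rewrite sumE lee_fin -ler_ofR -bE -Ms.
Qed.

Context {m : nat}.
Variable h : psystem R m.

Lemma HfunE p : Hfun h p = \row_i Heval h i p.
Proof. by apply/rowP => i; rewrite [RHS]mxE /Hfun mxE psumE. Qed.

(** From absolute convergence on a ball around [p] to a larger polydisc: pushing each coordinate of
    [p] radially outwards by [e / 2] stays in the ball, and absolute convergence depends on the
    moduli alone. *)
Lemma cvg_domainP (p : 'rV[C]_(1 + m)) : cvg_domain h p <-> in_domain h p.
Proof.
split=> [|dp].
  move=> /nbhs_ballP[e /= e0 He].
  (* The phase of [z], set to 1 at 0 so that vanishing coordinates are pushed outwards too. *)
  pose u (z : C) := if z == 0 then 1 else z / `|z|.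
  have u1 z : `|u z| = 1.
    rewrite /u; case: eqVneq => [_|z0]; first by rewrite normr1.
    by rewrite normrM normfV normr_id divff // normr_eq0.
  have zu z : z = `|z| * u z.
    rewrite /u; case: eqVneq => [->|z0]; first by rewrite normr0 mul0r.
    by rewrite mulrCA divff ?mulr1 // normr_eq0.
  have d0 := halfr_gt0 e0; set d := e / 2%:R in d0.
  pose q : 'rV[C]_(1 + m) := \row_v ((`|p 0 v| + d) * u (p 0 v)).
  have qp : ball p e q.
    rewrite -ball_normE /=; apply: le_lt_trans (_ : d < _); last first.
      by rewrite -[ltRHS](halfrD e) ltrDl.
    apply: norm_row_le; first exact: ltW.
    move=> v; rewrite rowBE mxE {1}[p 0 v]zu -mulrBl normrM u1 mulr1.
    by rewrite opprD addrA subrr sub0r normrN gtr0_norm.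
  exists d => // i; have /abs_convergentP := He _ qp i.
  apply: (@bbounded_le _ _ _ _ 1) => // a; rewrite mul1r !normrM ler_wpM2l //.
  rewrite /spow /dmon !normr_prod le_eqVlt; apply/orP; left; apply/eqP.
  apply: eq_bigr => v _; rewrite /ffmon ffactn0 mul1r subn0 !normrX mxE normrM u1.
  by rewrite mulr1.
have [D [nD _ _ Db _]] := in_domain_nbhs (@Cplx_complete R) dp.
apply: filterS nD => x Dx i; apply/abs_convergentP; exact: Db.
Qed.

Lemma dHdYE p : in_domain h p -> dHdY h p = dHmx h p.
Proof.
move=> dp; have [D [nD _ _ _ c2]] := in_domain_nbhs (@Cplx_complete R) dp.
pose J x : 'M[C]_(1 + m, m) := \matrix_(k, i) psder (succ_at k zexp) (h i) x.
have jE : jacobian (Hfun h) p = J p.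
  apply: (@jacobian_c2on _ _ _ D _ J) => // i.
  apply: c2on_ext (c2 i zexp) => [x|k x]; last by rewrite mxE.
  by rewrite HfunE mxE.
by apply/matrixP => i j; rewrite /dHdY jE !mxE.
Qed.

End Bridge.

(** * The singular point *)

Section SolutionAtSingularity.
Context {R : realType} {m : nat}.
Local Notation C := (Cplx R).
Let Kc := @Cplx_complete R.
Variables (h : psystem R m) (y : nat -> 'rV[C]_m) (rho : R) (tau : 'rV[C]_m).
Hypothesis wf : well_founded_system h.
Hypothesis sol : gf_solution h y.
Hypothesis rad : cvg_radius y = rho%:E.

Lemma coef_ge0 i a : 0 <= h i a.
Proof. by case: wf. Qed.

Lemma rho_gt0 : 0 < rho.
Proof. by case: sol => + _ _; rewrite rad lte_fin. Qed.

Lemma coef_bound (x : R) : x < rho -> exists2 r, x < r & exists2 M : C, 0 <= M &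
  forall k j, `|y k 0 j| * ofR r ^+ k <= M.
Proof.
rewrite -lte_fin -rad => /ereal_sup_gt[_ [z zc <-]]; rewrite lte_fin => xz.
exists (modulus z) => //; rewrite ofR_modulus.
exact: convergent_series_bounded zc.
Qed.

Lemma coef_unbounded (r : R) (M : C) : rho < r ->
  ~ (forall k j, `|y k 0 j| * ofR r ^+ k <= M).
Proof.
move=> rr yM; pose x := (rho + r) / 2.
have r0 : 0 < r := lt_trans rho_gt0 rr.
have x0 : 0 <= x by have := rho_gt0; rewrite /x; lra.
have xr : `|ofR x| < ofR r by rewrite normr_ofR ltr_ofR ger0_norm // /x; lra.
have r0' : 0 < ofR r by rewrite ofR_gt0.
have [sc _ _] := vgf_cvg Kc r0' yM xr.
have : ((modulus (ofR x))%:E <= cvg_radius y)%E.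
  by apply: ereal_sup_ubound; exists (ofR x) => //=; apply/cvg_ex; exists (vgf y (ofR x)).
by rewrite rad lee_fin modulus_ofR // /x; lra.
Qed.

Lemma gfE z : gf y z = vgf y z.
Proof. by []. Qed.

Lemma zYE z (Y : 'rV[C]_m) : zY z Y = pt z Y.
Proof. by []. Qed.

Lemma y0E : y 0%N = Uiter h m.
Proof.
have [r r0 [M M0 yM]] := coef_bound rho_gt0.
have r0' : 0 < ofR r by rewrite ofR_gt0.
have z0 : `|0 : C| < ofR r by rewrite normr0.
have [_ _ H] := vgf_cvg Kc r0' yM z0.
case: sol => _ <- _; apply/rowP => j; apply/eqP; rewrite gfE eq_sym -subr_eq0 -normr_le0.
by have := H j 1%N; rewrite big_ord1 expr0 mul1r normr0 mul0r expr1 mulr0 mul0r.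
Qed.

Lemma solution_asymp j N : bigOh N (fun x => gf y x 0 j - \sum_(k < N) x ^+ k * y k 0 j).
Proof.
have [r r0 [M M0 yM]] := coef_bound rho_gt0.
have r0' : 0 < ofR r by rewrite ofR_gt0.
exact: (vgf_asymp Kc r0' yM).
Qed.

Lemma solution_fix : exists2 r : C, 0 < r & forall x, 0 < x -> x <= r ->
  forall i, gf y x 0 i = Heval h i (pt x (gf y x)).
Proof.
case: sol => _ _ /nbhs_ballP[r /= r0 Hr]; exists (r / 2%:R); first exact: halfr_gt0.
move=> x x0 xr i; have [|_ {1}->] := Hr x; last by rewrite HfunE mxE.
rewrite -ball_normE /= sub0r normrN gtr0_norm //; apply: le_lt_trans xr _.
by rewrite -[ltRHS](halfrD r) ltrDl halfr_gt0.
Qed.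

Lemma dom_0 : in_domain h (pt 0 (y 0%N)).
Proof. by rewrite y0E; apply/cvg_domainP; case: wf => _ /(_ m (leqnn m)). Qed.

Lemma fix_0 i : Heval h i (pt 0 (y 0%N)) = y 0%N 0 i.
Proof.
have [_ g0 /nbhs_singleton[_]] := sol; rewrite g0 -y0E => e.
by rewrite [in RHS]e HfunE mxE.
Qed.

Lemma Uiter_ge0 k : (k <= m)%N -> forall j, 0 <= Uiter h k 0 j.
Proof.
elim: k => [|k IH] km j; first by rewrite mxE.
rewrite /Uiter /= -/(Uiter h k) HfunE mxE; apply: Heval_ge0 => //; first exact: coef_ge0.
  by apply: pt_ge0 => //; apply: IH; exact: ltnW.
by apply: in_domain_absconv => //; apply/cvg_domainP; case: wf => _ /(_ k (ltnW km)).
Qed.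

Lemma Uiter_le (x : C) Z : 0 < x -> supersol h x Z -> forall k, (k <= m)%N ->
  forall j, Uiter h k 0 j <= Z 0 j.
Proof.
move=> x0 [Z0 aZ HZ]; elim=> [|k IH] km j; first by rewrite mxE.
rewrite /Uiter /= -/(Uiter h k) HfunE mxE; apply: le_trans (HZ j).
apply: Heval_le => //; first exact: coef_ge0.
  by apply: pt_ge0 => //; apply: Uiter_ge0; exact: ltnW.
by apply: pt_le; [exact: ltW|apply: IH; exact: ltnW].
Qed.

Lemma nilpotent_0 : exists k, dHmx h (pt 0 (y 0%N)) ^+ k = 0.
Proof. by case: wf => _ _ [k]; rewrite -y0E dHdYE; [exists k|exact: dom_0]. Qed.

Lemma y_0_ge0 i : 0 <= y 0%N 0 i.
Proof. by rewrite y0E Uiter_ge0. Qed.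

Lemma y_0_le (x : C) Z : 0 < x -> supersol h x Z -> forall i, y 0%N 0 i <= Z 0 i.
Proof. by move=> x0 sZ i; rewrite y0E (Uiter_le x0 sZ). Qed.

Lemma partial_sum_le (x : C) Z : 0 < x -> supersol h x Z -> forall N,
  (forall k i, (k < N)%N -> 0 <= y k 0 i) /\
  (forall i, \sum_(k < N) x ^+ k * y k 0 i <= Z 0 i).
Proof.
exact: (truncation_le Kc coef_ge0 solution_asymp solution_fix dom_0 y_0_ge0 y_0_le
  nilpotent_0).
Qed.

(** The comparison of coefficients presupposes a supersolution. By nilpotency the Neumann series of
    [1 - A] at [z = 0] is a finite sum, so [W] solves [1 + A W = W] and the constant term can be
    perturbed. *)
Lemma supersol_near_0 : exists (x : C) Z, 0 < x /\ supersol h x Z.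
Proof.
have [e Ae] := nilpotent_0; set A := dHmx h _ in Ae.
pose W : 'cV[C]_m := \sum_(l < e) A ^+ l *m const_mx 1.
have A_ge0 i j : 0 <= A i j.
  rewrite mxE; apply: psder_ge0 => //; [exact: coef_ge0| |].
    by apply: pt_ge0 => //; exact: y_0_ge0.
  by apply: in_domain_bbounded => //; exact: dom_0.
have Al_ge0 l i : 0 <= (A ^+ l *m const_mx 1 : 'cV[C]_m) i 0.
  elim: l i => [|l IH] i; first by rewrite expr0 mul1mx mxE.
  by rewrite exprS -mulmxE -mulmxA mxE sumr_ge0 // => j _; rewrite mulr_ge0.
have subW (V : 'cV[C]_m) i : (V - const_mx 1) i 0 = V i 0 - 1 by rewrite !mxE.
have W_ge0 i : 0 <= W i 0 by rewrite summxE sumr_ge0.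
have WE i : 1 + \sum_j A i j * W j 0 = W i 0.
  have -> : \sum_j A i j * W j 0 = (A *m W) i 0 by rewrite mxE.
  have -> : (A *m W) = W - const_mx 1.
    rewrite /W mulmx_sumr.
    under eq_bigr => l _ do rewrite mulmxA mulmxE -exprS.
    have := big_ord_recr e (fun l => A ^+ l *m const_mx 1 : 'cV[C]_m) (op := +%R) (idx := 0).
    rewrite /= Ae mul0mx addr0 => <-.
    by rewrite big_ord_recl expr0 mul1mx addrAC subrr add0r.
  by rewrite subW addrC subrK.
have WA i : 1 + \sum_j dHeval h i j (pt 0 (y 0%N)) * W j 0 <= W i 0.
  by rewrite -[leRHS]WE lerD2l; apply: ler_sum => j _; rewrite /A mxE.
have [x [Z [x0 sZ]]] :=
  exists_supersol Kc coef_ge0 (lexx 0) y_0_ge0 dom_0 fix_0 W_ge0 WA.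
by exists x, Z.
Qed.

Lemma y_ge0 k i : 0 <= y k 0 i.
Proof.
have [x [Z [x0 sZ]]] := supersol_near_0.
by have [H _] := partial_sum_le x0 sZ k.+1; exact: H.
Qed.

Lemma partial_sum_term (x : C) k i : 0 <= x ->
  x ^+ k * y k 0 i <= \sum_(l < k.+1) x ^+ l * y l 0 i.
Proof.
move=> x0; rewrite big_ord_recr /= lerDr sumr_ge0 // => l _.
by rewrite mulr_ge0 ?exprn_ge0 // y_ge0.
Qed.

Lemma no_supersol (r : R) Z : rho < r -> ~ supersol h (ofR r) Z.
Proof.
move=> rr sZ; have r0 : 0 < ofR r by rewrite ofR_gt0 (lt_trans rho_gt0).
have [Z0 _ _] := sZ.
apply: (@coef_unbounded r (\sum_j Z 0 j)) => // k j.
rewrite ger0_norm ?y_ge0 // mulrC; apply: le_trans (partial_sum_term k j (ltW r0)) _.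
have [_ /(_ j) /le_trans] := partial_sum_le r0 sZ k.+1; apply.
by rewrite (bigD1 j) //= lerDl sumr_ge0.
Qed.

(** A constant series has bounded terms at every radius, for instance at [rho + 1]. *)
Lemma y_nonconst : exists k i, (0 < k)%N /\ y k 0 i != 0.
Proof.
apply: contrapT => H.
have rr : rho < rho + 1 by lra.
apply: (@coef_unbounded (rho + 1) (\sum_j `|y 0%N 0 j|)) => // k j.
have [->|k0] := posnP k; first by rewrite expr0 mulr1 (bigD1 j) //= lerDl sumr_ge0.
have [->|yn] := eqVneq (y k 0 j) 0; first by rewrite normr0 mul0r sumr_ge0.
by case: H; exists k, j.
Qed.

Let Y (x : R) : 'rV[C]_m := gf y (ofR x).

Lemma Y_cvg x : 0 < x -> x < rho -> forall j,
  (fun N => \sum_(k < N) ofR x ^+ k * y k 0 j) @ \oo --> Y x 0 j.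
Proof.
move=> x0 xr; have [r xr1 [M M0 yM]] := coef_bound xr.
have r0 : 0 < ofR r by rewrite ofR_gt0 (lt_trans x0).
have x1 : `|ofR x| < ofR r by rewrite normr_ofR gtr0_norm // ltr_ofR.
by have [_ H _] := vgf_cvg Kc r0 yM x1.
Qed.

Lemma partial_le_Y x N j : 0 < x -> x < rho ->
  \sum_(k < N) ofR x ^+ k * y k 0 j <= Y x 0 j.
Proof.
move=> x0 xr; apply: nondecreasing_cvg_ler (Y_cvg x0 xr (j := j)) N => N.
by rewrite big_ord_recr /= lerDl mulr_ge0 ?y_ge0 // exprn_ge0 // ofR_ge0 ltW.
Qed.

Lemma Y_ge0 x j : 0 < x -> x < rho -> 0 <= Y x 0 j.
Proof. by move=> x0 xr; have := @partial_le_Y x 0 j x0 xr; rewrite big_ord0. Qed.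

(** Beyond monotonicity, which is the case [k = 0], the gain due to one coefficient is kept; a
    nonzero coefficient of positive degree then makes [Y x] differ from [tau]. *)
Lemma Y_le x x' k j : 0 < x -> x <= x' -> x' < rho ->
  Y x 0 j + (ofR x' ^+ k - ofR x ^+ k) * y k 0 j <= Y x' 0 j.
Proof.
move=> x0 xx xr; have x0' : 0 < x' := lt_le_trans x0 xx.
have c : (fun N => \sum_(l < N) ofR x ^+ l * y l 0 j + (ofR x' ^+ k - ofR x ^+ k) * y k 0 j)
    @ \oo --> Y x 0 j + (ofR x' ^+ k - ofR x ^+ k) * y k 0 j.
  by apply: cvgD; [exact: Y_cvg x0 (le_lt_trans xx xr) _|exact: cvg_cst].
apply: (ler_cvg c (Y_cvg x0' xr (j := j))); exists k.+1 => // N /= kN.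
rewrite -lerBrDl -sumrB (bigD1 (Ordinal kN)) //= -mulrBl lerDl sumr_ge0 // => l _.
rewrite -mulrBl mulr_ge0 ?y_ge0 // subr_ge0 lerXn2r ?nnegrE ?ofR_ge0 ?ler_ofR //; exact: ltW.
Qed.

Hypothesis Ylim : gf y (ofR x) @[x --> rho^'-] --> tau.
Hypothesis taudom : cvg_domain h (zY (ofR rho) tau).

Let zeta := pt (ofR rho) tau.

Lemma zeta_dom : in_domain h zeta.
Proof. exact/cvg_domainP. Qed.

Lemma Y_le_tau x j : 0 < x -> x < rho -> Y x 0 j <= tau 0 j.
Proof.
move=> x0 xr.
have c1 : (fun=> Y x 0 j) x' @[x' --> rho^'-] --> Y x 0 j by exact: cvg_cst.
have c2 : gf y (ofR x') 0 j @[x' --> rho^'-] --> tau 0 j by exact: cvg_coord.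
apply: (ler_cvg c1 c2).
near=> x'; have xx' : x <= x' by apply: ltW; near: x'; exact: nbhs_left_gt.
have xr' : x' < rho by near: x'; exact: nbhs_left_lt.
by have := @Y_le x x' 0 j x0 xx' xr'; rewrite !expr0 subrr mul0r addr0.
Unshelve. all: by end_near.
Qed.

Lemma Y_lt_tau x : 0 < x -> x < rho -> exists j, Y x 0 j != tau 0 j.
Proof.
move=> x0 xr; have [k [j [k0 yk]]] := y_nonconst; exists j.
pose x' := (x + rho) / 2.
have xx' : x < x' by rewrite /x'; lra.
have xr' : x' < rho by rewrite /x'; lra.
rewrite lt_eqF //; apply: lt_le_trans (Y_le_tau j (lt_trans x0 xx') xr').
apply: lt_le_trans (Y_le k j x0 (ltW xx') xr').
rewrite ltrDl mulr_gt0 ?subr_gt0 //; last by rewrite lt_neqAle eq_sym yk y_ge0.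
by rewrite ltrXn2r ?ofR_ge0 ?ltr_ofR ?(ltW x0) ?(ltW (lt_trans x0 xx')) -?lt0n.
Qed.

Let P (x : R) := pt (ofR x) (Y x).

Lemma P_ge0 x v : 0 < x -> x < rho -> 0 <= P x 0 v.
Proof.
move=> x0 xr; move: v; apply: pt_ge0 => [|j]; first by rewrite ofR_ge0 ltW.
exact: Y_ge0.
Qed.

Lemma P_le_zeta x v : 0 < x -> x < rho -> P x 0 v <= zeta 0 v.
Proof.
move=> x0 xr; move: v; apply: pt_le => [|j]; first by rewrite ler_ofR ltW.
exact: Y_le_tau.
Qed.

Lemma P_dom x : 0 < x -> x < rho -> in_domain h (P x).
Proof.
move=> x0 xr; apply: (@in_domain_le _ _ _ (P x) zeta); last exact: zeta_dom.
  by move=> v; exact: P_ge0.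
by move=> v; exact: P_le_zeta.
Qed.

Lemma P_fix x i : 0 < x -> x < rho -> Heval h i (P x) = Y x 0 i.
Proof.
move=> x0 xr; have x0' : 0 < ofR x by rewrite ofR_gt0.
apply: (limit_fixpoint Kc coef_ge0 solution_asymp solution_fix dom_0 y_ge0 x0').
  exact: Y_cvg.
by apply: in_domain_absconv => //; exact: P_dom.
Qed.

Lemma P_cvg : P x @[x --> rho^'-] --> zeta.
Proof.
apply: cvg_row; apply: ord_pt => [|j].
  rewrite pt_l; under eq_fun do rewrite pt_l.
  by apply: cvg_at_left_filter; exact: continuous_ofR.
by rewrite pt_r; under eq_fun do rewrite pt_r; exact: cvg_coord.
Qed.

Lemma psder_P_cvg al i : psder al (h i) (P x) @[x --> rho^'-] --> psder al (h i) zeta.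
Proof.
have [D [nD _ _ _ c2]] := in_domain_nbhs Kc zeta_dom.
have cf := c2on_continuous (c2 i al) nD.
exact: (@cvg_comp _ _ _ P (psder al (h i)) _ _ _ P_cvg cf).
Qed.

Lemma zeta_fix i : Heval h i zeta = tau 0 i.
Proof.
have c := psder_P_cvg (al := zexp) (i := i).
apply: (@norm_cvg_unique C C _ _ _ _ c).
have c2 : gf y (ofR x') 0 i @[x' --> rho^'-] --> tau 0 i by exact: cvg_coord.
apply: cvg_trans c2; apply: near_eq_cvg.
near=> x; symmetry; apply: P_fix; near: x; last exact: nbhs_left_lt.
exact: (nbhs_left_gt rho_gt0).
Unshelve. all: by end_near.
Qed.

End SolutionAtSingularity.

(** * Invertibility of the Jacobian of the characteristic system *)

Section CharacteristicPoint.
Context {R : realType} {m : nat}.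
Local Notation C := (Cplx R).
Let Kc := @Cplx_complete R.
Variables (h : psystem R m) (y : nat -> 'rV[C]_m) (rho : R) (tau : 'rV[C]_m).
Hypothesis irr : irreducible_system h.
Hypothesis sol : gf_solution h y.
Hypothesis rad : cvg_radius y = rho%:E.
Hypothesis Ylim : gf y (ofR x) @[x --> rho^'-] --> tau.
Hypothesis taudom : cvg_domain h (zY (ofR rho) tau).

Let wf : well_founded_system h.
Proof. by case: irr. Qed.

Let zeta := pt (ofR rho) tau.

Lemma tau_gt0 j : 0 < tau 0 j.
Proof.
case: irr => _ zf _ _; have [k yk] := zf y sol j.
have r0 := rho_gt0 sol rad; have x0 : 0 < rho / 2 by lra.
have xr : rho / 2 < rho by lra.
apply: lt_le_trans (Y_le_tau wf sol rad Ylim j x0 xr).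
apply: lt_le_trans (partial_le_Y wf sol rad k.+1 j x0 xr).
apply: lt_le_trans (partial_sum_term wf sol rad k j _); last by rewrite ofR_ge0 ltW.
by rewrite mulr_gt0 ?exprn_gt0 ?ofR_gt0 // lt_neqAle eq_sym yk (y_ge0 wf sol rad).
Qed.

Lemma zeta_gt0 v : 0 < zeta 0 v.
Proof.
move: v; apply: ord_pt => [|j]; first by rewrite pt_l ofR_gt0 (rho_gt0 sol rad).
by rewrite pt_r tau_gt0.
Qed.

Let zeta_ge0' v : 0 <= zeta 0 v.
Proof. exact/ltW/zeta_gt0. Qed.

Let dz : in_domain h zeta.
Proof. exact: zeta_dom. Qed.

(** The matrix arguments take place in a totally ordered field. The derivatives at [zeta] are
    nonnegative reals, hence lose nothing when read in [R]. *)
Let re_psder al i : R := complex.Re (psder al (h i) zeta).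

Lemma re_psderE al i : psder al (h i) zeta = ofR (re_psder al i).
Proof.
apply: ge0_ofR; apply: psder_ge0 => //; first by move=> a; exact: coef_ge0.
exact: in_domain_bbounded.
Qed.

Lemma re_psder_ge0 al i : 0 <= re_psder al i.
Proof.
rewrite -ofR_ge0 -re_psderE; apply: psder_ge0 => //; first by move=> a; exact: coef_ge0.
exact: in_domain_bbounded.
Qed.

Lemma re_psder_eq0 al i : re_psder al i = 0 ->
  forall a : {ffun 'I_(1 + m) -> nat}, (forall v, (al v <= a v)%N) -> h i a = 0.
Proof.
move=> e; apply: (psder_eq0_coef Kc _ zeta_gt0); first by move=> a; exact: coef_ge0.
  exact: in_domain_bbounded.
by rewrite re_psderE e.
Qed.

Definition Amx : 'M[R]_m := \matrix_(i, j) re_psder (succ_at (rshift 1 j) zexp) i.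

Lemma AmxE i j : dHeval h i j zeta = ofR (Amx i j).
Proof. by rewrite mxE -re_psderE. Qed.

Lemma Amx_ge0 i j : 0 <= Amx i j.
Proof. by rewrite mxE re_psder_ge0. Qed.

Lemma dmon_small al (a : {ffun 'I_(1 + m) -> nat}) (p : 'rV[C]_(1 + m)) v :
  (a v < al v)%N -> dmon al a p = 0.
Proof. by move=> av; rewrite /dmon (bigD1 v) //= /ffmon ffact_small // !mul0r. Qed.

(** If the derivative vanished at [zeta], whose coordinates are positive, all the coefficients
    involved would vanish, and so would the derivative at any other point of the domain. *)
Lemma depends_on_gt0 i j : depends_on h i j -> 0 < Amx i j.
Proof.
move=> [p /cvg_domainP dp pn]; rewrite lt_neqAle Amx_ge0 andbT.
apply: contraNneq pn; rewrite mxE => e; rewrite dHdYE // mxE; apply/eqP.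
apply: (btot0 Kc) => a.
have [av|/existsPn av] := boolP [exists v, (a v < succ_at (rshift 1 j) zexp v)%N].
  by have [v /dmon_small ->] := existsP av; rewrite mulr0.
rewrite (re_psder_eq0 (esym e)) ?mul0r // => v; by rewrite leqNgt av.
Qed.

Lemma Amx_irr i j : connect [rel i j | 0 < Amx i j] i j.
Proof.
case: irr => _ _ _ sc; apply: connect_sub (sc i j) => k l /= /asboolP kl.
by apply: connect1 => /=; exact: depends_on_gt0.
Qed.

Let P (x : R) := pt (ofR x) (gf y (ofR x)).

(* Convexity of [H] makes [tau - Y x] subinvariant for the matrix at [P x]. *)
Lemma approx_subinvariant e : 0 < e -> exists v : 'I_m -> R,
  [/\ forall i, 0 <= v i, \sum_i v i = 1 &
      forall i, \sum_j Amx i j * v j <= v i + e].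
Proof.
move=> e0; have r0 := rho_gt0 sol rad.
have : \forall x \near rho^'-, [/\ 0 < x, x < rho & forall ij : 'I_m * 'I_m,
    `|dHeval h ij.1 ij.2 zeta - dHeval h ij.1 ij.2 (P x)| < ofR e].
  near=> x; split; near: x; [exact: nbhs_left_gt|exact: nbhs_left_lt|].
  apply: filter_forall => -[i j] /=.
  have e0' : 0 < ofR e by rewrite ofR_gt0.
  have c := psder_P_cvg Ylim taudom (al := succ_at (rshift 1 j) zexp) (i := i).
  by have /cvgrPdist_lt := c; apply.
move=> /filter_ex [x [x0 xr close]].
pose d j := complex.Re (tau 0 j - gf y (ofR x) 0 j).
have Yt j := Y_le_tau wf sol rad Ylim j x0 xr.
have dE j : tau 0 j - gf y (ofR x) 0 j = ofR (d j) by apply: ge0_ofR; rewrite subr_ge0.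
have d0 j : 0 <= d j by rewrite -ofR_ge0 -dE subr_ge0.
pose Ax i j := complex.Re (dHeval h i j (P x)).
have Px0 v : 0 <= P x 0 v by exact: (P_ge0 wf sol rad v x0 xr).
have Pxz v : P x 0 v <= zeta 0 v by exact: (P_le_zeta wf sol rad Ylim v x0 xr).
have Pd : in_domain h (P x) by exact: (P_dom wf sol rad Ylim taudom x0 xr).
have cg i a : 0 <= h i a by exact: coef_ge0.
have AxE i j : dHeval h i j (P x) = ofR (Ax i j).
  apply: ge0_ofR; apply: psder_ge0 => //; exact: in_domain_bbounded.
have Acl i j : Amx i j <= Ax i j + e.
  have := close (i, j); rewrite /= AmxE AxE -rmorphB normr_ofR ltr_ofR.
  by rewrite ltr_norml => /andP[_]; lra.
have sub i : \sum_j Ax i j * d j <= d i.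
  have := psder_convex Kc (cg i) Px0 Pxz (in_domain_absconv Kc dz i)
    (fun j => in_domain_bbounded Kc i (succ_at j zexp) Pd).
  rewrite -/(Heval h i (P x)) -/(Heval h i zeta) (P_fix wf sol rad Ylim taudom i x0 xr).
  rewrite (zeta_fix wf sol rad Ylim taudom) -lerBrDl dE.
  rewrite big_split_ord big_ord1 /=.
  have t0 : 0 <= (zeta - P x) 0 (lshift m 0) * psder (succ_at (lshift m 0) zexp) (h i) (P x).
    rewrite mulr_ge0 ?rowBE ?subr_ge0 //; apply: psder_ge0 => //; exact: in_domain_bbounded.
  move=> H; have := le_trans _ H; rewrite -ler_ofR; apply.
  apply: le_trans (_ : \sum_(j < m) (zeta - P x) 0 (rshift 1 j) * dHeval h i j (P x) <= _);
    last by rewrite lerDr.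
  rewrite rmorph_sum; apply: ler_sum => j _.
  by rewrite rowBE !pt_r dE AxE rmorphM mulrC.
set S := \sum_j d j.
have S0 : 0 < S.
  have [j yj] := Y_lt_tau wf sol rad Ylim x0 xr.
  rewrite /S (bigD1 j) //= ltr_pwDl ?sumr_ge0 // lt_neqAle d0 andbT eq_sym.
  by apply: contraNneq yj => dj; rewrite eq_sym -subr_eq0 dE dj.
exists (fun j => d j / S); split.
- by move=> j; rewrite divr_ge0 // ltW.
- by rewrite -mulr_suml divff // gt_eqF.
move=> i; under eq_bigr do rewrite mulrA.
rewrite -mulr_suml ler_pdivrMr // mulrDl divfK ?gt_eqF //.
apply: le_trans (_ : \sum_j (Ax i j + e) * d j <= _).
  by apply: ler_sum => j _; rewrite ler_wpM2r.
under eq_bigr do rewrite mulrDl.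
by rewrite big_split /= -mulr_sumr lerD2r.
Unshelve. all: by end_near.
Qed.

Lemma subinvariant_vector : exists2 w : 'I_m -> R, forall i, 0 < w i &
  forall i, \sum_j Amx i j * w j <= w i.
Proof.
have [w [w0 [k wk] Aw]] := subinvariant_limit Amx_ge0 approx_subinvariant.
exists w => //; exact: (subinvariant_gt0 Amx_ge0 Amx_irr w0 wk Aw).
Qed.

Lemma char_det_eq0 : \det (1%:M - Amx) = 0.
Proof.
apply/eqP/negPn/negP => dn; have [w w0 Aw] := subinvariant_vector.
have [v v0 vA] := nonsingular_strict Amx_ge0 w0 Aw dn.
have r0 : 0 <= ofR rho by rewrite ofR_ge0 ltW // (rho_gt0 sol rad).
have cg i a : 0 <= h i a by exact: coef_ge0.
have tg j : 0 <= tau 0 j by exact/ltW/tau_gt0.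
have v0' i : 0 <= ofR (v i) by rewrite ofR_ge0.
have vA' i : 1 + \sum_j dHeval h i j zeta * ofR (v j) <= ofR (v i).
  have -> : \sum_j dHeval h i j zeta * ofR (v j) = ofR (\sum_j Amx i j * v j).
    by rewrite rmorph_sum; apply: eq_bigr => j _; rewrite AmxE rmorphM.
  by rewrite -(rmorph1 (@ofR R)) -rmorphD ler_ofR -(vA i) subrK.
have zf i := zeta_fix wf sol rad Ylim taudom i.
have [z [Z [z1 sZ]]] := exists_supersol Kc cg r0 tg dz zf v0' vA'.
have [r _ zr] := ge0_ofRP (le_trans r0 (ltW z1)).
move: z1 sZ; rewrite zr ltr_ofR => rr; exact: (no_supersol wf sol rad rr).
Qed.

Lemma z_dependent : exists i, re_psder (succ_at (lshift m 0) zexp) i != 0.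
Proof.
apply/existsP; rewrite -negb_forall; apply/negP => /forallP b0.
have hz i (a : {ffun 'I_(1 + m) -> nat}) : (0 < a (lshift m 0%R))%N -> h i a = 0.
  move=> a0; apply: (re_psder_eq0 (eqP (b0 i))); apply: ord_pt => [|j].
    by rewrite /succ_at eqxx.
  by rewrite /succ_at eq_rlshift.
have [az Hz] := z_independent (ofR (rho + 1)) hz (in_domain_absconv Kc dz).
have rr : rho < rho + 1 by lra.
apply: (no_supersol wf sol rad rr (Z := tau)); split=> //.
  by move=> j; exact/ltW/tau_gt0.
by move=> i; rewrite Hz (zeta_fix wf sol rad Ylim taudom).
Qed.

Lemma nonlinear : exists i j k,
  re_psder (succ_at (rshift 1 k) (succ_at (rshift 1 j) zexp)) i != 0.
Proof.
apply: contrapT => H; have [w w0 Aw] := subinvariant_vector.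
have [u u0 uA] := left_vector Amx_ge0 Amx_irr w0 Aw char_det_eq0.
have hd i (a : {ffun 'I_(1 + m) -> nat}) j k :
    (forall v, (succ_at (rshift 1 k) (succ_at (rshift 1 j) zexp) v <= a v)%N) -> h i a = 0.
  apply: re_psder_eq0; apply/eqP/negPn/negP => ne.
  by apply: H; exists i, j, k.
have r0 : 0 < ofR rho by rewrite ofR_gt0 (rho_gt0 sol rad).
have cg i a : 0 <= h i a by exact: coef_ge0.
have tg j : 0 <= tau 0 j by exact/ltW/tau_gt0.
have aff := affine_fixpoint Kc cg (ltW r0) tg dz hd.
have z0 v : 0 <= pt (ofR rho) (0 : 'rV[C]_m) 0 v.
  by move: v; apply: pt_ge0 => [|j]; [exact: ltW|rewrite mxE].
have a0 : absconv h (pt (ofR rho) 0).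
  apply: (absconv_le cg z0 _ (in_domain_absconv Kc dz)).
  by apply: pt_le => // j; rewrite mxE.
have H0 i : 0 <= Heval h i (pt (ofR rho) 0) by exact: Heval_ge0.
have Hsum : \sum_i ofR (u i) * Heval h i (pt (ofR rho) 0) = 0.
  have e i : Heval h i (pt (ofR rho) 0) = tau 0 i - \sum_j dHeval h i j zeta * tau 0 j.
    rewrite -(zeta_fix wf sol rad Ylim taudom i) -(aff i).
    rewrite [X in _ = _ + X - _](eq_bigr (fun j => dHeval h i j zeta * tau 0 j)) ?addrK //.
    by move=> j _; rewrite mulrC.
  under eq_bigr do rewrite e mulrBr mulr_sumr.
  rewrite sumrB exchange_big /= -sumrB big1 // => j _.
  under eq_bigr do rewrite AmxE mulrA -rmorphM.
  by rewrite -mulr_suml -rmorph_sum /= uA subrr.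
have Hi i : Heval h i (pt (ofR rho) 0) = 0.
  have F0 j : 0 <= ofR (u j) * Heval h j (pt (ofR rho) 0).
    by rewrite mulr_ge0 // ofR_ge0 ltW.
  have /(_ i isT)/eqP := psumr_eq0P (fun j _ => F0 j) Hsum.
  by rewrite mulf_eq0 gt_eqF ?ofR_gt0 // => /eqP.
have sZ : supersol h (ofR rho) 0.
  by split=> [j||i] //; rewrite ?Hi mxE.
(* This supersolution sits at [rho] and not beyond it, so the contradiction is different: the
   partial sums at [rho] are bounded by 0, hence all coefficients vanish, although the series is not
   constant. *)
have [k [i [_ /eqP]]] := y_nonconst sol rad; apply.
have [_ /(_ i)] := partial_sum_le wf sol rad r0 sZ k.+1.
rewrite mxE => /(le_trans (partial_sum_term wf sol rad k i (ltW r0))) yk.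
have yk0 := y_ge0 wf sol rad k i.
have : ofR rho ^+ k * y k 0 i = 0 by apply/eqP; rewrite eq_le yk mulr_ge0 // exprn_ge0 // ltW.
by move/eqP; rewrite mulf_eq0 gt_eqF ?exprn_gt0 // => /eqP.
Qed.

Let zeta' : 'rV[C]_(m + 1) := row_mx tau (ofR rho)%:M.

Lemma zYperm_zeta : zYperm zeta' = zeta.
Proof. by rewrite /zYperm row_mxKl row_mxEr mxE. Qed.

Lemma char_jac_unit : char_jac h zeta' \in unitmx.
Proof.
have [w w0 Aw] := subinvariant_vector; have [i0 bi0] := z_dependent.
(* The Jacobian at [zeta] read over [R], where [bordered_unitmx] applies; invertibility is
   unaffected by the field embedding. *)
pose J : 'M[R]_(m + 1) := \matrix_(k, l)
  match fintype.split l with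
  | inl j => (k == lshift 1 j)%:R - re_psder (succ_at (var_index k) zexp) j
  | inr _ => \sum_i \sum_j
      - re_psder (succ_at (var_index k) (succ_at (rshift 1 j) zexp)) i *
      cofactor (1%:M - Amx) i j
  end.
have Nmx : 1%:M - dHmx h zeta = map_mx (@ofR R) (1%:M - Amx).
  apply/matrixP => i j; rewrite map_mxB map_mx1 mxE [RHS]mxE; congr (_ + _).
  by rewrite mxE [RHS]mxE; congr (- _); rewrite mxE [RHS]mxE AmxE.
have JE : char_jac h zeta' = map_mx (@ofR R) J.
  apply/matrixP => k l; rewrite [RHS]mxE; case: (split_ordP l) => j ->.
    rewrite char_jac_l mxE (unsplitK (inl j : 'I_m + 'I_1)) zYperm_zeta.
    by rewrite rmorphB rmorph_nat re_psderE.
  rewrite (ord1 j) char_jac_r mxE (unsplitK (inr 0 : 'I_m + 'I_1)) zYperm_zeta.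
  rewrite rmorph_sum; apply: eq_bigr => i _; rewrite rmorph_sum; apply: eq_bigr => i' _.
  by rewrite Nmx cofactor_map_mx re_psderE -rmorphN -rmorphM.
rewrite JE map_unitmx.
apply: (@bordered_unitmx _ _ Amx Amx_ge0 Amx_irr w w0 Aw char_det_eq0 J
  (re_psder (succ_at (lshift m 0) zexp))
  (fun i j k => re_psder (succ_at (rshift 1 k) (succ_at (rshift 1 j) zexp)) i) i0) => //.
- by move=> i; exact: re_psder_ge0.
- by move=> i j k; exact: re_psder_ge0.
- exact: nonlinear.
- move=> k j; rewrite mxE (unsplitK (inl j : 'I_m + 'I_1)) var_index_l.
  by rewrite (inj_eq (@lshift_inj _ _)) mxE.
- move=> j; rewrite mxE (unsplitK (inl j : 'I_m + 'I_1)) var_index_r.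
  by rewrite eq_rlshift sub0r.
- move=> k; rewrite mxE (unsplitK (inr 0 : 'I_m + 'I_1)) var_index_l -sumrN.
  by apply: eq_bigr => i _; rewrite -sumrN; apply: eq_bigr => j _; rewrite mulNr.
Qed.

Lemma newton_characteristic : exists2 V : set 'rV[C]_(m + 1), nbhs zeta' V &
  newton_cvg_quadratically [set x | cvg_domain h (zY_of_Yz x)] (char_system h) V zeta'.
Proof.
have [D [nD Dd Dbd _ c2]] := in_domain_nbhs Kc dz.
pose E : set 'rV[C]_(m + 1) := [set x | D (zYperm x)].
have zYE x : zY_of_Yz x = zYperm x by rewrite /zY_of_Yz /zYperm mxE.
have nE : nbhs zeta' E.
  move: nD; rewrite !nbhs_ballP => -[r /= r0 rD]; exists r => //= x.
  rewrite -ball_normE /= => xr; apply: rD; rewrite -ball_normE /= -zYperm_zeta.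
  exact: le_lt_trans (zYperm_norm _ _) xr.
have F1 x j : E x -> char_system h x 0 (lshift 1 j) =
    x 0 (lshift 1 j) - Heval h j (zYperm x).
  move=> Ex; rewrite /char_system row_mxEl rowBE zYE HfunE.
  by rewrite !mxE.
have F2 x : E x -> char_system h x 0 (rshift m 0) = \det (1%:M - dHmx h (zYperm x)).
  move=> Ex; have dE : dHdY h (zY_of_Yz x) = dHmx h (zYperm x).
    by rewrite zYE; apply: dHdYE; exact: Dd Ex.
  have sE (c : C) : (c%:M : 'M[C]_1) 0 0 = c by rewrite mxE eqxx mulr1n.
  by rewrite /char_system dE row_mxEr sE.
have cF := c2on_char Dbd c2 F1 F2.
have cJ := c2on_char_jac c2.
have F0 : char_system h zeta' = 0.
  have Ez := nbhs_singleton nE.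
  apply/rowP => l; rewrite [RHS]mxE; case: (split_ordP l) => j ->.
    rewrite F1 // zYperm_zeta row_mxEl (zeta_fix wf sol rad Ylim taudom).
    exact: subrr.
  rewrite (ord1 j) F2 // zYperm_zeta.
  have -> : 1%:M - dHmx h zeta = map_mx (@ofR R) (1%:M - Amx).
    apply/matrixP => i i'; rewrite map_mxB map_mx1 mxE [RHS]mxE; congr (_ + _).
    by rewrite mxE [RHS]mxE; congr (- _); rewrite mxE [RHS]mxE AmxE.
  by rewrite det_map_mx char_det_eq0 rmorph0.
have [V [nV [c c0 HV]]] := newton_quadratic Kc cF cJ nE F0 char_jac_unit.
exists V => //; have [c' _ cc] := ge0_ofRP c0; exists c' => x0 Vx0.
have [H1 H2 H3] := HV x0 Vx0.
have nE' : newton (char_system h) = newton_step (char_system h) by [].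
rewrite nE'; split; [move=> k|exact: H2|move=> k]; last first.
  by rewrite -cc; exact: (H3 k).
have [Ek uk] := H1 k; split; last exact: uk.
have dk := Dd _ (nbhs_singleton Ek); rewrite -zYE in dk.
exact: (proj2 (cvg_domainP h _) dk).
Qed.

End CharacteristicPoint.

Unset Implicit Arguments.
Set Strict Implicit.

Theorem theorem4p6 (R : realType) (m : nat) (h : psystem R m)
    (y : nat -> 'rV[Cplx R]_m) (rho : R) (tau : 'rV[Cplx R]_m) :
  irreducible_system h ->
  gf_solution h y ->
  cvg_radius y = rho%:E ->
  gf y (ofR x) @[x --> rho^'-] --> tau ->
  cvg_domain h (zY (ofR rho) tau) ->
  let zeta : 'rV[Cplx R]_(m + 1) := row_mx tau (ofR rho)%:M in
  exists2 V : set 'rV[Cplx R]_(m + 1),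
    nbhs zeta V &
    newton_cvg_quadratically [set x | cvg_domain h (zY_of_Yz x)] (char_system h) V zeta.
Proof.
exact: newton_characteristic.
Qed.
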